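(* Let $n\ge 1$, let $a_1,\dots,a_n\in\mathbb{Q}$, and let $r$ be a positive integer with $ra_i\in\mathbb{Z}$ for all $i$. For each $p$, let $H^p(1,n;a_i)\subseteq\Omega^p(T(1,n))$ be the $\mathbb{C}$-span of the differential forms $\overline{\beta}(F)$ for $F\in\bigcup_{k+l=p}\mathcal{F}(1,n;a_i)^{k,l}$. Write $\omega=\sum_i a_i\omega_i$. Then: (1) $H^p(1,n;a_i)\subset\ker(d+\ell_{\omega}:\Omega^p(T(1,n))\to\Omega^{p+1}(T(1,n)))$. (2) The map sending each form to its class modulo $\mathrm{im}(d+\ell_{\omega}:\Omega^{p-1}(T(1,n))\to\Omega^{p}(T(1,n)))$ is an isomorphism $H^p(1,n;a_i)\to H^p(T(1,n),\mathcal{L}_{\omega})$. (3) $H^p(1,n;a_i)$ has basis $\{\overline{\beta}(F)\mid F\in\bigcup_{k+l=p}\mathcal{F}(1,n;a_i)^{\circ,k,l}\}$. (4) For $w\in Z_{(a_i)}$ and $F\in\mathcal{F}(1,n;a_i)^{k,l}$, $\ w.\overline{\beta}(F)=\varepsilon_n(w)\,\varepsilon(w,F)\,\overline{\beta}(w.F)$.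
   Context: Space and forms. $T(1,n)=\{(z_1,\dots,z_n)\in\mathbb{C}^n\mid z_i\ne0\ \forall i,\ z_i\neq z_j\ \forall i\ne j\}$. $\Omega^\bullet(T(1,n))$ is the graded algebra of regular (algebraic) differential forms on $T(1,n)$, with differential $d$; $\omega_i=dz_i/z_i$, $\omega_{i,j}=(dz_i-dz_j)/(z_i-z_j)$. $S_n$ acts on $\Omega^\bullet(T(1,n))$ by $w.z_i=z_{w(i)}$, $w.dz_i=dz_{w(i)}$, respecting wedge products. For a 1-form $\omega$, $\ell_\omega(\alpha)=\omega\wedge\alpha$. $\mathcal{L}_\omega$ is the rank-one local system on $T(1,n)$ whose local sections are the solutions of $df+f\omega=0$; there is a natural isomorphism, used as an identification, $H^p(T(1,n),\mathcal{L}_\omega)\cong\ker(d+\ell_\omega|_{\Omega^p(T(1,n))})/\mathrm{im}(d+\ell_\omega|_{\Omega^{p-1}(T(1,n))})$. $Z_{(a_i)}=\{w\in S_n\mid a_{w(i)}=a_i\ \forall i\}$ and $\varepsilon_n$ is the sign character of $S_n$. Forests. A directed tree on a nonempty finite set is a directed graph with that vertex set, without loops or cycles, with exactly one vertex (the root) of out-degree $0$ and all others of out-degree $1$. A directed forest on $\{1,\dots,n\}$ is a directed graph on this vertex set each of whose connected components is a directed tree. $\mathcal{F}(1,n)$ is the set of directed forests on $\{1,\dots,n\}$ equipped with a partition of the set of roots into open and closed roots; $i\to j$ means there is an edge from $i$ to $j$. $F$ is rectified if $i\to j$ implies $i<j$. $\mathcal{F}(1,n;a_i)$ is the set of $F\in\mathcal{F}(1,n)$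 such that $\sum_{i\in T}a_i\in\mathbb{Z}$ for every tree $T$ of $F$ (sum over vertices of $T$). $\mathcal{F}(1,n;a_i)^{k,l}$ is the subset of forests with $k$ edges and $l$ closed roots; $\mathcal{F}(1,n;a_i)^{\circ,k,l}$ is its subset of rectified forests. $S_n$ acts by relabelling vertices: $w.F$ has edges $w(i)\to w(j)$ for $i\to j$ in $F$, and $w(i)$ is an open (closed) root of $w.F$ iff $i$ is an open (closed) root of $F$. Signs. $\varepsilon_i(F)=(-1)^{i-1-|\{\text{open roots of }F\text{ which are }<i\}|}$ and $\varepsilon(w,F)=(-1)^{|\{(i,j)\,\mid\, i,j\text{ open roots of }F,\ i<j,\ w(i)>w(j)\}|}$. The forms $\overline{\beta}(F)$. For $F\in\mathcal{F}(1,n;a_i)$ let $\preceq$ be the partial order generated by $\to$ (so $i\preceq j$ iff there is a directed path, possibly of length $0$, from $i$ to $j$). Put $b_j(F)=-\lfloor\sum_{k\preceq j}a_k\rfloor+\sum_{i\to j}\lceil\sum_{k\preceq i}a_k\rceil$ (outer sum over all $i$ with $i\to j$ in $F$), and $\overline{\beta}(F)=\big(\prod_{j=1}^n z_j^{b_j(F)}\big)\,\overline{\beta}_1(F)\wedge\cdots\wedge\overline{\beta}_n(F)$, where $\overline{\beta}_i(F)=\varepsilon_i(F)\,r$ if $i$ is an open root of $F$; $\overline{\beta}_i(F)=\omega_i$ if $i$ is a closed root; $\overline{\beta}_i(F)=\omega_{i,j}$ if $i\to j$ in $F$ and $\sum_{k\preceq i}a_k\in\mathbb{Z}$; $\overline{\beta}_i(F)=(z_i-z_j)^{-1}(\omega_i-\omega_j)$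 if $i\to j$ in $F$ and $\sum_{k\preceq i}a_k\notin\mathbb{Z}$. *)

(* Defs.v *)
From HB Require Import structures.
From mathcomp Require Import fingroup perm.
From mathcomp Require Import all_boot all_order all_algebra ring.
From mathcomp Require Import boolp.
From mathcomp Require Import mpoly.

Set Implicit Arguments.
Unset Strict Implicit.
Unset Printing Implicit Defensive.

Import Order.TTheory GRing.Theory Num.Theory.
Local Open Scope ring_scope.
Local Open Scope quotient_scope.

Section LinearAlgebra.
Variables (K : fieldType) (V : lmodType K).

Definition in_span (I : finType) (A : {set I}) (v : I -> V) : {pred V} :=
  fun x => `[< exists c : I -> K, x = \sum_(i in A) c i *: v i >].

Definition lin_indep (I : finType) (A : {set I}) (v : I -> V) : Prop :=
  forall c : I -> K, \sum_(i in A) c i *: v i = 0 -> forall i, i \in A -> c i = 0.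

(* The family (v i)_(i in A), indexed without repetition, is a basis of the
   subspace S. *)
Definition is_basis (S : {pred V}) (I : finType) (A : {set I}) (v : I -> V) :=
  lin_indep A v /\ in_span A v =i S.

Lemma in_span_submod (I : finType) (A : {set I}) (v : I -> V) :
  submod_closed (in_span A v).
Proof.
split; first by apply/asboolP; exists (fun=> 0); rewrite big1 // => i; rewrite scale0r.
move=> k x y /asboolP[c ->] /asboolP[d ->]; apply/asboolP.
exists (fun i => k * c i + d i); rewrite scaler_sumr -big_split /=.
by apply: eq_bigr => i _; rewrite scalerA scalerDl.
Qed.

HB.instance Definition _ (I : finType) (A : {set I}) (v : I -> V) :=
  GRing.isSubmodClosed.Build K V (in_span A v) (in_span_submod A v).

Variable S : submodClosed V.

Record subspace := Subspace { subspace_val :> V; _ : subspace_val \in S }.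

HB.instance Definition _ := [isSub for subspace_val].
HB.instance Definition _ := [Choice of subspace by <:].
HB.instance Definition _ := [SubChoice_isSubLmodule of subspace by <:].

End LinearAlgebra.

(* The library forms the quotient of a Z-module by a zmodClosed predicate, but
   submodClosed does not inherit from zmodClosed, and the quotient carries no
   scaling. *)
Section QuotientModule.
Variables (K : fieldType) (V : lmodType K) (S : submodClosed V).

Definition submod_pred : {pred V} := fun x => x \in S.

Lemma submod_pred_zmod : zmod_closed submod_pred.
Proof. exact: GRing.submod_closedB (submodClosedP S). Qed.

HB.instance Definition _ := GRing.isZmodClosed.Build V submod_pred submod_pred_zmod.

Definition lquot := Quotient.quot submod_pred.
HB.instance Definition _ := GRing.Zmodule.on lquot.
HB.instance Definition _ := EqQuotient.on lquot.

Local Notation Q := lquot.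

Definition lclass (x : V) : Q := \pi_Q x.

Lemma lclass_is_zmod_morphism : zmod_morphism lclass.
Proof.
move=> x y; rewrite /lclass -[RHS]/(_ + _) -[- \pi_Q y]Quotient.pi_opp.
exact: Quotient.pi_add.
Qed.

HB.instance Definition _ := GRing.isZmodMorphism.Build V Q lclass
  lclass_is_zmod_morphism.

Lemma lclass_eq (x y : V) : (lclass x == lclass y) = (x - y \in S).
Proof. by rewrite -[RHS]/(x - y \in submod_pred) Quotient.idealrBE. Qed.

Definition quot_scale (k : K) (x : Q) : Q := lclass (k *: repr x).

Lemma lclass_repr (x : Q) : lclass (repr x) = x.
Proof. exact: reprK. Qed.

Lemma quot_scale_class k (x : V) : quot_scale k (lclass x) = lclass (k *: x).
Proof.
apply/eqP; rewrite lclass_eq -scalerBr; apply: (rpredZ (s := S)).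
by rewrite -lclass_eq lclass_repr.
Qed.

Lemma quot_scaleA k l x : quot_scale k (quot_scale l x) = quot_scale (k * l) x.
Proof. by rewrite [X in quot_scale k X]/quot_scale quot_scale_class scalerA. Qed.

Lemma quot_scale1 : left_id 1 quot_scale.
Proof. by move=> x; rewrite /quot_scale scale1r lclass_repr. Qed.

Lemma quot_scaleDr : right_distributive quot_scale +%R.
Proof.
move=> k x y; rewrite -(lclass_repr x) -(lclass_repr y) -raddfD.
by rewrite !quot_scale_class scalerDr raddfD.
Qed.

Lemma quot_scaleDl x : {morph quot_scale^~ x : k l / k + l}.
Proof. by move=> k l; rewrite /quot_scale scalerDl raddfD. Qed.

HB.instance Definition _ := GRing.Zmodule_isLmodule.Build K Q
  quot_scaleA quot_scale1 quot_scaleDr quot_scaleDl.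

Lemma lclass_is_scalable : scalable lclass.
Proof. by move=> k x; rewrite -quot_scale_class. Qed.

HB.instance Definition _ := GRing.isScalable.Build K V Q *:%R lclass
  lclass_is_scalable.

End QuotientModule.

Section RationalFunctions.
Variables (C : fieldType) (n : nat).

Local Notation poly := {mpoly C[n]}.
Definition ratfun := {fraction poly}.
HB.instance Definition _ := GRing.Field.on ratfun.

Definition frac_of (p : poly) : ratfun := @FracField.tofrac poly p.
HB.instance Definition _ := GRing.RMorphism.copy frac_of (@FracField.tofrac poly).

Definition z (i : 'I_n) : ratfun := frac_of 'X_i.

Definition numer (f : ratfun) : poly := \n_(repr f).
Definition denom (f : ratfun) : poly := \d_(repr f).

Definition partial (i : 'I_n) (f : ratfun) : ratfun :=
  frac_of (mderiv i (numer f) * denom f - numer f * mderiv i (denom f))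
  / frac_of (denom f) ^+ 2.

Definition perm_ratfun (w : 'S_n) (f : ratfun) : ratfun :=
  frac_of (msym w (numer f)) / frac_of (msym w (denom f)).

(* T(1,n) is the principal open subset of affine n-space where
   this polynomial does not vanish. *)
Definition arrangement : poly :=
  (\prod_(i < n) 'X_i) * \prod_(i < n) \prod_(j < n | (i < j)%N) ('X_i - 'X_j).

Definition regular : {pred ratfun} :=
  fun f => `[< exists (N : nat) (p : poly), f * frac_of arrangement ^+ N = frac_of p >].

Lemma regular_submod c f g : f \in regular -> g \in regular ->
  frac_of c%:MP * f + g \in regular.
Proof.
move=> /asboolP[N [p fN]] /asboolP[M [q gM]]; apply/asboolP.
exists (N + M)%N, (c%:MP * p * arrangement ^+ M + q * arrangement ^+ N).
move: arrangement fN gM => D fN gM.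
rewrite rmorphD !rmorphM !rmorphXn /= -fN -gM exprD; ring.
Qed.

Lemma regular0 : 0 \in regular.
Proof. by apply/asboolP; exists 0%N, 0; rewrite mul0r rmorph0. Qed.

Lemma frac_of_eq0 p : (frac_of p == 0) = (p == 0).
Proof. exact: tofrac_eq0. Qed.

Lemma denom_neq0 f : denom f != 0.
Proof. exact: denom_ratioP. Qed.

Lemma fracE (f : ratfun) : f = frac_of (numer f) / frac_of (denom f).
Proof.
have d0 : frac_of (denom f) != 0 by rewrite frac_of_eq0 denom_neq0.
apply: (mulIf d0); rewrite divfK //.
rewrite /numer /denom /frac_of -[X in X * _ = _](reprK f).
move: (repr f) => r; unlock FracField.tofrac.
rewrite -[X in X = _]FracField.pi_mul; apply/eqmodP => /=.
rewrite FracField.equivfE /FracField.mulf.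
by rewrite !numden_Ratio ?mulr1 ?mul1r ?oner_neq0 ?denom_ratioP // mulrC.
Qed.

Lemma fracP (p q p' q' : poly) : q != 0 -> q' != 0 ->
  frac_of p / frac_of q = frac_of p' / frac_of q' -> p * q' = p' * q.
Proof.
move=> q0 q'0 /eqP; rewrite eqr_div ?frac_of_eq0 // -!rmorphM /=.
by rewrite [_ == _]tofrac_eq => /eqP.
Qed.

Lemma partialE i (p q : poly) : q != 0 ->
  partial i (frac_of p / frac_of q)
  = frac_of (mderiv i p * q - p * mderiv i q) / frac_of q ^+ 2.
Proof.
move=> q0; rewrite /partial; have := fracE (frac_of p / frac_of q).
move: (numer _) (denom _) (denom_neq0 (frac_of p / frac_of q)) => a b b0.
move=> /(fracP q0 b0) E; have := congr1 (mderiv i) E; rewrite !mderivM => DE.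
apply/eqP; rewrite eqr_div ?expf_neq0 ?frac_of_eq0 //.
rewrite -!rmorphXn -!rmorphM /= [_ == _]tofrac_eq -subr_eq0; apply/eqP.
have {}DE : mderiv i p * b + p * mderiv i b
    - (mderiv i a * q + a * mderiv i q) = 0.
  by rewrite DE subrr.
have {}E : p * b - a * q = 0 by rewrite E subrr.
transitivity ((p * b - a * q) * (q * mderiv i b + b * mderiv i q)
   - b * q * (mderiv i p * b + p * mderiv i b
              - (mderiv i a * q + a * mderiv i q))).
  by ring.
by rewrite E DE mul0r mulr0 subr0.
Qed.

Lemma msym_neq0 (w : 'S_n) (p : poly) : p != 0 -> msym w p != 0.
Proof.
by apply: contraNneq => p0; rewrite -(inj_eq (@inj_msym _ _ w)) p0 rmorph0.
Qed.

Lemma perm_ratfunE (w : 'S_n) (p q : poly) : q != 0 ->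
  perm_ratfun w (frac_of p / frac_of q) = frac_of (msym w p) / frac_of (msym w q).
Proof.
move=> q0; rewrite /perm_ratfun; have := fracE (frac_of p / frac_of q).
move: (numer _) (denom _) (denom_neq0 (frac_of p / frac_of q)) => a b b0.
move=> /(fracP q0 b0) /(congr1 (msym w)); rewrite !msymM => E.
apply/eqP; rewrite eqr_div ?frac_of_eq0 ?msym_neq0 //.
by rewrite -2!(rmorphM frac_of) [_ == _]tofrac_eq E.
Qed.

Lemma partialD i : {morph partial i : f g / f + g}.
Proof.
move=> f g; rewrite (fracE f) (fracE g).
move: (numer f) (denom f) (denom_neq0 f) (numer g) (denom g) (denom_neq0 g).
move=> a b b0 c d d0.
rewrite addf_div ?frac_of_eq0 // -!rmorphM -rmorphD !partialE ?mulf_neq0 //.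
rewrite addf_div ?expf_neq0 ?frac_of_eq0 //; apply/eqP.
rewrite -!rmorphXn -!rmorphM -rmorphD eqr_div; last 2 first.
- by rewrite frac_of_eq0 expf_neq0 ?mulf_neq0.
- by rewrite frac_of_eq0 mulf_neq0 ?expf_neq0.
by rewrite -!rmorphM tofrac_eq !(mderivM, mderivD); apply/eqP; ring.
Qed.

Lemma partial_scale i c (f : ratfun) :
  partial i (frac_of c%:MP * f) = frac_of c%:MP * partial i f.
Proof.
rewrite (fracE f); move: (numer f) (denom f) (denom_neq0 f) => a b b0.
rewrite mulrA -rmorphM !partialE //.
rewrite mulrA -rmorphM; congr (frac_of _ / _).
by rewrite mderivM mderivC; ring.
Qed.

End RationalFunctions.

Section Forms.
Variables (C : fieldType) (n : nat).

Local Notation ratfun := (ratfun C n).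

(* Rational differential forms on affine n-space: alpha S is the coefficient of
   dz_(s_1) /\ ... /\ dz_(s_k), where S = {s_1 < ... < s_k}. *)
Definition form := {ffun {set 'I_n} -> ratfun}.
HB.instance Definition _ := GRing.Zmodule.on form.

Implicit Types (f : ratfun) (alpha beta : form) (S A B : {set 'I_n}).

Definition form_mul f alpha : form := [ffun S : {set 'I_n} => f * alpha S].

Definition form_scale (c : C) := form_mul (frac_of c%:MP).

Lemma form_scaleA c d alpha : form_scale c (form_scale d alpha) = form_scale (c * d) alpha.
Proof. by apply/ffunP => S; rewrite !ffunE mpolyCM rmorphM mulrA. Qed.

Lemma form_scale1 : left_id 1 form_scale.
Proof. by move=> alpha; apply/ffunP => S; rewrite !ffunE mpolyC1 rmorph1 mul1r. Qed.

Lemma form_scaleDr : right_distributive form_scale +%R.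
Proof. by move=> c alpha beta; apply/ffunP => S; rewrite !ffunE mulrDr. Qed.

Lemma form_scaleDl alpha : {morph form_scale^~ alpha : c d / c + d}.
Proof.
by move=> c d; apply/ffunP => S; rewrite !ffunE mpolyCD rmorphD mulrDl.
Qed.

HB.instance Definition _ := GRing.Zmodule_isLmodule.Build C form
  form_scaleA form_scale1 form_scaleDr form_scaleDl.

Lemma form_scaleE c alpha S : (c *: alpha) S = frac_of c%:MP * alpha S.
Proof. by rewrite ffunE. Qed.

Definition form0 f : form := [ffun S : {set 'I_n} => if S == set0 then f else 0].

Definition dz (i : 'I_n) : form := [ffun S : {set 'I_n} => (S == [set i])%:R].

Definition inversions A B := #|[set ij in setX A B | (ij.2 < ij.1)%N]|.

Definition wedge alpha beta : form :=
  [ffun S : {set 'I_n} => \sum_(A : {set 'I_n} | A \subset S)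
     (-1) ^+ inversions A (S :\: A) * (alpha A * beta (S :\: A))].

Definition dz_wedge S : form := \big[wedge/form0 1]_(i <- enum S) dz i.

Definition ext_d alpha : form :=
  \sum_(S : {set 'I_n}) \sum_(i < n)
    form_mul (partial i (alpha S)) (wedge (dz i) (dz_wedge S)).

Definition perm_form (w : 'S_n) alpha : form :=
  \sum_(S : {set 'I_n}) form_mul (perm_ratfun w (alpha S))
     (\big[wedge/form0 1]_(i <- enum S) dz (w i)).

(* The regular p-forms on T(1,n). *)
Definition Omega (p : nat) : {pred form} :=
  fun alpha => [forall S, (alpha S \in @regular C n)
                          && ((alpha S != 0) ==> (#|S| == p))].

Definition omega1 (i : 'I_n) : form := form_mul (z C i)^-1 (dz i).

Definition omega2 (i j : 'I_n) : form := form_mul (z C i - z C j)^-1 (dz i - dz j).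

Lemma Omega_submod p : submod_closed (Omega p).
Proof.
split=> [|c f g /forallP fP /forallP gP].
  by apply/forallP => S; rewrite ffunE regular0 eqxx.
apply/forallP => S; have /andP[fr fp] := fP S; have /andP[gr gp] := gP S.
have -> : (c *: f + g) S = frac_of c%:MP * f S + g S by rewrite ffunE form_scaleE.
apply/andP; split; first exact: regular_submod.
apply/implyP; apply: contraNT => Sp.
have := implyP fp; have := implyP gp; rewrite (negPf Sp).
have [->|_ /(_ isT)//] := eqVneq (g S) 0; have [->|_ _ /(_ isT)//] := eqVneq (f S) 0.
by move=> _ _; rewrite mulr0 addr0.
Qed.

HB.instance Definition _ p := GRing.isSubmodClosed.Build C form (Omega p)
  (Omega_submod p).

Lemma form_mul_linear f : linear (form_mul f).
Proof.
by move=> c g h; apply/ffunP => S; rewrite !ffunE; ring.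
Qed.

Lemma wedge_linear alpha : linear (wedge alpha).
Proof.
move=> c g h; apply/ffunP => S; rewrite !ffunE mulr_sumr -big_split /=.
by apply: eq_bigr => A _; rewrite !ffunE; ring.
Qed.

Lemma ext_d_linear : linear ext_d.
Proof.
move=> c g h; rewrite /ext_d scaler_sumr -big_split /=; apply: eq_bigr => S _.
rewrite scaler_sumr -big_split /=; apply: eq_bigr => i _.
rewrite ffunE form_scaleE partialD partial_scale.
by apply/ffunP => A; rewrite !ffunE; ring.
Qed.

End Forms.

Section Cohomology.
Variables (C : fieldType) (n : nat) (a : 'I_n -> rat).

Local Notation form := (form C n).

Definition omega : form := \sum_(i < n) (ratr (a i) : C) *: omega1 C i.

(* d + l_omega *)
Definition nabla (alpha : form) : form := ext_d alpha + wedge omega alpha.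

Lemma nabla_linear : linear nabla.
Proof.
by move=> c g h; rewrite /nabla ext_d_linear wedge_linear scalerDr addrACA.
Qed.

HB.instance Definition _ := GRing.isLinear.Build C form form *:%R nabla nabla_linear.

Definition cocycles (p : nat) : {pred form} :=
  fun alpha => (alpha \in Omega p) && (nabla alpha == 0).

Definition coboundaries (p : nat) : {pred form} :=
  fun alpha =>
    if p is q.+1 then `[< exists2 beta, beta \in Omega q & alpha = nabla beta >]
    else alpha == 0.

Lemma cocycles_submod p : submod_closed (cocycles p).
Proof.
split=> [|c f g /andP[fO /eqP f0] /andP[gO /eqP g0]].
  by apply/andP; rewrite rpred0 linear0.
apply/andP; split; first exact: (Omega_submod C n p).2 fO gO.
apply/eqP.
have -> : nabla (c *: f + g) = c *: nabla f + nabla g by exact: nabla_linear.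
by rewrite f0 g0 scaler0 addr0.
Qed.

HB.instance Definition _ p := GRing.isSubmodClosed.Build C form (cocycles p)
  (cocycles_submod p).

Definition coboundaries_in (p : nat) : {pred subspace (cocycles p)} :=
  fun alpha => coboundaries p (subspace_val alpha).

Lemma coboundaries_submod p : submod_closed (@coboundaries_in p).
Proof.
case: p => [|p]; split=> [|c f g].
- exact: eqxx.
- move=> /eqP f0 /eqP g0; apply/eqP.
  rewrite -[LHS]/(c *: subspace_val f + subspace_val g) f0 g0.
  by rewrite scaler0 addr0.
- by apply/asboolP; exists 0; [exact: rpred0 | rewrite linear0].
move=> /asboolP[b bO fb] /asboolP[b' b'O gb]; apply/asboolP.
exists (c *: b + b'); first exact: (Omega_submod C n p).2 bO b'O.
rewrite -[LHS]/(c *: subspace_val f + subspace_val g) fb gb.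
exact: esym (nabla_linear c b b').
Qed.

HB.instance Definition _ p := GRing.isSubmodClosed.Build C
  (subspace (cocycles p)) (@coboundaries_in p) (coboundaries_submod p).

(* H^p(T(1,n), L_omega), through its identification with the cohomology of
   (Omega^*(T(1,n)), d + l_omega). *)
Definition cohomology (p : nat) := lquot (@coboundaries_in p).
HB.instance Definition _ p := GRing.Lmodule.on (cohomology p).

Definition cohomology_class (p : nat) : subspace (cocycles p) -> cohomology p :=
  @lclass _ _ (@coboundaries_in p).

End Cohomology.

Section Forests.
Variable n : nat.

(* The edges, the open roots and the closed roots; (i, j) stands for i -> j. *)
Definition rooted_graph : finType :=
  ({set 'I_n * 'I_n} * {set 'I_n} * {set 'I_n})%type.

Implicit Types (E : {set 'I_n * 'I_n}) (T : {set 'I_n}) (F : rooted_graph).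

Definition edges F := F.1.1.
Definition open_roots F := F.1.2.
Definition closed_roots F := F.2.

Definition arrow E : rel 'I_n := fun i j => (i, j) \in E.

Definition outdeg E (i : 'I_n) := #|[set j | arrow E i j]|.

Definition loopless E := [forall i, ~~ arrow E i i].

Definition acyclic_digraph E :=
  [forall i, forall j, arrow E i j ==> ~~ connect (arrow E) j i].

Definition directed_tree T E :=
  [&& T != set0, E \subset setX T T, loopless E, acyclic_digraph E,
      #|[set i in T | outdeg E i == 0%N]| == 1%N
    & [forall i in T, (outdeg E i == 0) || (outdeg E i == 1)]%N].

Definition component E (i : 'I_n) : {set 'I_n} :=
  [set j | connect (fun x y => arrow E x y || arrow E y x) i j].

Definition components E : {set {set 'I_n}} := [set component E i | i : 'I_n].

Definition directed_forest E :=
  [forall T in components E, directed_tree T (E :&: setX T T)].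

Definition roots E : {set 'I_n} := [set i | outdeg E i == 0%N].

Definition forests : {set rooted_graph} :=
  [set F | [&& directed_forest (edges F),
               [disjoint open_roots F & closed_roots F]
             & open_roots F :|: closed_roots F == roots (edges F)]].

Definition rectified F := [forall i, forall j, arrow (edges F) i j ==> (i < j)%N].

Definition perm_forest (w : 'S_n) F : rooted_graph :=
  ([set (w e.1, w e.2) | e in edges F], w @: open_roots F, w @: closed_roots F).

Definition preceq F : rel 'I_n := connect (arrow (edges F)).

Variable a : 'I_n -> rat.

Definition stabilizer : {set 'S_n} := [set w : 'S_n | [forall i, a (w i) == a i]].

Definition int_forests : {set rooted_graph} :=
  [set F in forests | [forall T in components (edges F),
                         \sum_(i in T) a i \is a Num.int]].

Definition int_forests_kl (k l : nat) : {set rooted_graph} :=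
  [set F in int_forests | (#|edges F| == k) && (#|closed_roots F| == l)].

Definition rect_forests_kl (k l : nat) : {set rooted_graph} :=
  [set F in int_forests_kl k l | rectified F].

Definition int_forests_deg (p : nat) : {set rooted_graph} :=
  \bigcup_(k < p.+1) int_forests_kl k (p - k).

Definition rect_forests_deg (p : nat) : {set rooted_graph} :=
  \bigcup_(k < p.+1) rect_forests_kl k (p - k).

Definition weight F (j : 'I_n) : rat := \sum_(k | preceq F k j) a k.

Definition exponent F (j : 'I_n) : int :=
  - Num.floor (weight F j) + \sum_(i | arrow (edges F) i j) Num.ceil (weight F i).

(* Vertices are numbered from 0, so that val i is the i - 1 of the 1-based
   convention. *)
Definition sign_at F (i : 'I_n) : nat :=
  (i - #|[set j in open_roots F | (j < i)%N]|)%N.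

Definition perm_sign_exp (w : 'S_n) F : nat :=
  #|[set ij in setX (open_roots F) (open_roots F) |
       (ij.1 < ij.2)%N && (w ij.2 < w ij.1)%N]|.

Variables (C : fieldType) (r : nat).

Definition edge_form F (i j : 'I_n) : form C n :=
  if weight F i \is a Num.int then omega2 C i j
  else form_mul (z C i - z C j)^-1 (omega1 C i - omega1 C j).

(* In a forest, a vertex i which is not a root has exactly one out-neighbour j,
   so that the sum has exactly one term. *)
Definition beta_factor F (i : 'I_n) : form C n :=
  if i \in open_roots F then form0 ((-1) ^+ sign_at F i * r%:R)
  else if i \in closed_roots F then omega1 C i
  else \sum_(j | arrow (edges F) i j) edge_form F i j.

Definition beta_bar F : form C n :=
  form_mul (\prod_(j < n) z C j ^ exponent F j)
    (\big[@wedge C n/form0 1]_(i < n) beta_factor F i).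

Definition Hspan (p : nat) : {pred form C n} :=
  in_span (int_forests_deg p) beta_bar.
HB.instance Definition _ p := GRing.SubmodClosed.on (Hspan p).

End Forests.

Arguments cohomology C {n} a p.
Arguments beta_bar {n} a C r F.
Arguments Hspan {n} a C r p.

(* Main.v *)
Require Import Defs.
From HB Require Import structures.
From mathcomp Require Import fingroup perm.
From mathcomp Require Import all_boot all_order all_algebra ring lra zify.
From mathcomp Require Import boolp mpoly.
From mathcomp Require Import reals complex.

(** Why the theorem holds.

    To every vertex [i] of a rooted forest is attached a code: an edge to [j], a
    closed root or an open root. A code and a weight [q] define an operator on
    forms, the block of [i]: left multiplication by a 1-form, or by a function for
    an open root. Its normalisation makes that 1-form closed for the differential
    [d + q (omega_i - omega_j)] for an edge, [d + q omega_i] for a root. Hence a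
    block intertwines, up to sign, [d + l_omega] with the same differential for
    the exponents in which [a_i] has been passed on to the target of the edge
    ([nab_block]). Up to a nonzero constant, the product of the blocks of a
    forest, each taken with the weight of its vertex, is [beta_bar] ([beta_barE]).

    The cohomology is computed by integrating out one variable after the other, [z_1]
    first. Over the ring [A] of regular functions of the other variables, the
    fibre is a line with the punctures 0 and [z_l], and its functions have partial
    fractions. These show that modulo the image of [D + a_k / z_k] the functions
    are freely generated over [A] by the coefficients of the blocks of [k], one
    for each edge to another variable and one for the closed root if [a_k] is an
    integer, and that the kernel is generated by the open root if [a_k] is an
    integer and vanishes otherwise ([fiber_exists], [fiber_unique],
    [fiber_horizontal]). By induction, every cocycle is cohomologous to a
    combination of products of valid blocks ([cocycle_span]), and these products
    are independent modulo exact forms ([independence]). As an edge always points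
    to a variable that is still present, the valid sequences of codes are those of
    the rectified forests all of whose trees have integral sums
    ([valid_code_forest], [rect_forest_code]).

    An arbitrary forest is built by adding leaves one by one, so it remains to see
    that the span of the products of valid blocks is stable under the block of a
    leaf that does not come first in the order ([bspan_leaf]). Blocks commute up
    to sign, and the only obstruction to moving the new block to its place is an
    edge to an earlier vertex: it is resolved by the Arnold relation
    ([block_three_term]), or by reversing the edge if its target is a root
    ([block_reverse_open], [block_reverse_closed]). Thus the span of all the
    [beta_bar] consists of cocycles and is the span of the rectified ones, which
    gives the first three assertions once everything is restricted to one degree.

    For the last one, a permutation of the variables permutes the blocks, and sorting
    them costs one sign for every inversion between two vertices that are not open
    roots. The signs in the factors of the open roots account for the inversions
    between an open root and another vertex, and what remains of the sign of [w]
    is the sign of the inversions between open roots ([equivariance_sign]). *)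

Set Implicit Arguments.
Unset Strict Implicit.
Unset Printing Implicit Defensive.

Import Order.TTheory GRing.Theory Num.Theory.
Local Open Scope ring_scope.

(** * Derivations and orders of poles *)

Section Localization.
Variables (K : fieldType) (A : {pred K}) (ps : seq K) (x : K).

Definition poles (t : K) : K := \prod_(p <- ps) (t - p).

(** The functions with coefficients in [A] and poles in [ps], as a set of values
    at one element [x], which will be transcendental over [A]. *)
Definition loc : {pred K} := fun f =>
  `[< exists N (Q : {poly K}), Q \is a polyOver A /\ f = Q.[x] / poles x ^+ N >].

Lemma locP f :
  reflect (exists N (Q : {poly K}), Q \is a polyOver A /\ f = Q.[x] / poles x ^+ N)
          (f \in loc).
Proof. exact: asboolP. Qed.

End Localization.

Section Derivations.
Variables (K : fieldType) (D : K -> K).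

Definition derivation :=
  (forall f g, D (f + g) = D f + D g) /\ (forall f g, D (f * g) = D f * g + f * D g).

Hypothesis hD : derivation.

Lemma derD f g : D (f + g) = D f + D g. Proof. exact: hD.1. Qed.
Lemma derM f g : D (f * g) = D f * g + f * D g. Proof. exact: hD.2. Qed.
Lemma der0 : D 0 = 0.
Proof. by apply: (addrI (D 0)); rewrite -derD !addr0. Qed.
Lemma derN f : D (- f) = - D f.
Proof. by apply: (addrI (D f)); rewrite -derD !subrr der0. Qed.
Lemma derB f g : D (f - g) = D f - D g. Proof. by rewrite derD derN. Qed.
Lemma der1 : D 1 = 0.
Proof. by apply: (addrI (D 1)); rewrite addr0 -[in RHS](mulr1 1) derM mulr1 mul1r. Qed.
Lemma derV f : f != 0 -> D f^-1 = - D f / f ^+ 2.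
Proof.
move=> f0; have := der1; rewrite -(divff f0) derM => E.
apply: (mulfI f0); apply: (addrI (D f / f)); rewrite E.
by field.
Qed.
Lemma der_div f g : g != 0 -> D (f / g) = (D f * g - f * D g) / g ^+ 2.
Proof. by move=> g0; rewrite derM derV //; field. Qed.
Lemma derX f n : D (f ^+ n) = n%:R * f ^+ n.-1 * D f.
Proof.
elim: n => [|n IH]; first by rewrite expr0 der1 !mul0r.
rewrite exprS derM IH; case: n {IH} => [|n] /=.
  by rewrite !expr0 mul0r mul0r mulr0 addr0 mulr1 !mul1r.
by rewrite exprS -addn1 !natrD; ring.
Qed.
Lemma der_natr n : D n%:R = 0.
Proof. by elim: n => [|n IH]; rewrite ?der0 // -addn1 natrD derD IH der1 addr0. Qed.
Lemma derXz f (m : int) : f != 0 -> D (f ^ m) = m%:~R * f ^ (m - 1) * D f.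
Proof.
move=> f0; case: m => [[|n]|n].
- by rewrite expr0z der1 !mul0r.
- by rewrite -[f ^ Posz n.+1]/(f ^+ n.+1) derX /= intS addrAC subrr add0r.
rewrite NegzE -exprz_inv -[_ ^ _]/(f^-1 ^+ n.+1) derX derV //=.
rewrite expfzDr // -exprz_inv -[_ ^ Posz n.+1]/(f^-1 ^+ n.+1) exprN1 mulrNz (exprS f^-1 n).
rewrite -[(Posz n.+1)%:~R]/(n.+1%:R : K).
by field; rewrite f0.
Qed.

Lemma der_horner (Q : {poly K}) (t : K) :
  D Q.[t] = (map_poly D Q).[t] + Q^`().[t] * D t.
Proof.
have map_polyD0 : forall (P : {poly K}) i, (map_poly D P)`_i = D P`_i.
  by move=> P i; rewrite coef_map_id0 ?der0.
elim/poly_ind: Q => [|Q c IH].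
  rewrite deriv0 !horner0 (_ : map_poly _ _ = 0) ?horner0 ?der0 ?mul0r ?addr0 //.
  by apply/polyP => i; rewrite map_polyD0 !coef0 der0.
rewrite derivMXaddC (_ : map_poly D _ = map_poly D Q * 'X + (D c)%:P); last first.
  apply/polyP => i; rewrite map_polyD0 !coefD !coefMX !coefC derD.
  by case: i => [|i] /=; rewrite ?map_polyD0 ?der0.
rewrite !hornerE derD derM IH.
ring.
Qed.

End Derivations.

Section PoleOrder.
Variable K : fieldType.
Hypothesis char0 : forall m, m.+1%:R != 0 :> K.
Implicit Types P Q U W T S : {poly K}.

(** The last identity is multiplied by ['X - y], so that it also holds for the
    order [m = 0]. *)
Lemma local_factor (y : K) P : P != 0 ->
  exists m Q, [/\ Q.[y] != 0, P = ('X - y%:P) ^+ m * Q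
    & ('X - y%:P) * P^`() = ('X - y%:P) ^+ m * (m%:R *: Q + ('X - y%:P) * Q^`())].
Proof.
move=> P0; have [m [Q Qy PE]] := multiplicity_XsubC P y.
exists m, Q; split; first by move: Qy; rewrite P0.
  by rewrite PE mulrC.
rewrite PE derivM deriv_exp derivXsubC mul1r -mulr_natl -mul_polyC.
rewrite (rmorph_nat (@polyC K)) => {Qy PE}.
by case: m => [|m] /=; rewrite ?exprS; ring.
Qed.

Let hE := (horner_exp, hornerM, hornerD, hornerN, hornerZ, hornerC).

(** With [f = Q / U] the equation is [W f' + s f = S / (('X - y) T)]. If [f] has a
    pole at [y], the left side has a pole of order at least 2, otherwise it has
    none: it never has a simple pole, so the residue of the right side at [y]
    vanishes. *)
Lemma pole_argument (y s : K) Q U W T S :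
  U != 0 -> W.[y] != 0 -> T.[y] != 0 ->
  (W * (Q^`() * U - Q * U^`()) + s%:P * (Q * U)) * (('X - y%:P) * T) = U ^+ 2 * S ->
  S.[y] = 0.
Proof.
move=> U0 Wy Ty; have [->|Q0] := eqVneq Q 0.
  rewrite deriv0 !(mul0r, mulr0, subr0, addr0) => /esym/eqP.
  by rewrite mulf_eq0 expf_eq0 (negPf U0) => /eqP->; rewrite horner0.
have [q [Q1 [Q1y QE Q'E]]] := local_factor y Q0.
have [u [U1 [U1y UE U'E]]] := local_factor y U0.
set E := 'X - y%:P in QE Q'E UE U'E * => //.
have E0 : E != 0 by rewrite polyXsubC_eq0.
have Ey : E.[y] = 0 by rewrite hornerXsubC subrr.
clearbody E => H.
have {}H : E ^+ q * E ^+ u * ((W * ((q%:R - u%:R) *: (Q1 * U1)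
     + E * (Q1^`() * U1 - Q1 * U1^`())) + s%:P * (E * Q1 * U1)) * T)
     = (E ^+ u) ^+ 2 * (U1 ^+ 2 * S).
  rewrite [RHS]mulrA -exprMn -UE -H.
  transitivity ((W * ((E * Q^`()) * U - Q * (E * U^`())) + s%:P * (E * (Q * U))) * T);
    last by ring.
  rewrite Q'E U'E QE UE -!mul_polyC polyCB; ring.
have [qu|uq|qu] := ltngtP q u.
- have {}H : (W * ((q%:R - u%:R) *: (Q1 * U1) + E * (Q1^`() * U1 - Q1 * U1^`()))
       + s%:P * (E * Q1 * U1)) * T = E ^+ (u - q) * (U1 ^+ 2 * S).
    apply: (mulfI (_ : E ^+ q * E ^+ u != 0)); first by rewrite mulf_neq0 ?expf_neq0.
    have Eu : E ^+ u = E ^+ (u - q) * E ^+ q by rewrite -exprD subnK ?(ltnW qu).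
    by move: H; rewrite Eu; move: (E ^+ _) (E ^+ q) => e f -> ; ring.
  move/(congr1 (fun P => P.[y])): H.
  rewrite !hE Ey expr0n subn_eq0 leqNgt qu /= !(mul0r, mulr0, addr0).
  move/eqP; rewrite !mulf_eq0 (negPf Wy) (negPf Ty) (negPf Q1y) (negPf U1y) !orbF /=.
  rewrite -opprB oppr_eq0 -natrB ?(ltnW qu) //; move: qu; rewrite -subn_gt0.
  by case: (u - q)%N => // m _; rewrite (negPf (char0 m)).
- have {}H : E ^+ (q - u) * ((W * ((q%:R - u%:R) *: (Q1 * U1) + E * (Q1^`() * U1 - Q1 * U1^`()))
       + s%:P * (E * Q1 * U1)) * T) = (U1 ^+ 2 * S).
    apply: (mulfI (_ : (E ^+ u) ^+ 2 != 0)); first by rewrite !expf_neq0.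
    have Eq : E ^+ q = E ^+ (q - u) * E ^+ u by rewrite -exprD subnK ?(ltnW uq).
    by move: H; rewrite Eq; move: (E ^+ (q - u)) (E ^+ u) => e f <-; ring.
  move/(congr1 (fun P => P.[y])): H.
  rewrite !hE Ey expr0n subn_eq0 leqNgt uq /= !mul0r.
  by move/esym/eqP; rewrite mulf_eq0 expf_eq0 (negPf U1y) => /eqP.
move: H; rewrite qu subrr scale0r add0r -expr2.
move/(mulfI (expf_neq0 2 (expf_neq0 u E0)))/(congr1 (fun P => P.[y])).
rewrite !hE Ey !(mul0r, mulr0, addr0).
by move/esym/eqP; rewrite mulf_eq0 expf_eq0 (negPf U1y) => /eqP.
Qed.

(** At the lowest order at 0, [x f' = - s f] says that [- s] is the order of [f].
    *)
Lemma no_solution (s : K) Q U : U != 0 -> (forall m : int, s + m%:~R != 0) ->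
  'X * (Q^`() * U - Q * U^`()) + s%:P * (Q * U) = 0 -> Q = 0.
Proof.
move=> U0 sZ H; apply/eqP; apply: contraT => Q0.
have [q [Q1 [Q1y QE Q'E]]] := local_factor 0 Q0.
have [u [U1 [U1y UE U'E]]] := local_factor 0 U0.
rewrite subr0 in QE Q'E UE U'E.
have {}H : 'X ^+ q * 'X ^+ u * ((q%:R - u%:R) *: (Q1 * U1)
     + 'X * (Q1^`() * U1 - Q1 * U1^`()) + s%:P * (Q1 * U1)) = 0.
  rewrite -[RHS]H.
  transitivity ((('X * Q^`()) * U - Q * ('X * U^`())) + s%:P * (Q * U)); last by ring.
  rewrite Q'E U'E QE UE -!mul_polyC polyCB; ring.
move/eqP: H; rewrite !mulf_eq0 !expf_eq0 polyX_eq0 !andbF /= => /eqP.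
move/(congr1 (fun P => P.[0])); rewrite !hE hornerX !(mul0r, addr0).
rewrite -mulrDl => /eqP; rewrite !mulf_eq0 (negPf Q1y) (negPf U1y) !orbF addrC.
by have := sZ (q%:Z - u%:Z); rewrite rmorphB /= => /negPf->.
Qed.
End PoleOrder.

(** * The twisted derivative on a punctured line *)

Section Fiber.
Variables (K : fieldType) (A : subringClosed K) (D : K -> K) (x : K) (ps : seq K).
Hypothesis hD : derivation D.
Hypothesis Dx : D x = 1.
Hypothesis DA : {in A, forall c, D c = 0}.
Hypothesis char0 : forall m, m.+1%:R != 0 :> K.
Hypothesis natV : forall m, (m.+1%:R : K)^-1 \in A.
Hypothesis ups : uniq ps.
Hypothesis psA : {subset ps <= A}.
Hypothesis psV : {in ps &, forall p q, (p - q)^-1 \in A}.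

Local Notation B := (loc A ps x).
Local Notation PT := (\prod_(p <- ps) ('X - p%:P)).

(** By descent on the derivative. This turns equalities between values at [x] into
    equalities between polynomials, where orders of poles can be compared. *)
Lemma transcendental (Q : {poly K}) : (forall i, D Q`_i = 0) -> Q.[x] = 0 -> Q = 0.
Proof.
move: {2}(size Q) (leqnn (size Q)) => m.
elim: m Q => [|m IH] Q; first by rewrite leqn0 size_poly_eq0 => /eqP.
move=> szQ DQ Qx; have := der_horner hD Q x; rewrite Qx (der0 hD) Dx mulr1.
rewrite (_ : map_poly D Q = 0) ?horner0 ?add0r; last first.
  by apply/polyP => i; rewrite coef_map_id0 ?DQ ?coef0 ?(der0 hD).
move/esym/IH => Q'0.
have {Q'0} : Q^`() = 0.
  apply: Q'0 => [|i].
    have [->|Q0] := eqVneq Q 0; first by rewrite deriv0 size_poly0.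
    by rewrite -ltnS (leq_trans (lt_size_deriv Q0)).
  by rewrite coef_deriv -mulr_natl (derM hD) (der_natr hD) DQ mul0r mulr0 addr0.
move=> Q'0; have QC : Q = (Q`_0)%:P.
  apply/polyP => -[|i]; rewrite coefC //=.
  have := congr1 (fun P : {poly K} => P`_i) Q'0; rewrite coef_deriv coef0 -mulr_natl.
  by move/eqP; rewrite mulf_eq0 (negPf (char0 _)) => /eqP.
by move: QC Qx; move: (Q`_0) => c ->; rewrite hornerC => ->.
Qed.

Lemma sub_neq0 p : p \in A -> x - p != 0.
Proof.
move=> pA; apply: contra_neq (oner_neq0 K) => /(congr1 D).
by rewrite (derB hD) Dx (der0 hD) DA ?subr0.
Qed.

Lemma poles_neq0 : poles ps x != 0.
Proof.
rewrite /poles prodf_seq_neq0; apply/allP => p pps /=.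
exact: sub_neq0 (psA pps).
Qed.

Lemma PT_horner : PT.[x] = poles ps x.
Proof. by rewrite horner_prod; apply: eq_bigr => p _; rewrite hornerXsubC. Qed.

Lemma PT_monic : PT \is monic. Proof. exact: monic_prod_XsubC. Qed.

Lemma PT_over : PT \is a polyOver A.
Proof.
rewrite big_seq; apply: rpred_prod => p pps.
by rewrite polyOverXsubC psA.
Qed.

Lemma loc_poly (Q : {poly K}) : Q \is a polyOver A -> Q.[x] \in B.
Proof. by move=> QA; apply/locP; exists 0%N, Q; rewrite expr0 divr1. Qed.

Lemma loc_const c : c \in A -> c \in B.
Proof. by move=> cA; rewrite -[c](hornerC c x) loc_poly ?polyOverC. Qed.

Lemma loc_x : x \in B.
Proof. by rewrite -{1}[x]hornerX loc_poly // polyOverX. Qed.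

Lemma loc_subring : subring_closed B.
Proof.
split; first exact: loc_const (rpred1 _).
  move=> f g /locP[N [Q [QA ->]]] /locP[M [P [PA ->]]]; apply/locP.
  exists (N + M)%N, (Q * PT ^+ M - P * PT ^+ N); split.
    by rewrite rpredB // rpredM // rpredX // PT_over.
  rewrite !(hornerD, hornerN, hornerM, horner_exp) PT_horner exprD.
  by have := poles_neq0; move: (poles _ _) => T T0; field; rewrite ?expf_neq0.
move=> f g /locP[N [Q [QA ->]]] /locP[M [P [PA ->]]]; apply/locP.
exists (N + M)%N, (Q * P); split; first by rewrite rpredM.
rewrite hornerM exprD.
by have := poles_neq0; move: (poles _ _) => T T0; field; rewrite ?expf_neq0.
Qed.

Lemma loc0 : 0 \in B. Proof. exact: loc_const (rpred0 _). Qed.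
Lemma locM f g : f \in B -> g \in B -> f * g \in B.
Proof. by have [_ _] := loc_subring; apply. Qed.
Lemma locN f : f \in B -> - f \in B.
Proof. by have [_ lB _] := loc_subring; rewrite -sub0r; apply: lB; apply: loc0. Qed.
Lemma locD f g : f \in B -> g \in B -> f + g \in B.
Proof. by have [_ lB _] := loc_subring => fB gB; rewrite -[g]opprK lB ?locN. Qed.
Lemma locX f m : f \in B -> f ^+ m \in B.
Proof. by elim: m => [|m IH] fB; [apply: loc_const (rpred1 _)|rewrite exprS locM ?IH]. Qed.

Lemma loc_pole p : p \in ps -> (x - p)^-1 \in B.
Proof.
move=> pps; apply/locP; exists 1%N, (\prod_(q <- rem p ps) ('X - q%:P)).
have psE := perm_to_rem pps.
split.
  rewrite big_seq; apply: rpred_prod => q /mem_rem qps.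
  by rewrite polyOverXsubC psA.
have p0 := sub_neq0 (psA pps); have := poles_neq0.
rewrite /poles (perm_big _ psE) big_cons /= expr1 horner_prod.
have -> : \prod_(q <- rem p ps) ('X - q%:P).[x] = \prod_(q <- rem p ps) (x - q).
  by apply: eq_bigr => q _; rewrite hornerXsubC.
by rewrite mulf_eq0 negb_or => /andP[_ T0]; field; rewrite ?p0 ?T0.
Qed.

(** An inductive predicate lets the closure under division by [x - p] be proved
    one elementary fraction at a time. *)
Inductive partial_fraction : K -> Prop :=
  | pf_pow c m : c \in A -> partial_fraction (c * x ^+ m)
  | pf_pole c p m : c \in A -> p \in ps -> partial_fraction (c * (x - p) ^- m.+1)
  | pf_add f g : partial_fraction f -> partial_fraction g -> partial_fraction (f + g).

Lemma pf_scale c f : c \in A -> partial_fraction f -> partial_fraction (c * f).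
Proof.
move=> cA; elim=> [d m dA|d p m dA pps|g h _ IHg _ IHh].
- by rewrite mulrA; apply: pf_pow; rewrite rpredM.
- by rewrite mulrA; apply: pf_pole; rewrite ?rpredM.
by rewrite mulrDr; apply: pf_add.
Qed.

Lemma pf_const c : c \in A -> partial_fraction c.
Proof. by move=> cA; rewrite -[c]mulr1 -(expr0 x); apply: pf_pow. Qed.

Lemma pf_pole0 c p m : c \in A -> p \in ps -> partial_fraction (c * (x - p) ^- m).
Proof.
move=> cA pps; case: m => [|m]; last exact: pf_pole.
by rewrite expr0 invr1 mulr1; apply: pf_const.
Qed.

Lemma pf_mulx f : partial_fraction f -> partial_fraction (f * x).
Proof.
elim=> [c m cA|c p m cA pps|g h _ IHg _ IHh].
- by rewrite -mulrA -exprSr; apply: pf_pow.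
- have -> : c * (x - p) ^- m.+1 * x = c * (x - p) ^- m + (c * p) * (x - p) ^- m.+1.
    have p0 := sub_neq0 (psA pps).
    have -> : (x - p) ^- m = (x - p) * (x - p) ^- m.+1.
      by rewrite exprS; field; rewrite expf_neq0 ?p0.
    by ring.
  apply: pf_add; [exact: pf_pole0 | apply: pf_pole => //].
  by apply: rpredM => //; apply: psA.
by rewrite mulrDl; apply: pf_add.
Qed.

Lemma pf_div p f : p \in ps -> partial_fraction f -> partial_fraction (f / (x - p)).
Proof.
move=> pps; have p0 := sub_neq0 (psA pps).
elim=> [c m cA|c q m cA qps|g h _ IHg _ IHh]; last by rewrite mulrDl; apply: pf_add.
- rewrite -mulrA; apply: pf_scale => //.
  elim: m => [|m IH].
    by rewrite expr0 mul1r -[_^-1]mul1r -[x - p]expr1; apply: pf_pole; rewrite ?rpred1.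
  have -> : x ^+ m.+1 / (x - p) = 1 * x ^+ m + p * (x ^+ m / (x - p)).
    by rewrite exprS; field.
  apply: pf_add; first by apply: pf_pow; rewrite rpred1.
  by apply: pf_scale => //; apply: psA.
rewrite -mulrA; apply: pf_scale => //.
have [->|qp] := eqVneq q p.
  rewrite -invfM -exprSr -[_^-1]mul1r; apply: pf_pole => //; exact: rpred1.
have q0 := sub_neq0 (psA qps).
have pq0 : p - q != 0 by rewrite subr_eq0 eq_sym.
suff H : forall m, partial_fraction ((x - q) ^- m / (x - p)) by apply: H.
elim=> [|k IH].
  by rewrite expr0 invr1 -[x - p]expr1; apply: pf_pole; rewrite ?rpred1.
have -> : (x - q) ^- k.+1 / (x - p)
    = (p - q)^-1 * ((x - q) ^- k / (x - p) + (-1) * (x - q) ^- k.+1).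
  have -> : (x - q) ^- k = (x - q) * (x - q) ^- k.+1.
    by rewrite exprS; field; rewrite expf_neq0 ?q0.
  by move: (_ ^- _) => t; field; rewrite p0 pq0.
apply: pf_scale; first exact: psV.
apply: pf_add => //; apply: pf_pole => //; by rewrite rpredN rpred1.
Qed.

Lemma pf_loc f : f \in B -> partial_fraction f.
Proof.
case/locP=> N [Q [QA ->]]; elim: N => [|N IH].
  rewrite expr0 divr1; elim/poly_ind: Q QA => [|Q c IH] QA.
    by rewrite horner0; apply: pf_const; exact: rpred0.
  rewrite hornerMXaddC; apply: pf_add.
    apply: pf_mulx; apply: IH; apply/polyOverP => i.
    by have /polyOverP/(_ i.+1) := QA; rewrite coefD coefMX coefC /= addr0.
  apply: pf_const.
  by have /polyOverP/(_ 0%N) := QA; rewrite coefD coefMX coefC /= add0r.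
rewrite exprS invfM mulrCA mulrC; move: IH; move: (_ / _) => g.
have : {subset ps <= ps} by [].
rewrite /poles; elim: {1 3}ps g => [|p l IHl] g lps pg.
  by rewrite big_nil invr1 mulr1.
rewrite big_cons invfM mulrA; apply: IHl; first by move=> q ql; rewrite lps ?inE ?ql ?orbT.
by apply: pf_div => //; rewrite lps ?mem_head.
Qed.

Section Twist.
Variable s : K.
Hypothesis sA : s \in A.
Local Notation Ds g := (D g + s / x * g).

Lemma twistD f g : Ds (f + g) = Ds f + Ds g.
Proof. by rewrite (derD hD); ring. Qed.

Lemma twist_scale c f : c \in A -> Ds (c * f) = c * Ds f.
Proof. by move=> cA; rewrite (derM hD) (DA cA); ring. Qed.

Definition reduced (c : K -> K) f :=
  exists2 g, g \in B & f = Ds g + \sum_(p <- ps) c p / (x - p).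

(** If [s != 0] the representative is normalised to have no residue at 0. *)
Definition reducible f :=
  exists c, [/\ (forall p, c p \in A), s = 0 \/ c 0 = 0 & reduced c f].

Lemma reducible_add f g : reducible f -> reducible g -> reducible (f + g).
Proof.
move=> [c [cA c0 [f' f'B ->]]] [d [dA d0 [g' g'B ->]]].
exists (fun p => c p + d p); split=> [p||].
- by rewrite rpredD.
- by case: c0 => [|->]; [left|case: d0 => [|->]; [left|right; rewrite addr0]].
exists (f' + g'); first exact: locD.
rewrite twistD addrACA -big_split /=; congr (_ + _).
by apply: eq_bigr => p _; rewrite mulrDl.
Qed.

Lemma reducible_scale c f : c \in A -> reducible f -> reducible (c * f).
Proof.
move=> cA [d [dA d0 [f' f'B ->]]].
exists (fun p => c * d p); split=> [p||].
- by rewrite rpredM.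
- by case: d0 => [|->]; [left|right; rewrite mulr0].
exists (c * f'); first exact: locM (loc_const cA) f'B.
rewrite twist_scale // mulrDr mulr_sumr; congr (_ + _).
by apply: eq_bigr => p _; rewrite mulrA.
Qed.

Lemma reducible_exact g : g \in B -> reducible (Ds g).
Proof.
move=> gB; exists (fun=> 0); split=> [p||]; [exact: rpred0|by right|].
by exists g => //; rewrite big1 ?addr0 // => p _; rewrite mul0r.
Qed.

Lemma reducible_pole p : p \in ps -> s = 0 \/ p != 0 -> reducible (x - p)^-1.
Proof.
move=> pps p0; exists (fun q => (q == p)%:R); split=> [q||].
- exact: rpred_nat.
- by case: p0; [left|right; rewrite eq_sym (negPf b)].
exists 0; first exact: loc0.
rewrite (der0 hD) mulr0 !add0r (big_rem p) //= eqxx mul1r big_seq big1 ?addr0 // => q.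
by rewrite mem_rem_uniq // inE => /andP[/negPf-> _]; rewrite mul0r.
Qed.

Lemma reducible_sum f : f \in B -> (forall c m, c \in A -> reducible (c * x ^+ m)) ->
  (forall c p m, c \in A -> p \in ps -> reducible (c * (x - p) ^- m.+1)) -> reducible f.
Proof.
move=> /pf_loc fB powR poleR; elim: fB => // g h _ rg _; exact: reducible_add.
Qed.

Hypothesis ps0 : 0 \in ps.

Lemma x_neq0 : x != 0.
Proof. by have := sub_neq0 (rpred0 A); rewrite subr0. Qed.

Lemma loc_inv : x^-1 \in B.
Proof. by have := loc_pole ps0; rewrite subr0. Qed.

(** Every elementary fraction has a primitive, except the simple poles. *)
Lemma reducible_untwisted f : s = 0 -> f \in B -> reducible f.
Proof.
move=> s0 fB; apply: reducible_sum => // [c m cA|c p m cA pps].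
  apply: reducible_scale => //.
  have -> : x ^+ m = Ds (m.+1%:R^-1 * x ^+ m.+1).
    rewrite s0 !mul0r addr0 (derM hD) (DA (natV _)) mul0r add0r (derX hD) Dx mulr1 /=.
    by have := char0 m; move: (m.+1%:R) => k k0; field.
  by apply: reducible_exact; rewrite locM ?locX ?loc_x // loc_const.
apply: reducible_scale => //; case: m => [|m].
  by apply: reducible_pole => //; left.
have p0 := sub_neq0 (psA pps).
have -> : (x - p) ^- m.+2 = Ds ((- m.+1%:R^-1) * (x - p) ^- m.+1).
  have nA : - (m.+1%:R : K)^-1 \in A by rewrite rpredN.
  rewrite s0 !mul0r addr0 (derM hD) (DA nA) mul0r add0r (derV hD) ?expf_neq0 //.
  rewrite (derX hD) (derB hD) Dx (DA (psA pps)) subr0 mulr1 /= !exprS.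
  have := char0 m; move: (m.+1%:R) ((x - p) ^+ m) (expf_neq0 m p0) (p0) => k t t0.
  by move: (x - p) => v v0 k0; field; rewrite k0 t0 v0.
apply: reducible_exact; apply: locM; first by apply: loc_const; rewrite rpredN.
by rewrite -exprVn locX ?loc_pole.
Qed.

(** Integration by parts: every power of [x] is exact because no integer equals
    [- s], and the order of a pole at [p != 0] can be lowered down to 1. *)
Lemma reducible_twisted f : (forall m : int, s + m%:~R != 0) ->
  (forall m : int, (s + m%:~R)^-1 \in A) -> f \in B -> reducible f.
Proof.
move=> s0 sV fB; have x0 := x_neq0.
have powR (m : int) : x ^ m \in B -> x * x ^ m \in B -> reducible (x ^ m).
  move=> mB mB'; have sm := s0 (m + 1).
  have -> : x ^ m = Ds ((s + (m + 1)%:~R)^-1 * (x * x ^ m)).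
    rewrite (derM hD) (DA (sV _)) mul0r add0r (derM hD) (derXz hD) // Dx.
    rewrite (_ : x ^ m = x * x ^ (m - 1)); last first.
      by rewrite -{2}[x]expr1z -expfzDr // addrC subrK.
    move: sm; rewrite rmorphD /= => sm; field; by rewrite x0 sm.
  apply: reducible_exact; apply: locM mB'; exact: loc_const.
apply: reducible_sum => // [c m cA|c p m cA pps]; apply: reducible_scale => //.
  by apply: (powR m); rewrite -?exprnP -?exprS locX // loc_x.
have [->|p0] := eqVneq p 0.
  rewrite subr0 exprnN; apply: powR.
    by rewrite -exprnN -exprVn locX // loc_inv.
  rewrite -exprnN exprS (_ : x * _ = x ^- m).
    by rewrite -exprVn locX // loc_inv.
  by field; rewrite expf_neq0 ?x0.
have pB := psA pps; have xp := sub_neq0 pB.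
elim: m => [|m IH]; first by apply: reducible_pole => //; right.
have pV : p^-1 \in A by rewrite -[p]subr0; apply: psV.
have mA : (m.+1%:R : K)^-1 * p^-1 \in A by rewrite rpredM.
have -> : (x - p) ^- m.+2 = (m.+1%:R^-1 * p^-1) * ((1 + s - m.+1%:R) * (x - p) ^- m.+1
     + (-1) * Ds (x * (x - p) ^- m.+1)).
  rewrite (derM hD) (derV hD) ?expf_neq0 // Dx.
  rewrite (derX hD) (derB hD) Dx (DA (psA pps)) subr0 mulr1 /= !exprS.
  have q0 : x - p != 0 by [].
  have := char0 m; move: (m.+1%:R) ((x - p) ^+ m) (expf_neq0 m xp) => k t t0 k0.
  by field; rewrite ?k0 ?t0 ?xp ?p0 ?x0.
apply: reducible_scale => //; apply: reducible_add.
  by apply: reducible_scale => //; rewrite rpredB ?rpredD ?rpred1 // rpred_nat.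
apply: reducible_scale; first by rewrite rpredN rpred1.
apply: reducible_exact; apply: locM; first exact: loc_x.
by rewrite -exprVn locX // loc_pole.
Qed.

Lemma over_const (Q : {poly K}) : Q \is a polyOver A -> forall i, D Q`_i = 0.
Proof. by move/polyOverP=> QA i; apply: DA. Qed.

Lemma der_loc (Q U : {poly K}) : (forall i, D Q`_i = 0) -> (forall i, D U`_i = 0) ->
  U.[x] != 0 -> D (Q.[x] / U.[x]) = (Q^`() * U - Q * U^`()).[x] / U.[x] ^+ 2.
Proof.
move=> DQ DU U0; have mapD0 (P : {poly K}) : (forall i, D P`_i = 0) -> map_poly D P = 0.
  by move=> DP; apply/polyP => i; rewrite coef_map_id0 ?(der0 hD) // DP coef0.
rewrite (der_div hD) // !(der_horner hD) !mapD0 // Dx !(horner0, hornerD, hornerN, hornerM).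
by congr (_ / _); ring.
Qed.

(** Clearing denominators gives a polynomial identity to which [pole_argument]
    applies. If [s != 0] the factor [W = 'X] clears the denominator of [s / x]; it
    spoils the information at 0, where the residue is assumed to vanish. *)
Lemma residues_unique c g : (forall p, c p \in A) -> g \in B -> s = 0 \/ c 0 = 0 ->
  Ds g + \sum_(p <- ps) c p / (x - p) = 0 -> {in ps, forall p, c p = 0}.
Proof.
move=> cA /locP[N [Q [QA gE]]] s0 H y yps; have x0 := x_neq0.
pose S := \sum_(p <- ps) (c p)%:P * \prod_(q <- rem p ps) ('X - q%:P).
have SA : S \is a polyOver A.
  rewrite /S big_seq; apply: rpred_sum => p pps; apply: rpredM; first by rewrite polyOverC.
  rewrite big_seq; apply: rpred_prod => q /mem_rem qps.
  by rewrite polyOverXsubC psA.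
have Sx : S.[x] = poles ps x * \sum_(p <- ps) c p / (x - p).
  rewrite /S horner_sum mulr_sumr !big_seq; apply: eq_bigr => p pps.
  rewrite /poles (perm_big _ (perm_to_rem pps)) big_cons /= hornerM hornerC horner_prod.
  have -> : \prod_(q <- rem p ps) ('X - q%:P).[x] = \prod_(q <- rem p ps) (x - q).
    by apply: eq_bigr => q _; rewrite hornerXsubC.
  by have p0 := sub_neq0 (psA pps); field; rewrite p0.
have Sy : S.[y] = c y * \prod_(q <- rem y ps) (y - q).
  rewrite /S horner_sum (perm_big _ (perm_to_rem yps)) big_cons /=.
  rewrite [X in _ + X]big_seq [X in _ + X]big1 ?addr0.
    rewrite hornerM hornerC horner_prod; congr (_ * _).
    by apply: eq_bigr => q _; rewrite hornerXsubC.
  move=> p; rewrite mem_rem_uniq // inE => /andP[py pps].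
  rewrite hornerM horner_prod (big_rem y) /= ?hornerXsubC ?subrr ?mul0r ?mulr0 //.
  by rewrite mem_rem_uniq // inE eq_sym py.
have y0 : \prod_(q <- rem y ps) (y - q) != 0.
  rewrite prodf_seq_neq0; apply/allP => q; rewrite mem_rem_uniq // inE => /andP[qy _].
  by rewrite /= subr_eq0 eq_sym.
pose U := PT ^+ N; have Ux : U.[x] = poles ps x ^+ N by rewrite horner_exp PT_horner.
have UA : U \is a polyOver A by rewrite rpredX // PT_over.
have Ux0 : U.[x] != 0 by rewrite Ux expf_neq0 // poles_neq0.
have U0 : U != 0 by apply: contraNneq Ux0 => ->; rewrite horner0.
rewrite -Ux in gE; clearbody U.
have PTE : PT = ('X - y%:P) * \prod_(q <- rem y ps) ('X - q%:P).
  by rewrite (perm_big _ (perm_to_rem yps)) big_cons.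
have T1y : (\prod_(q <- rem y ps) ('X - q%:P)).[y] != 0.
  by rewrite horner_prod (eq_bigr (fun q => y - q)) // => q _; rewrite hornerXsubC.
suff [W [Wy HW]] : exists W : {poly K}, (c y = 0 \/ W.[y] != 0) /\
    (W * (Q^`() * U - Q * U^`()) + s%:P * (Q * U)) * PT = U ^+ 2 * (W * - S).
  case: Wy => // Wy; move: HW; rewrite PTE => /(pole_argument char0 U0 Wy T1y).
  rewrite hornerM hornerN Sy => /eqP.
  by rewrite mulf_eq0 oppr_eq0 mulf_eq0 (negPf Wy) (negPf y0) orbF => /eqP.
have key (W : {poly K}) : W \is a polyOver A -> s * W.[x] = s * x ->
    (W * (Q^`() * U - Q * U^`()) + s%:P * (Q * U)) * PT = U ^+ 2 * (W * - S).
  move=> WA Wx; apply/eqP; rewrite -subr_eq0; apply/eqP.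
  apply: transcendental; first apply: over_const.
    have Q'A := polyOver_deriv QA; have U'A := polyOver_deriv UA.
    rewrite ?(rpredB, rpredD, rpredM, rpredN, rpredX) // ?PT_over ?polyOverC //.
  move: H; rewrite gE der_loc //; [|exact: over_const|exact: over_const].
  rewrite !(hornerM, hornerD, hornerN, horner_exp, hornerC) -/PT PT_horner Sx.
  have T0 := poles_neq0.
  move: (poles ps x) T0 (\sum_(p <- ps) _) (W.[x]) Wx => T T0 F w sw.
  move: (Q.[x]) (U.[x]) Ux0 (Q^`().[x]) (U^`().[x]) => q u u0 q' u' H.
  transitivity (w * T * u ^+ 2 * ((q' * u - q * u') / u ^+ 2 + s / x * (q / u) + F)
      - (s * w - s * x) * (q * u * T) / x).
    by field; rewrite x0 u0.
  by rewrite H sw subrr !mul0r mulr0 subr0.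
case: s0 => [s0|c0].
  exists 1; split; first by right; rewrite hornerC oner_neq0.
  by apply: key; rewrite ?rpred1 // s0 !mul0r.
exists 'X; split; last by apply: key; rewrite ?polyOverX // hornerX.
by have [->|y0'] := eqVneq y 0; [left|right; rewrite hornerX].
Qed.

(** With [g = Q.[x] / PT.[x] ^+ N], the polynomial [g *: PT ^+ N - Q] vanishes at
    [x] and has constant coefficients, so it is zero; as [PT] is monic, [g] is a
    coefficient of [Q]. *)
Lemma horizontal_untwisted g : s = 0 -> g \in B -> Ds g = 0 -> g \in A.
Proof.
move=> s0 /locP[N [Q [QA gE]]]; rewrite s0 !mul0r addr0 => Dg.
have T0 := poles_neq0.
have E : g *: PT ^+ N - Q = 0.
  apply: transcendental => [i|].
    have PA : PT ^+ N \is a polyOver A by rewrite rpredX // PT_over.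
    rewrite coefB coefZ (derB hD) (derM hD) Dg (over_const PA) (over_const QA).
    by rewrite mul0r mulr0 !addr0 subr0.
  by rewrite !(hornerD, hornerN, hornerZ, horner_exp) PT_horner gE; field; rewrite expf_neq0.
have lead1 : (PT ^+ N)`_(size (PT ^+ N)).-1 = 1.
  exact/monicP/monic_exp/PT_monic.
rewrite -[g]mulr1 -lead1 -coefZ (subr0_eq E).
exact: polyOverP.
Qed.

Lemma horizontal_twisted g : (forall m : int, s + m%:~R != 0) ->
  g \in B -> Ds g = 0 -> g = 0.
Proof.
move=> s0 /locP[N [Q [QA gE]]] Dg; have x0 := x_neq0.
pose U := PT ^+ N; have Ux : U.[x] = poles ps x ^+ N by rewrite horner_exp PT_horner.
have UA : U \is a polyOver A by rewrite rpredX // PT_over.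
have Ux0 : U.[x] != 0 by rewrite Ux expf_neq0 // poles_neq0.
have U0 : U != 0 by apply: contraNneq Ux0 => ->; rewrite horner0.
rewrite -Ux in gE; clearbody U.
suff /(no_solution U0 s0) Q0 :
    'X * (Q^`() * U - Q * U^`()) + s%:P * (Q * U) = 0.
  by rewrite gE Q0 horner0 mul0r.
apply: transcendental; first apply: over_const.
  have Q'A := polyOver_deriv QA; have U'A := polyOver_deriv UA.
  by rewrite ?(rpredB, rpredD, rpredM) // ?polyOverX ?polyOverC.
move: Dg; rewrite gE der_loc //; [|exact: over_const|exact: over_const].
rewrite !(hornerM, hornerD, hornerN, hornerC, hornerX).
move: (Q.[x]) (U.[x]) Ux0 (Q^`().[x]) (U^`().[x]) => q u u0 q' u' H.
transitivity (x * u ^+ 2 * ((q' * u - q * u') / u ^+ 2 + s / x * (q / u))).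
  by field; rewrite x0 u0.
by rewrite H mulr0.
Qed.

End Twist.
End Fiber.

(** * Exterior algebra in coordinates *)

Section ExteriorAlgebra.
Variables (K : fieldType) (n : nat).
Local Notation aform := {ffun {set 'I_n} -> K}.
Implicit Types (f g : K) (alpha beta : aform) (S : {set 'I_n}) (i j k : 'I_n).

Definition fmul f alpha : aform := [ffun S : {set 'I_n} => f * alpha S].

(** The number of transpositions that bring [dz_i] to its place in [S]. *)
Definition pos i S := #|[set j in S | (j < i)%N]|.

(** Left multiplication by [dz_i]. All products of forms in the proof are iterated
    left multiplications by 1-forms. *)
Definition lw i alpha : aform :=
  [ffun S : {set 'I_n} => if i \in S then (-1) ^+ pos i S * alpha (S :\ i) else 0].

Definition fmap (h : K -> K) alpha : aform := [ffun S : {set 'I_n} => h (alpha S)].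

Definition unit_form : aform := [ffun S : {set 'I_n} => if S == set0 then 1 else 0].

Lemma fmulA f g alpha : fmul f (fmul g alpha) = fmul (f * g) alpha.
Proof. by apply/ffunP => S; rewrite !ffunE mulrA. Qed.
Lemma fmul1 alpha : fmul 1 alpha = alpha.
Proof. by apply/ffunP => S; rewrite !ffunE mul1r. Qed.
Lemma fmul0 alpha : fmul 0 alpha = 0.
Proof. by apply/ffunP => S; rewrite !ffunE mul0r. Qed.
Lemma fmulr0 f : fmul f 0 = 0.
Proof. by apply/ffunP => S; rewrite !ffunE mulr0. Qed.
Lemma fmulDr f alpha beta : fmul f (alpha + beta) = fmul f alpha + fmul f beta.
Proof. by apply/ffunP => S; rewrite !ffunE mulrDr. Qed.
Lemma fmulDl f g alpha : fmul (f + g) alpha = fmul f alpha + fmul g alpha.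
Proof. by apply/ffunP => S; rewrite !ffunE mulrDl. Qed.
Lemma fmulN f alpha : fmul f (- alpha) = - fmul f alpha.
Proof. by apply/ffunP => S; rewrite !ffunE mulrN. Qed.
Lemma fmulNl f alpha : fmul (- f) alpha = - fmul f alpha.
Proof. by apply/ffunP => S; rewrite !ffunE mulNr. Qed.
Lemma fmul_sum f I (r : seq I) (P : pred I) (F : I -> aform) :
  fmul f (\sum_(i <- r | P i) F i) = \sum_(i <- r | P i) fmul f (F i).
Proof. by elim/big_rec2: _ => [|i u v _ <-]; rewrite ?fmulr0 ?fmulDr. Qed.
Lemma fmulC f g alpha : fmul f (fmul g alpha) = fmul g (fmul f alpha).
Proof. by rewrite !fmulA mulrC. Qed.

Lemma lw0 i : lw i 0 = 0.
Proof. by apply/ffunP => S; rewrite !ffunE mulr0 if_same. Qed.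
Lemma lwD i alpha beta : lw i (alpha + beta) = lw i alpha + lw i beta.
Proof. by apply/ffunP => S; rewrite !ffunE; case: ifP; rewrite ?mulrDr ?addr0. Qed.
Lemma lwN i alpha : lw i (- alpha) = - lw i alpha.
Proof. by apply/ffunP => S; rewrite !ffunE; case: ifP; rewrite ?mulrN ?oppr0. Qed.
Lemma lw_fmul i f alpha : lw i (fmul f alpha) = fmul f (lw i alpha).
Proof. by apply/ffunP => S; rewrite !ffunE; case: ifP; rewrite ?mulr0 // mulrCA. Qed.
Lemma lw_sum i I (r : seq I) (P : pred I) (F : I -> aform) :
  lw i (\sum_(l <- r | P l) F l) = \sum_(l <- r | P l) lw i (F l).
Proof. by elim/big_rec2: _ => [|l u v _ <-]; rewrite ?lw0 ?lwD. Qed.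

Lemma pos_del i j S : j \in S -> pos i S = (pos i (S :\ j) + (j < i))%N.
Proof.
move=> jS; rewrite /pos; case: ltnP => ji.
  rewrite (cardsD1 j) inE jS ji addnC; congr (_ + _)%N.
  by apply: eq_card => k; rewrite !inE; case: eqP.
rewrite addn0; apply: eq_card => k; rewrite !inE.
by case: eqP => //= ->; rewrite ltnNge ji andbF.
Qed.

Lemma lw2 i alpha : lw i (lw i alpha) = 0.
Proof. by apply/ffunP => S; rewrite !ffunE !inE eqxx /= mulr0 if_same. Qed.

Lemma lwC i j alpha : lw i (lw j alpha) = - lw j (lw i alpha).
Proof.
have [->|ij] := eqVneq i j; first by rewrite lw2 oppr0.
apply/ffunP => S; rewrite !ffunE !inE (eq_sym j i) ij /=.
case iS: (i \in S); case jS: (j \in S); rewrite ?mulr0 ?oppr0 //=.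
rewrite (pos_del i jS) (pos_del j iS) !exprD.
have -> : S :\ i :\ j = S :\ j :\ i by rewrite !setDDl setUC.
by case: ltngtP (ij) => [ji|ji|/val_inj->]; rewrite ?eqxx //= => _; ring.
Qed.

Lemma lw_fmap (h : K -> K) i alpha : h 0 = 0 -> (forall f, h (- f) = - h f) ->
  lw i (fmap h alpha) = fmap h (lw i alpha).
Proof.
move=> h0 hN; apply/ffunP => S; rewrite !ffunE; case: ifP => // _.
by rewrite -signr_odd; case: (odd _); rewrite ?expr0 ?expr1 ?mul1r ?mulN1r.
Qed.

Definition free_of k alpha := forall S, k \in S -> alpha S = 0.
(** The contraction with the vector field of [z_k]: [dz_decomposition] is the
    decomposition of a form along [dz_k]. *)
Definition coef_dz k alpha : aform :=
  [ffun S : {set 'I_n} => if k \in S then 0 else (-1) ^+ pos k S * alpha (k |: S)].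
Definition drop_dz k alpha : aform :=
  [ffun S : {set 'I_n} => if k \in S then 0 else alpha S].

Lemma pos_self k S : pos k (k |: S) = pos k S.
Proof.
apply: eq_card => j; rewrite !inE; case: eqP => //= ->.
by rewrite ltnn andbF.
Qed.

Lemma dz_decomposition k alpha : alpha = lw k (coef_dz k alpha) + drop_dz k alpha.
Proof.
apply/ffunP => S; rewrite !ffunE !inE eqxx /=; case: ifP => kS; last by rewrite add0r.
by rewrite addr0 mulrA -exprD setD1K // (pos_del k kS) ltnn addn0 -signr_odd oddD addbb mul1r.
Qed.

Lemma coef_dzD k alpha beta : coef_dz k (alpha + beta) = coef_dz k alpha + coef_dz k beta.
Proof. by apply/ffunP => S; rewrite !ffunE; case: ifP; rewrite ?mulrDr ?addr0. Qed.

Lemma coef_dz0 k : coef_dz k 0 = 0.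
Proof. by apply/ffunP => S; rewrite !ffunE mulr0 if_same. Qed.

Lemma coef_dz_sum k I (r : seq I) (P : pred I) (F : I -> aform) :
  coef_dz k (\sum_(l <- r | P l) F l) = \sum_(l <- r | P l) coef_dz k (F l).
Proof. by elim/big_rec2: _ => [|l u v _ <-]; rewrite ?coef_dz0 ?coef_dzD. Qed.

Lemma coef_dz_fmul k f alpha : coef_dz k (fmul f alpha) = fmul f (coef_dz k alpha).
Proof. by apply/ffunP => S; rewrite !ffunE; case: ifP; rewrite ?mulr0 // mulrCA. Qed.

Lemma coef_dz_of_free k alpha : free_of k alpha -> coef_dz k alpha = 0.
Proof.
move=> fa; apply/ffunP => S; rewrite !ffunE fa ?mulr0 ?if_same //.
by rewrite !inE eqxx.
Qed.

Lemma coef_dz_lw k alpha : free_of k alpha -> coef_dz k (lw k alpha) = alpha.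
Proof.
move=> fa; apply/ffunP => S; rewrite !ffunE; case: ifP => kS; first by rewrite fa.
rewrite !inE eqxx /= setU1K ?kS // pos_self mulrA -exprD -signr_odd oddD addbb.
by rewrite mul1r.
Qed.

Lemma free_lw k j alpha : j != k -> free_of k alpha -> free_of k (lw j alpha).
Proof.
move=> jk fa S kS; rewrite ffunE; case: ifP => // jS.
by rewrite fa ?mulr0 // !inE eq_sym jk.
Qed.

Lemma free_fmul k f alpha : free_of k alpha -> free_of k (fmul f alpha).
Proof. by move=> fa S kS; rewrite ffunE fa ?mulr0. Qed.

End ExteriorAlgebra.

(** * Relations between the coefficients of edges *)

Section MonomialIdentities.
Variable K : fieldType.
Implicit Types (x y w : K) (p q r : int).

(** In a block, [dz_x] and [dz_y] come with such coefficients, whose exponents are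
    the two roundings of one weight. *)
Definition edge_coef x y p : K := (x / y) ^ (- p) / (x - y).

Lemma edge_coefE x y p : y != 0 -> edge_coef x y p = (x ^ p)^-1 * y ^ p / (x - y).
Proof. by move=> y0; rewrite /edge_coef expfzMl exprz_inv opprK -invr_expz. Qed.

(** The Arnold relation between the three [1 / (x - y)], multiplied by monomials;
    the two values of [r] are those that the rounding of a sum may take. *)
Lemma three_term x y w p q r :
  x != 0 -> y != 0 -> w != 0 -> x != y -> x != w -> y != w ->
  r = p + q \/ r = p + q - 1 ->
  edge_coef x y p * edge_coef y w r + edge_coef y x q * edge_coef x w r
  = edge_coef x w p * edge_coef y w q.
Proof.
move=> x0 y0 w0 xy xw yw rE; rewrite !edge_coefE //.
have xy0 : x - y != 0 by rewrite subr_eq0.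
have xw0 : x - w != 0 by rewrite subr_eq0.
have yw0 : y - w != 0 by rewrite subr_eq0.
have yx0 : y - x != 0 by rewrite subr_eq0 eq_sym.
(* a factor 1/u common to all terms, or none *)
have [d dE] : exists d : bool, forall u : K, u != 0 -> u ^ r = u ^ p * u ^ q / u ^+ d.
  case: rE => ->; [exists false|exists true] => u u0.
    by rewrite expfzDr // expr0 divr1.
  by rewrite !expfzDr // exprN1 expr1.
rewrite !dE //.
have [xp xq yp yq] : [/\ x ^ p != 0, x ^ q != 0, y ^ p != 0 & y ^ q != 0].
  by rewrite !expfz_neq0.
move: (x ^ p) (x ^ q) (y ^ p) (y ^ q) (w ^ p) (w ^ q) xp xq yp yq.
move=> xp xq yp yq wp wq xp0 xq0 yp0 yq0.
case: d {dE} => /=; rewrite ?expr0 ?expr1.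
  by field; rewrite ?x0 ?y0 ?w0 ?xy0 ?xw0 ?yw0 ?yx0 ?xp0 ?xq0 ?yp0 ?yq0.
by field; rewrite ?x0 ?y0 ?w0 ?xy0 ?xw0 ?yw0 ?yx0 ?xp0 ?xq0 ?yp0 ?yq0 ?oner_neq0.
Qed.

(** Together with the next two identities, this reverses an edge into a root: an
    open root, a closed root reached by integral weights, and a closed root
    reached by weights that are not integers. *)
Lemma reverse_edge x y p q : x != 0 -> y != 0 -> x != y ->
  edge_coef x y p * y ^ (- (p + q)) = - edge_coef y x q * x ^ (- (p + q)).
Proof.
move=> x0 y0 xy; rewrite !edge_coefE // -!invr_expz !expfzDr //.
have xy0 : x - y != 0 by rewrite subr_eq0.
have yx0 : y - x != 0 by rewrite subr_eq0 eq_sym.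
have [xp xq yp yq] : [/\ x ^ p != 0, x ^ q != 0, y ^ p != 0 & y ^ q != 0].
  by rewrite !expfz_neq0.
move: (x ^ p) (x ^ q) (y ^ p) (y ^ q) xp xq yp yq => xp xq yp yq xp0 xq0 yp0 yq0.
by field; rewrite ?x0 ?y0 ?xy0 ?yx0 ?xp0 ?xq0 ?yp0 ?yq0.
Qed.

Lemma reverse_edge_closed x y p q : x != 0 -> y != 0 -> x != y ->
  edge_coef x y p * y ^ (- (p + q) - 1)
  = - edge_coef y x q * x ^ (- (p + q) - 1) + x ^ (- p - 1) * y ^ (- q - 1).
Proof.
move=> x0 y0 xy; rewrite !edge_coefE // !expfzDr // -!invr_expz !expfzDr // !expr1z.
have xy0 : x - y != 0 by rewrite subr_eq0.
have yx0 : y - x != 0 by rewrite subr_eq0 eq_sym.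
have [xp xq yp yq] : [/\ x ^ p != 0, x ^ q != 0, y ^ p != 0 & y ^ q != 0].
  by rewrite !expfz_neq0.
move: (x ^ p) (x ^ q) (y ^ p) (y ^ q) xp xq yp yq => xp xq yp yq xp0 xq0 yp0 yq0.
by field; rewrite ?x0 ?y0 ?xy0 ?yx0 ?xp0 ?xq0 ?yp0 ?yq0.
Qed.

Lemma reverse_edge_split x y p q r : x != 0 -> y != 0 -> x != y -> r = p + q + 1 ->
  edge_coef x y (p + 1) * y ^ (- r - 1) = - edge_coef y x (q + 1) * x ^ (- r - 1).
Proof.
move=> x0 y0 xy ->; rewrite !edge_coefE // !expfzDr // -!invr_expz !expfzDr // !expr1z.
have xy0 : x - y != 0 by rewrite subr_eq0.
have yx0 : y - x != 0 by rewrite subr_eq0 eq_sym.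
have [xp xq yp yq] : [/\ x ^ p != 0, x ^ q != 0, y ^ p != 0 & y ^ q != 0].
  by rewrite !expfz_neq0.
move: (x ^ p) (x ^ q) (y ^ p) (y ^ q) xp xq yp yq => xp xq yp yq xp0 xq0 yp0 yq0.
by field; rewrite ?x0 ?y0 ?xy0 ?yx0 ?xp0 ?xq0 ?yp0 ?yq0.
Qed.

Variables (D : K -> K).
Hypothesis hD : derivation D.

Lemma der_expz_twist x (p : int) : x != 0 ->
  D (x ^ p) = p%:~R / x * D x * x ^ p.
Proof.
move=> x0; rewrite (derXz hD) // (_ : x ^ p = x * x ^ (p - 1)); last first.
  by rewrite -{2}[x]expr1z -expfzDr // addrC subrK.
by field; rewrite x0.
Qed.

Lemma der_edge_coef x y p : x != 0 -> y != 0 -> x != y ->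
  D (edge_coef x y p) = edge_coef x y p *
    (- p%:~R / x * D x + p%:~R / y * D y - (D x - D y) / (x - y)).
Proof.
move=> x0 y0 xy; rewrite !edge_coefE // (derM hD).
have xy0 : x - y != 0 by rewrite subr_eq0.
have xp0 : x ^ p != 0 by rewrite expfz_neq0.
rewrite (derV hD) // (derB hD) (derM hD) (derV hD) // !der_expz_twist //.
by move: (x ^ p) xp0 (y ^ p) => xp xp0 yp; field; rewrite x0 y0 xy0 xp0.
Qed.
End MonomialIdentities.

(** * Twisted differential and blocks *)

(** What the computation uses of a field of rational functions: constants,
    coordinates, and commuting derivations dual to the coordinates. *)
Record coordinates (C : numFieldType) (K : fieldType) (n : nat) := Coordinates {
  cst : {rmorphism C -> K};
  coord : 'I_n -> K;
  dd : 'I_n -> K -> K;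
  dd_der : forall i, derivation (dd i);
  dd_coord : forall i j, dd i (coord j) = (i == j)%:R;
  dd_cst : forall i c, dd i (cst c) = 0;
  ddC : forall i j f, dd i (dd j f) = dd j (dd i f) }.

Section Coordinates.
Variables (C : numFieldType) (K : fieldType) (n : nat) (X : coordinates C K n).
Local Notation z := (coord X).
Local Notation dd := (dd X).
Local Notation aform := {ffun {set 'I_n} -> K}.
Local Notation code := ('I_n + bool)%type.
Implicit Types (i j k : 'I_n) (f g : K) (alpha beta : aform) (a b c : 'I_n -> rat).

Definition rho (q : rat) : K := cst X (ratr q).
HB.instance Definition _ := GRing.RMorphism.copy rho (cst X \o (@ratr C)).

Lemma dd_rho i q : dd i (rho q) = 0. Proof. exact: dd_cst. Qed.

Lemma char0 m : m.+1%:R != 0 :> K.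
Proof. by rewrite -(rmorph_nat (cst X)) fmorph_eq0 pnatr_eq0. Qed.

Lemma rhoN q : rho (- q) = - rho q. Proof. exact: rmorphN. Qed.
Lemma rhoD p q : rho (p + q) = rho p + rho q. Proof. exact: rmorphD. Qed.
Lemma rho0 : rho 0 = 0. Proof. exact: rmorph0. Qed.

Lemma rho_neq0 q : q != 0 -> rho q != 0.
Proof. by rewrite fmorph_eq0. Qed.

Lemma z_neq0 i : z i != 0.
Proof.
apply: contra_neq (oner_neq0 K) => zi.
by rewrite -[1]/(true%:R) -(eqxx i) -(dd_coord X) zi (der0 (dd_der X i)).
Qed.

Lemma zB_neq0 i j : i != j -> z i - z j != 0.
Proof.
move=> ij; apply: contra_neq (oner_neq0 K) => zi.
have := der0 (dd_der X i); rewrite -zi (derB (dd_der X i)) !dd_coord eqxx.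
by rewrite (negPf ij) subr0.
Qed.

Lemma z_inj : injective z.
Proof.
move=> i j zij; apply/eqP; apply: contraT => /zB_neq0.
by rewrite zij subrr eqxx.
Qed.

Lemma z_neq i j : i != j -> z i != z j.
Proof. by rewrite (inj_eq z_inj). Qed.

(** Covariant derivative along [z_i]. *)
Definition tw a i f := dd i f + rho (a i) / z i * f.

Lemma twD a i f g : tw a i (f + g) = tw a i f + tw a i g.
Proof. by rewrite /tw (derD (dd_der X i)) mulrDr addrACA. Qed.
Lemma tw0 a i : tw a i 0 = 0.
Proof. by rewrite /tw (der0 (dd_der X i)) mulr0 addr0. Qed.
Lemma twN a i f : tw a i (- f) = - tw a i f.
Proof. by rewrite /tw (derN (dd_der X i)) mulrN opprD. Qed.
Lemma twM a b c i f g : a i = b i + c i -> tw a i (f * g) = tw b i f * g + f * tw c i g.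
Proof. by rewrite /tw (derM (dd_der X i)) => ->; rewrite rhoD; ring. Qed.
Lemma tw_cst a i (q : C) f : tw a i (cst X q * f) = cst X q * tw a i f.
Proof. by rewrite /tw (derM (dd_der X i)) dd_cst; ring. Qed.
Lemma twC a i j f : tw a i (tw a j f) = tw a j (tw a i f).
Proof.
have [->//|ij] := eqVneq i j.
rewrite /tw !(derD (dd_der X _)) !(derM (dd_der X _)) (ddC X i j).
rewrite !(derV (dd_der X _)) ?z_neq0 // !dd_rho !dd_coord (eq_sym j i) (negPf ij) /= mulr0n; ring.
Qed.

(** The differential [d + sum_i a_i dz_i / z_i]. *)
Definition nab a alpha := \sum_i lw i (fmap (tw a i) alpha).

Lemma nabD a alpha beta : nab a (alpha + beta) = nab a alpha + nab a beta.
Proof.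
rewrite /nab -big_split; apply: eq_bigr => i _ /=; rewrite -lwD; congr lw.
by apply/ffunP => S; rewrite !ffunE twD.
Qed.
Lemma nab0 a : nab a 0 = 0.
Proof.
rewrite /nab big1 // => i _; rewrite (_ : fmap _ _ = 0) ?lw0 //.
by apply/ffunP => S; rewrite !ffunE tw0.
Qed.
Lemma nabN a alpha : nab a (- alpha) = - nab a alpha.
Proof. by apply: (addrI (nab a alpha)); rewrite -nabD !subrr nab0. Qed.
Lemma nab_sum a I (r : seq I) (P : pred I) (F : I -> aform) :
  nab a (\sum_(i <- r | P i) F i) = \sum_(i <- r | P i) nab a (F i).
Proof. by elim/big_rec2: _ => [|i u v _ <-]; rewrite ?nab0 ?nabD. Qed.
Lemma nab_cst a (q : C) alpha : nab a (fmul (cst X q) alpha) = fmul (cst X q) (nab a alpha).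
Proof.
rewrite /nab fmul_sum; apply: eq_bigr => i _; rewrite -lw_fmul; congr lw.
by apply/ffunP => S; rewrite !ffunE tw_cst.
Qed.

Lemma nab_lw a j alpha : nab a (lw j alpha) = - lw j (nab a alpha).
Proof.
rewrite /nab lw_sum -sumrN; apply: eq_bigr => i _.
rewrite -lw_fmap; [exact: lwC|exact: tw0|exact: twN].
Qed.

Lemma nab_fmul a b c f alpha : (forall i, a i = b i + c i) ->
  nab a (fmul f alpha) = \sum_i fmul (tw b i f) (lw i alpha) + fmul f (nab c alpha).
Proof.
move=> abc; rewrite /nab fmul_sum -big_split; apply: eq_bigr => i _ /=.
rewrite -!lw_fmul -lwD; congr lw; apply/ffunP => S; rewrite !ffunE.
exact: twM.
Qed.

Lemma nab_nab a alpha : nab a (nab a alpha) = 0.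
Proof.
have E : nab a (nab a alpha)
    = \sum_i \sum_j lw i (lw j (fmap (tw a i) (fmap (tw a j) alpha))).
  rewrite {1}/nab; apply: eq_bigr => i _; rewrite -lw_sum; congr lw.
  rewrite /nab (_ : fmap _ _ = \sum_j fmap (tw a i) (lw j (fmap (tw a j) alpha))).
    by apply: eq_bigr => j _; symmetry; apply: lw_fmap; [exact: tw0|exact: twN].
  apply/ffunP => S; rewrite ffunE !sum_ffunE.
  by elim/big_rec2: _ => [|l u v _ <-]; rewrite ?tw0 ?twD ?ffunE.
have EN : nab a (nab a alpha) = - nab a (nab a alpha).
  rewrite {1}E exchange_big E -sumrN; apply: eq_bigr => i _.
  rewrite -sumrN; apply: eq_bigr => j _; rewrite lwC; congr (- lw _ (lw _ _)).
  by apply/ffunP => S; rewrite !ffunE twC.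
apply/ffunP => S; have := congr1 (fun u : aform => u S) EN; rewrite !ffunE.
move/eqP; rewrite -addr_eq0 -mulr2n -mulr_natl mulf_eq0 (negPf (char0 1)) /=.
by move/eqP.
Qed.

(** The exponents after [z_k] has been integrated out: an edge passes the exponent
    of [k] on to its target, a root absorbs it. *)
Definition upd a k (d : code) : 'I_n -> rat := fun i =>
  if i == k then 0 else
  if d is inl j then (if i == j then a i + a k else a i) else a i.

Definition ecoef k j (p : int) := edge_coef (z k) (z j) p.

(** Up to a constant, the factor of [beta_bar] at a vertex, multiplied by the
    monomial in [z_k] and [z_j] which its weight contributes. For the edges,
    rounding up one coefficient and rounding down the other gives the integral and
    the nonintegral case by one formula. *)
Definition block k (d : code) (s : rat) alpha : aform :=
  match d with
  | inl j => fmul (ecoef k j (Num.ceil s)) (lw k alpha)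
             - fmul (ecoef k j (Num.floor s)) (lw j alpha)
  | inr true => fmul (z k ^ (- Num.floor s - 1)) (lw k alpha)
  | inr false => fmul (z k ^ (- Num.floor s)) alpha
  end.

Definition is_open (d : code) := d == inr false.

Lemma blockD k d s alpha beta : block k d s (alpha + beta) = block k d s alpha + block k d s beta.
Proof.
case: d => [j|[]] /=; rewrite ?lwD ?fmulDr //.
by rewrite opprD addrACA.
Qed.
Lemma blockZ k d s f alpha : block k d s (fmul f alpha) = fmul f (block k d s alpha).
Proof.
case: d => [j|[]] /=; rewrite ?lw_fmul ?(fmulC _ f) //.
by rewrite fmulDr fmulN.
Qed.
Lemma block0 k d s : block k d s 0 = 0.
Proof. by rewrite -[X in block _ _ _ X](fmul0 0) blockZ fmul0. Qed.
Lemma blockN k d s alpha : block k d s (- alpha) = - block k d s alpha.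
Proof. by apply: (addrI (block k d s alpha)); rewrite -blockD !subrr block0. Qed.
Lemma block_sum k d s I (r : seq I) (P : pred I) (F : I -> aform) :
  block k d s (\sum_(i <- r | P i) F i) = \sum_(i <- r | P i) block k d s (F i).
Proof. by elim/big_rec2: _ => [|i u v _ <-]; rewrite ?block0 ?blockD. Qed.

Definition wsign (d : code) alpha : aform := if is_open d then alpha else - alpha.

Lemma block_lw k d s i alpha : block k d s (lw i alpha) = wsign d (lw i (block k d s alpha)).
Proof.
rewrite /wsign /is_open; case: d => [j|[]] /=.
- by rewrite lwD lwN !lw_fmul (lwC k) (lwC j) !fmulN opprD.
- by rewrite lw_fmul (lwC k) fmulN.
by rewrite lw_fmul.
Qed.

Lemma blockC k d s k' d' s' alpha :
  block k d s (block k' d' s' alpha)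
  = if is_open d || is_open d' then block k' d' s' (block k d s alpha)
    else - block k' d' s' (block k d s alpha).
Proof.
case: d' => [j|[]] /=.
- rewrite blockD blockN !blockZ !block_lw /wsign orbF.
  by case: ifP; rewrite // !fmulN opprD opprK.
- rewrite blockZ block_lw /wsign orbF.
  by case: ifP; rewrite // fmulN.
by rewrite orbT blockZ.
Qed.

Lemma ecoef_ceil k j (s : rat) :
  ecoef k j (Num.ceil s)
  = ecoef k j (Num.floor s) * (z j / z k) ^+ (s \isn't a Num.int).
Proof.
have zk := z_neq0 k; have zj := z_neq0 j.
rewrite ceil_floor /ecoef !edge_coefE //; case: (_ \is a _); rewrite /= ?addr0 ?mulr1 //.
rewrite !expfzDr // expr1 !expr1z.
have := expfz_neq0 (Num.floor s) zk; move: (z k ^ _) (z j ^ _) => u v u0.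
by move: (z k - z j)^-1 => d; field; rewrite u0 zk.
Qed.

Lemma rho_int s : s \is a Num.int -> rho s = (Num.floor s)%:~R.
Proof. by rewrite intrEfloor => /eqP<-; rewrite intrKfloor rmorph_int. Qed.

(** For integral [s] the monomial is horizontal and [1 / (z_k - z_j)] is invariant
    under simultaneous translation of both variables; otherwise the two roundings
    differ by the factor [z_j / z_k], whose derivative makes up for the fractional
    part of [s]. *)
Lemma edge_coef_closed k j (s : rat) c : k != j -> c k = s -> c j = - s ->
  tw c k (- ecoef k j (Num.floor s)) = tw c j (ecoef k j (Num.ceil s)).
Proof.
move=> kj ck cj; have zk := z_neq0 k; have zj := z_neq0 j; have zkj := zB_neq0 kj.
have dk := dd_der X k; have dj := dd_der X j.
have eD (D : K -> K) p : derivation D -> D (ecoef k j p) = ecoef k j p *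
    (- p%:~R / z k * D (z k) + p%:~R / z j * D (z j) - (D (z k) - D (z j)) / (z k - z j)).
  by move=> hD; rewrite [LHS]der_edge_coef // z_neq.
rewrite twN /tw ecoef_ceil ck cj rhoN.
have [/rho_int ->|_] := boolP (s \is a Num.int).
  rewrite expr0 mulr1 (eD _ _ dk) (eD _ _ dj) !dd_coord !eqxx (eq_sym j k) (negPf kj) /= mulr0n.
  by move: (ecoef _ _ _) (_%:~R) => e p; field; rewrite zk zj zkj.
rewrite expr1 (derM dj) (derM dj) (derV dj) // (eD _ _ dk) (eD _ _ dj) !dd_coord !eqxx
   (eq_sym j k) (negPf kj) /= mulr0n.
by move: (ecoef _ _ _) (_%:~R) (rho s) => e p q; field; rewrite zk zj zkj.
Qed.

Lemma tw_other c l k j p : l != k -> l != j -> c l = 0 -> tw c l (ecoef k j p) = 0.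
Proof.
move=> lk lj cl; have dl := dd_der X l; rewrite /tw cl rho0 !mul0r addr0.
have [->|kj] := eqVneq k j.
  by rewrite /ecoef /edge_coef subrr invr0 mulr0 (der0 dl).
rewrite [LHS]der_edge_coef ?z_neq0 ?z_neq // !dd_coord (negPf lk) (negPf lj).
by rewrite /= !mulr0n !mulr0 subr0 mul0r subr0 addr0 mulr0.
Qed.

Lemma upd_split a k j : k != j -> forall i,
  a i = (if i == k then a k else if i == j then - a k else 0) + upd a k (inl j) i.
Proof.
move=> kj i; rewrite /upd; case: eqP => [->|_]; first by rewrite addr0.
by case: eqP => _; rewrite ?add0r // addrCA addNr addr0.
Qed.

(** The 1-form of a block is closed for the part of the exponents which [upd]
    takes away. *)
Lemma nab_block a k d alpha :
  (if d is inl j then k != j else a k \is a Num.int) ->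
  nab a (block k d (a k) alpha) = wsign d (block k d (a k) (nab (upd a k d) alpha)).
Proof.
pose b i := if i == k then a k else 0.
case: d => [j kj|e aint]; last first.
  have ab i : a i = b i + upd a k (inr e) i.
    by rewrite /b /upd; case: eqP => [->|_]; rewrite ?addr0 ?add0r.
  have tw0' m i : i != k -> tw b i (z k ^ m) = 0.
    move=> ik; rewrite /tw /b (negPf ik) rho0 !mul0r addr0.
    by rewrite (der_expz_twist (dd_der X i)) ?z_neq0 // dd_coord (negPf ik) mulr0 mul0r.
  case: e ab => ab; rewrite /= /wsign /is_open /=.
    rewrite (nab_fmul _ _ ab) big1 => [|i _].
      by rewrite add0r nab_lw fmulN.
    have [->|ik] := eqVneq i k; first by rewrite lw2 fmulr0.
    by rewrite tw0' // fmul0.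
  rewrite (nab_fmul _ _ ab) big1 ?add0r // => i _.
  have [->|ik] := eqVneq i k; last by rewrite tw0' // fmul0.
  rewrite /tw /b eqxx (der_expz_twist (dd_der X k)) ?z_neq0 // dd_coord eqxx rho_int //.
  by rewrite rmorphN mulr1 -mulrDl mulNr addNr mul0r fmul0.
pose c i := if i == k then a k else if i == j then - a k else 0.
have ac : forall i, a i = c i + upd a k (inl j) i := upd_split a kj.
rewrite /= nabD nabN !(nab_fmul _ _ ac) !nab_lw /wsign /= /is_open /=.
have two (F : 'I_n -> aform) : (forall i, i != k -> i != j -> F i = 0) ->
    \sum_i F i = F k + F j.
  move=> F0; rewrite (bigD1 k) // (bigD1 j) /= 1?eq_sym // big1 ?addr0 // => i /andP[ik ij].
  exact: F0.
rewrite !two => [|i ik ij|i ik ij]; last 2 first.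
- by rewrite tw_other ?fmul0 // /c (negPf ik) (negPf ij).
- by rewrite tw_other ?fmul0 // /c (negPf ik) (negPf ij).
have ck : c k = a k by rewrite /c eqxx.
have cj : c j = - a k by rewrite /c eq_sym (negPf kj) eqxx.
have := edge_coef_closed kj ck cj; rewrite twN => E.
rewrite !lw2 !fmulr0 add0r addr0 (lwC j k) !fmulN -fmulNl -E opprK.
by rewrite [X in _ + X]opprB addrC addrA subrK opprB.
Qed.
End Coordinates.

(** * Regular functions along the tower of fibrations *)

Section RegularFunctions.
Variables (C : numFieldType) (K : fieldType) (n : nat) (X : coordinates C K n).
Local Notation z := (coord X).
Local Notation dd := (dd X).
Local Notation cst := (cst X).
Local Notation rho := (rho X).
Local Notation code := ('I_n + bool)%type.
Implicit Types (i j k : 'I_n) (f g : K) (s : seq 'I_n) (a : 'I_n -> rat).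

(** Adding one variable at a time exhibits the complement of the arrangement as a
    tower of fibrations by punctured lines; without variables, only constants are
    left. *)
Fixpoint reg s : {pred K} :=
  if s is k :: s' then loc (reg s') (0 :: map z s') (z k)
  else fun f => `[< exists c, f = cst c >].

(** The induction hypothesis along the tower: enough to make the functions of the
    variables added so far a ring of constants for the next derivation, over which
    all differences of punctures are invertible. *)
Record reg_spec s : Prop := RegSpec {
  reg_subring : subring_closed (reg s);
  reg_cst : forall c, cst c \in reg s;
  reg_z : forall i, i \in s -> z i \in reg s;
  reg_zV : forall i, i \in s -> (z i)^-1 \in reg s;
  reg_zBV : forall i j, i \in s -> j \in s -> (z i - z j)^-1 \in reg s;
  reg_dd : forall i f, f \in reg s -> dd i f \in reg s;
  reg_horizontal : forall i f, i \notin s -> f \in reg s -> dd i f = 0 }.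

Definition regS s (H : reg_spec s) : subringClosed K :=
  HB.pack (reg s) (GRing.isSubringClosed.Build K (reg s) (reg_subring H)).

Section Step.
Variables (k : 'I_n) (s : seq 'I_n).
Hypothesis us : uniq (k :: s).
Hypothesis Hs : reg_spec s.
Local Notation A := (regS Hs).
Local Notation ps := (0 :: map z s).

Lemma kNs : k \notin s. Proof. by case/andP: us. Qed.

Lemma fiber_Dx : dd k (z k) = 1. Proof. by rewrite dd_coord eqxx. Qed.
Lemma fiber_DA : {in A, forall c, dd k c = 0}.
Proof. by move=> c; apply: reg_horizontal Hs _ _ kNs. Qed.
Lemma fiber_natV m : (m.+1%:R : K)^-1 \in A.
Proof. by rewrite -(rmorph_nat cst) -fmorphV; apply: (reg_cst Hs). Qed.
Lemma fiber_psA : {subset ps <= A}.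
Proof.
move=> p; rewrite inE => /predU1P[->|/mapP[l ls ->]]; first exact: rpred0.
exact: reg_z Hs _ ls.
Qed.
Lemma fiber_psV : {in ps &, forall p q, (p - q)^-1 \in A}.
Proof.
move=> p q; rewrite !inE => /predU1P[->|/mapP[l ls ->]] /predU1P[->|/mapP[m ms ->]].
- by rewrite subrr invr0 rpred0.
- by rewrite sub0r invrN rpredN; apply: (reg_zV Hs).
- by rewrite subr0; apply: (reg_zV Hs).
exact: (reg_zBV Hs).
Qed.
Lemma fiber_ups : uniq ps.
Proof.
rewrite cons_uniq map_inj_uniq; last exact: z_inj.
have us' : uniq s by case/andP: us.
rewrite us' andbT; apply/mapP => -[l _ /esym/eqP].
by rewrite (negPf (z_neq0 X l)).
Qed.

Definition fiber_pole := loc_pole (dd_der X k) fiber_Dx fiber_DA fiber_psA.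

Lemma reg_step : reg_spec (k :: s).
Proof.
have Dx := fiber_Dx; have DA := fiber_DA; have psA := fiber_psA.
have hD := dd_der X k.
have sub : subring_closed (reg (k :: s)) := loc_subring hD Dx DA psA.
have AB f : f \in reg s -> f \in reg (k :: s) by apply: (@loc_const K A (z k) ps).
have xB : z k \in reg (k :: s) by apply: (@loc_x K A (z k) ps).
have T0 := poles_neq0 hD Dx DA psA.
have bM : {in reg (k :: s) &, forall f g, f * g \in reg (k :: s)} by case: sub.
have bB : {in reg (k :: s) &, forall f g, f - g \in reg (k :: s)} by case: sub.
have b0 : 0 \in reg (k :: s) by apply: AB; apply: (rpred0 A).
have bN f : f \in reg (k :: s) -> - f \in reg (k :: s).
  by move=> fB; rewrite -sub0r bB.
have bD f g : f \in reg (k :: s) -> g \in reg (k :: s) -> f + g \in reg (k :: s).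
  by move=> fB gB; rewrite -[g]opprK bB ?bN.
have poleV p : p \in ps -> (z k - p)^-1 \in reg (k :: s) by apply: fiber_pole.
have zV : (z k)^-1 \in reg (k :: s) by rewrite -[z k]subr0 poleV ?mem_head.
have zBV l : l \in s -> (z k - z l)^-1 \in reg (k :: s).
  by move=> ls; rewrite poleV // inE map_f ?orbT.
split=> //.
- by move=> c; apply: AB; apply: (reg_cst Hs).
- by move=> i; rewrite inE => /predU1P[->//|/(reg_z Hs)/AB].
- by move=> i; rewrite inE => /predU1P[->//|/(reg_zV Hs)/AB].
- move=> i j; rewrite !inE => /predU1P[->|is_] /predU1P[->|js].
  + by rewrite subrr invr0.
  + exact: zBV.
  + by rewrite -opprB invrN bN ?zBV.
  by apply: AB; apply: (reg_zBV Hs).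
- move=> i f /locP[N [Q [QA ->]]]; have hi := dd_der X i.
  have b1 : 1 \in reg (k :: s) by apply: AB; apply: (rpred1 A).
  have bX g m : g \in reg (k :: s) -> g ^+ m \in reg (k :: s).
    by move=> gB; elim: m => [|m IH]; rewrite ?expr0 ?exprS // bM.
  have bn m : m%:R \in reg (k :: s) by apply: AB; apply: (rpred_nat A).
  have QB (P : {poly K}) : P \is a polyOver A -> P.[z k] \in reg (k :: s).
    exact: (@loc_poly K A (z k) ps).
  have DQ (P : {poly K}) : P \is a polyOver A -> dd i P.[z k] \in reg (k :: s).
    move=> PA; rewrite (der_horner hi) bD //.
      apply: QB; apply/polyOverP => m; rewrite coef_map_id0 ?(der0 hi) //.
      by apply: (reg_dd Hs); apply: (polyOverP PA).
    by rewrite bM ?QB ?(polyOver_deriv PA) // dd_coord bn.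
  have TV : (poles ps (z k))^-1 \in reg (k :: s).
    rewrite /poles -prodfV big_seq; elim/big_ind: _ => // p; exact: poleV.
  have PT := PT_over psA.
  rewrite (derM hi) bD // bM ?QB ?DQ // -?exprVn ?bX //.
  rewrite (derX hi) bM ?bM ?bX ?bn // (derV hi) // -exprVn mulNr bN // bM ?bX //.
  by rewrite -PT_horner DQ.
move=> i f; rewrite inE negb_or => /andP[ik is_] /locP[N [Q [QA ->]]].
have hi := dd_der X i.
have DP (P : {poly K}) : P \is a polyOver A -> dd i P.[z k] = 0.
  move=> PA; rewrite (der_horner hi) dd_coord (negPf ik) mulr0 addr0.
  rewrite (_ : map_poly _ _ = 0) ?horner0 //; apply/polyP => m.
  rewrite coef_map_id0 ?(der0 hi) // coef0 (reg_horizontal Hs) //.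
  exact: (polyOverP PA).
rewrite -PT_horner (der_div hi) ?expf_neq0 ?PT_horner // DP //.
rewrite (derX hi) -PT_horner DP ?PT_over // mul0r mulr0 mulr0.
by rewrite subr0 mul0r.
Qed.
End Step.

Lemma reg_nil : reg_spec [::].
Proof.
have regP f : reflect (exists c, f = cst c) (f \in reg [::]) by apply: asboolP.
split=> //.
- split; first by apply/regP; exists 1; rewrite rmorph1.
    move=> f g /regP[c ->] /regP[d ->]; apply/regP.
    by exists (c - d); rewrite rmorphB.
  move=> f g /regP[c ->] /regP[d ->]; apply/regP.
  by exists (c * d); rewrite rmorphM.
- by move=> c; apply/regP; exists c.
- by move=> i f /regP[c ->]; apply/regP; exists 0; rewrite dd_cst rmorph0.
by move=> i f _ /regP[c ->]; rewrite dd_cst.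
Qed.

Lemma reg_ok s : uniq s -> reg_spec s.
Proof.
elim: s => [|k s IH] us; first exact: reg_nil.
by apply: reg_step => //; apply: IH; case/andP: us.
Qed.

Section Closure.
Variable s : seq 'I_n.
Hypothesis us : uniq s.
Let A := regS (reg_ok us).
Lemma reg0 : 0 \in reg s. Proof. exact: (rpred0 A). Qed.
Lemma reg1 : 1 \in reg s. Proof. exact: (rpred1 A). Qed.
Lemma regM f g : f \in reg s -> g \in reg s -> f * g \in reg s. Proof. exact: (@rpredM _ A). Qed.
Lemma regD f g : f \in reg s -> g \in reg s -> f + g \in reg s. Proof. exact: (@rpredD _ A). Qed.
Lemma regN f : f \in reg s -> - f \in reg s. Proof. by move=> fr; rewrite (@rpredN _ A). Qed.
Lemma regX f m : f \in reg s -> f ^+ m \in reg s. Proof. by move=> fr; apply: (@rpredX _ A). Qed.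
Lemma reg_sum (I : Type) (r : seq I) (P : pred I) (F : I -> K) :
  (forall l, P l -> F l \in reg s) -> \sum_(i <- r | P i) F i \in reg s.
Proof. by move=> H; apply: (@rpred_sum _ A). Qed.
Lemma reg_zexp i (m : int) : i \in s -> z i ^ m \in reg s.
Proof.
move=> is_; case: m => m; first by rewrite -exprnP regX // (reg_z (reg_ok us)).
by rewrite NegzE -exprnN -exprVn regX // (reg_zV (reg_ok us)).
Qed.
Lemma reg_ecoef i j p : i \in s -> j \in s -> ecoef X i j p \in reg s.
Proof.
move=> is_ js; rewrite /ecoef edge_coefE ?z_neq0 // invr_expz.
by rewrite !regM ?reg_zexp // (reg_zBV (reg_ok us)).
Qed.
End Closure.

Lemma reg_cons k s f : uniq (k :: s) -> f \in reg s -> f \in reg (k :: s).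
Proof.
move=> us fs; have us' : uniq s by case/andP: us.
by apply: (loc_const _ _ (A := regS (reg_ok us'))).
Qed.

Lemma reg_generated (P : {pred K}) s : uniq s ->
  (forall c, cst c \in P) -> (forall i, z i \in P) -> (forall i, (z i)^-1 \in P) ->
  (forall i j, (z i - z j)^-1 \in P) ->
  (forall f g, f \in P -> g \in P -> f + g \in P) ->
  (forall f g, f \in P -> g \in P -> f * g \in P) -> {subset reg s <= P}.
Proof.
move=> us Pc Pz PzV PzBV PD PM.
have P0 : 0 \in P by rewrite -(rmorph0 cst).
have P1 : 1 \in P by rewrite -(rmorph1 cst).
elim: s us => [|k s IH] us f; first by case/asboolP => c ->.
have us' : uniq s by case/andP: us.
case/asboolP => N [Q [QA ->]]; apply: (PM).
  elim/poly_ind: Q QA => [|Q c IHQ] QA; first by rewrite horner0.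
  have H := @polyOverP _ (regS (reg_ok us')) _ QA.
  rewrite hornerMXaddC; apply: (PD); last first.
    by apply: IH => //; have := H 0%N; rewrite coefD coefMX coefC /= add0r.
  apply: (PM) => //; apply: IHQ; apply/(@polyOverP _ (regS (reg_ok us'))) => m.
  by have := H m.+1; rewrite coefD coefMX coefC /= addr0.
rewrite -exprVn; elim: N => [|N IHN]; first by rewrite expr0.
rewrite exprS; apply: (PM) => //; rewrite /poles -prodfV big_seq.
elim/big_ind: _ => // p; rewrite inE => /predU1P[->|/mapP[l _ ->]] //.
by rewrite subr0.
Qed.

Section FiberCohomology.
Variables (k : 'I_n) (s : seq 'I_n) (q : rat).
Hypothesis us : uniq (k :: s).
Let us' : uniq s. Proof. by case/andP: us. Qed.
Local Notation Hs := (reg_ok us').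
Local Notation A := (regS Hs).
Local Notation ps := (0 :: map z s).
Local Notation x := (z k).
Local Notation t := (Num.floor q).
Local Notation D := (dd k).
Local Notation sg := (rho q - t%:~R).

Definition is_valid (d : code) := if d is inl j then j \in s else q \is a Num.int.

(** The coefficient of [dz_k] in the block of [k] with code [d]. *)
Definition hcoef (d : code) : K :=
  match d with
  | inl j => ecoef X k j (Num.ceil q)
  | inr true => x ^ (- t - 1)
  | inr false => 0
  end.

Definition tw1 f := D f + rho q / x * f.

Lemma sum_codes (F : code -> K) :
  \sum_(d | is_valid d && ~~ is_open d) F d
  = \sum_(l <- s) F (inl l) + (if q \is a Num.int then F (inr true) else 0).
Proof.
rewrite big_sumType /= big_uniq //=; congr (_ + _).
  by apply: eq_bigl => l; rewrite andbT.
rewrite big_mkcond big_bool /is_open /= andbT andbF addr0.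
by [].
Qed.

Let hD := dd_der X k.
Let x0 : x != 0 := z_neq0 X k.

(** A monomial in [x] changes the exponent by an integer, so that it can be
    assumed to be 0 or not an integer. *)
Lemma tw_gauge g : tw1 (x ^ (- t) * g) = x ^ (- t) * (D g + sg / x * g).
Proof.
rewrite /tw1 (derM hD) (der_expz_twist hD) // dd_coord eqxx rmorphN /=.
by move: (x ^ _) (t%:~R) (rho q) => u p v; field.
Qed.

Lemma xz l : l \in s -> x - z l != 0.
Proof. by move=> ls; apply: zB_neq0; apply: contraNneq (kNs us) => ->. Qed.

Lemma hcoef_int l : q \is a Num.int -> l \in s ->
  hcoef (inl l) = x ^ (- t) * z l ^ t / (x - z l).
Proof.
move=> qint ls; rewrite /hcoef /ecoef ceil_floor qint addr0 edge_coefE ?z_neq0 //.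
by rewrite invr_expz.
Qed.

Lemma hcoef_nonint l : q \isn't a Num.int -> l \in s ->
  hcoef (inl l) = x ^ (- t) * z l ^ t * ((x - z l)^-1 - x^-1).
Proof.
move=> qint ls; rewrite /hcoef /ecoef ceil_floor qint /= edge_coefE ?z_neq0 //.
rewrite !expfzDr ?z_neq0 // !expr1z -invr_expz.
have := expfz_neq0 t x0; have := xz ls; move: (x ^ t) (z l ^ t) => u v xl u0.
by field; rewrite xl u0 x0.
Qed.

Lemma regA f : f \in reg s -> f \in A. Proof. by []. Qed.

Lemma sgA : sg \in A.
Proof.
apply: (@rpredB _ A); first exact: (reg_cst Hs).
by rewrite rpred_int.
Qed.

Lemma sg_int : q \is a Num.int -> sg = 0.
Proof. by move=> qint; rewrite rho_int // subrr. Qed.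

Lemma sgE (m : int) : sg + m%:~R = rho (q - t%:~R + m%:~R).
Proof. by rewrite rhoD /rho rmorphB !rmorphD !rmorphN !rmorph_int. Qed.

Lemma sg_nonint : q \isn't a Num.int -> forall m : int, sg + m%:~R != 0.
Proof.
move=> qint m; rewrite sgE rho_neq0 //; apply: contra qint => /eqP E.
have -> : q = (q - t%:~R + m%:~R) + (t - m)%:~R by rewrite rmorphB /=; ring.
by rewrite E add0r intr_int.
Qed.

Lemma sgV (m : int) : (sg + m%:~R)^-1 \in A.
Proof. by rewrite sgE /rho -!fmorphV; apply: (reg_cst Hs). Qed.

Let Dx : D x = 1. Proof. exact: fiber_Dx. Qed.
Let DA : {in A, forall c, D c = 0}. Proof. exact: (@fiber_DA k s us Hs). Qed.
Let psA : {subset ps <= A}. Proof. exact: fiber_psA. Qed.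
Let psV : {in ps &, forall p p', (p - p')^-1 \in A}. Proof. exact: fiber_psV. Qed.
Let natV m : (m.+1%:R : K)^-1 \in A. Proof. exact: fiber_natV. Qed.
Let ups : uniq ps. Proof. exact: (@fiber_ups k s us). Qed.
Let c0 := char0 X.

Lemma sum_poles (F : K -> K) : \sum_(p <- ps) F p = F 0 + \sum_(l <- s) F (z l).
Proof. by rewrite big_cons big_map. Qed.

Let xk i (m : int) : i \in k :: s -> z i ^ m \in reg (k :: s).
Proof. exact: reg_zexp. Qed.

(** The first cohomology of the fibre is generated by the simple poles. For a
    nonintegral exponent [1 / x] is exact, and the correction [G] completes each
    [1 / (x - z_l)] to [1 / (x - z_l) - 1 / x], a monomial away from the
    coefficient of a block. *)
Lemma fiber_exists f : f \in reg (k :: s) -> exists g (c : code -> K),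
  [/\ g \in reg (k :: s), forall d, c d \in reg s
   & f = tw1 g + \sum_(d | is_valid d && ~~ is_open d) c d * hcoef d].
Proof.
move=> fB; pose f' := x ^ t * f.
have f'B : f' \in reg (k :: s) by apply: regM => //; rewrite xk ?mem_head.
have fE : f = x ^ (- t) * f'.
  by rewrite /f' mulrA -invr_expz mulVf ?mul1r // expfz_neq0.
have ps0 : 0 \in ps by rewrite mem_head.
have [qint|qint] := boolP (q \is a Num.int).
  have [c [cA _ [g gB E]]] := reducible_untwisted hD Dx DA c0 natV ups psA psV (sg_int qint) f'B.
  exists (x ^ (- t) * g).
  exists (fun d =>
    match d with inl l => if l \in s then c (z l) * z l ^ (- t) else 0 | inr _ => c 0 end).
  split; first by apply: regM => //; rewrite xk ?mem_head.
    case=> [l|_]; last exact: cA.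
    case: ifP => ls; last exact: reg0.
    by apply: regM; [exact: us'|exact: cA|exact: reg_zexp].
  rewrite sum_codes qint tw_gauge fE E mulrDr; congr (_ + _).
  rewrite sum_poles subr0 mulrDr addrC; congr (_ + _).
    rewrite mulr_sumr !big_seq; apply: eq_bigr => l ls; rewrite ls hcoef_int //.
    have := expfz_neq0 t (z_neq0 X l); rewrite -!invr_expz => zl0.
    by have := xz ls; move: (x ^ t)^-1 (z l ^ t) zl0 => u v v0 xl; field; rewrite v0 xl.
  by rewrite /= expfzDr // exprN1; ring.
have sg0 : sg != 0 by rewrite -[sg]addr0; apply: (sg_nonint qint 0).
have [c [cA c00 [g gB E]]] := reducible_twisted hD Dx DA c0 natV ups psA psV sgA ps0
  (sg_nonint qint) sgV f'B.
have {}c00 : c 0 = 0 by case: c00 => // /eqP; rewrite (negPf sg0).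
pose G := (\sum_(l <- s) c (z l)) / sg.
have GA : G \in reg s.
  apply: regM => //; first by apply: reg_sum => // l _; apply: cA.
  by rewrite -[sg]addr0; apply: (sgV 0).
(* adding G to g subtracts (sum of the residues) / x: it is constant along the fibre *)
exists (x ^ (- t) * (g + G)).
exists (fun d =>
  match d with inl l => if l \in s then c (z l) * z l ^ (- t) else 0 | inr _ => 0 end).
split.
- apply: regM => //; first by rewrite xk ?mem_head.
  by apply: regD => //; apply: reg_cons.
- case=> [l|_]; last exact: reg0.
  case: ifP => ls; last exact: reg0.
  by apply: regM; [exact: us'|exact: cA|exact: reg_zexp].
rewrite sum_codes (negPf qint) addr0 tw_gauge fE E sum_poles c00 mul0r add0r.
rewrite (derD hD) (DA (regA GA)) addr0.
have -> : \sum_(l <- s) (if l \in s then c (z l) * z l ^ (- t) else 0) * hcoef (inl l)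
    = x ^ (- t) * (\sum_(l <- s) c (z l) / (x - z l) - (\sum_(l <- s) c (z l)) / x).
  rewrite mulrBr mulr_suml !mulr_sumr -sumrB !big_seq; apply: eq_bigr => l ls.
  rewrite ls hcoef_nonint //.
  have := expfz_neq0 t (z_neq0 X l); rewrite -!invr_expz => zl0.
  by have := xz ls; move: (x ^ t)^-1 (z l ^ t) zl0 => u v v0 xl; field; rewrite v0 xl x0.
rewrite /G; move: (D g) (\sum_(l <- s) c (z l)) (\sum_(l <- s) _ / _) (x ^ _) => g' S1 S2 u.
by move: sg sg0 => v v0; field; rewrite v0 x0.
Qed.

Lemma fiber_unique g (c : code -> K) : g \in reg (k :: s) ->
  (forall d, is_valid d -> ~~ is_open d -> c d \in reg s) ->
  tw1 g + \sum_(d | is_valid d && ~~ is_open d) c d * hcoef d = 0 ->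
  forall d, is_valid d -> ~~ is_open d -> c d = 0.
Proof.
move=> gB cA; rewrite sum_codes => H.
have ps0 : 0 \in ps by rewrite mem_head.
have cl l : l \in s -> c (inl l) \in reg s by move=> ls; apply: cA.
(* residues of the combination at the punctures, once the monomial x^t is factored out *)
pose e p := if p == 0 then (if q \is a Num.int then c (inr true) else 0)
            else \sum_(l <- s | z l == p) c (inl l) * z l ^ t.
have e0 : e 0 = if q \is a Num.int then c (inr true) else 0 by rewrite /e eqxx.
have el l : l \in s -> e (z l) = c (inl l) * z l ^ t.
  move=> ls; rewrite /e (negPf (z_neq0 X l)) (big_rem l) //= eqxx big_seq_cond big1 ?addr0 //.
  move=> m; rewrite mem_rem_uniq // inE => /andP[/andP[ml _]].
  by rewrite (inj_eq (@z_inj _ _ _ X)) (negPf ml).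
have eA p : e p \in A.
  rewrite /e; case: ifP => _.
    by case: ifP => qint; [apply: cA|exact: reg0].
  rewrite big_seq_cond; apply: reg_sum => // l /andP[ls _].
  by apply: regM; rewrite ?cl ?reg_zexp.
pose g' := x ^ t * g.
have g'B : g' \in reg (k :: s) by apply: regM => //; rewrite xk ?mem_head.
have gE : g = x ^ (- t) * g'.
  by rewrite /g' mulrA -invr_expz mulVf ?mul1r // expfz_neq0.
have xt0 : x ^ (- t) != 0 by rewrite expfz_neq0.
have conclude : {in ps, forall p, e p = 0} ->
    forall d, is_valid d -> ~~ is_open d -> c d = 0.
  move=> ep [l ls _|[] //= qint _]; last by have := ep 0 ps0; rewrite e0 qint.
  have : e (z l) = 0 by apply: ep; rewrite inE map_f ?orbT.
  by rewrite el // => /eqP; rewrite mulf_eq0 (negPf (expfz_neq0 _ (z_neq0 X l))) orbF => /eqP.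
rewrite gE tw_gauge in H; apply: conclude.
have [qint|qint] := boolP (q \is a Num.int).
  apply: (residues_unique hD Dx DA c0 ups psA sgA eA g'B (or_introl (sg_int qint))).
  apply: (mulfI xt0); rewrite mulr0 -[RHS]H qint mulrDr; congr (_ + _).
  rewrite sum_poles e0 qint subr0 mulrDr addrC; congr (_ + _).
    rewrite mulr_sumr !big_seq; apply: eq_bigr => l ls; rewrite el // hcoef_int //.
    by ring.
  by rewrite /= expfzDr // exprN1; ring.
have sg0 : sg != 0 by rewrite -[sg]addr0; apply: (sg_nonint qint 0).
pose G := (\sum_(l <- s) c (inl l) * z l ^ t) / sg.
have GA : G \in reg s.
  apply: regM => //.
    rewrite big_seq; apply: reg_sum => // l ls.
    by apply: regM; rewrite ?cl ?reg_zexp.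
  by rewrite -[sg]addr0; apply: (sgV 0).
have gGB : g' - G \in reg (k :: s).
  by apply: regD => //; apply: regN => //; apply: reg_cons.
apply: (residues_unique hD Dx DA c0 ups psA sgA eA gGB).
  by right; rewrite e0 (negPf qint).
apply: (mulfI xt0); rewrite mulr0 -[RHS]H (negPf qint) addr0 sum_poles e0 (negPf qint).
rewrite mul0r add0r (derB hD) (DA (regA GA)) subr0.
have -> : \sum_(l <- s) c (inl l) * hcoef (inl l)
    = x ^ (- t) * (\sum_(l <- s) e (z l) / (x - z l) - (\sum_(l <- s) c (inl l) * z l ^ t) / x).
  rewrite mulrBr mulr_suml !mulr_sumr -sumrB !big_seq; apply: eq_bigr => l ls.
  by rewrite el // hcoef_nonint //; ring.
rewrite /G; move: (D g') (\sum_(l <- s) c (inl l) * _) (\sum_(l <- s) _ / _) (x ^ _) => h S1 S2 u.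
by move: sg sg0 => v v0; field; rewrite v0 x0.
Qed.

Lemma fiber_horizontal g : g \in reg (k :: s) -> tw1 g = 0 ->
  if q \is a Num.int then exists2 c, c \in reg s & g = x ^ (- t) * c else g = 0.
Proof.
move=> gB; pose g' := x ^ t * g.
have g'B : g' \in reg (k :: s) by apply: regM => //; rewrite xk ?mem_head.
have gE : g = x ^ (- t) * g'.
  by rewrite /g' mulrA -invr_expz mulVf ?mul1r // expfz_neq0.
have xt0 : x ^ (- t) != 0 by rewrite expfz_neq0.
rewrite gE tw_gauge => /eqP; rewrite mulf_eq0 (negPf xt0) /= => /eqP H.
have ps0 : 0 \in ps by rewrite mem_head.
case: ifP => qint.
  exists g' => //.
  exact: (horizontal_untwisted hD Dx DA c0 psA (sg_int qint) g'B H).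
rewrite (horizontal_twisted hD Dx DA c0 psA sgA (sg_nonint (negbT qint)) g'B H).
by rewrite mulr0.
Qed.
End FiberCohomology.

End RegularFunctions.

(** * Regular forms along the tower of fibrations *)

Section RegularForms.
Variables (C : numFieldType) (K : fieldType) (n : nat) (X : coordinates C K n).
Local Notation z := (coord X).
Local Notation tw := (tw X).
Local Notation nab := (nab X).
Local Notation reg := (reg X).
Local Notation block := (block X).
Local Notation upd := (@upd n).
Local Notation aform := {ffun {set 'I_n} -> K}.
Local Notation code := ('I_n + bool)%type.
Implicit Types (i j k : 'I_n) (f g : K) (s t : seq 'I_n) (a : 'I_n -> rat).
Implicit Types (alpha beta eta theta : aform) (d : code) (S : {set 'I_n}).

(** Forms in the differentials of [t] with coefficients regular in the variables
    [s]. Forms without [dz_k] on the total space of the fibration by [z_k] are the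
    case [Om (k :: s) s]. *)
Definition Om s t alpha :=
  (forall S, alpha S \in reg s) /\ (forall S i, alpha S != 0 -> i \in S -> i \in t).

Definition supported a s := forall i, i \notin s -> a i = 0.

Section OmClosure.
Variables (s t : seq 'I_n).
Hypothesis us : uniq s.

Lemma Om0 : Om s t 0.
Proof. by split=> [S|S i]; rewrite ffunE ?eqxx // reg0. Qed.

Lemma Om_add alpha beta : Om s t alpha -> Om s t beta -> Om s t (alpha + beta).
Proof.
move=> [ra ta] [rb tb]; split=> [S|S i]; rewrite ffunE; first exact: regD.
have [->|aS _ iS] := eqVneq (alpha S) 0; first by rewrite add0r; apply: tb.
exact: ta iS.
Qed.

Lemma Om_fmul f alpha : f \in reg s -> Om s t alpha -> Om s t (fmul f alpha).
Proof.
move=> fr [ra ta]; split=> [S|S i]; rewrite ffunE; first exact: regM.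
by rewrite mulf_eq0 negb_or => /andP[_]; apply: ta.
Qed.

Lemma Om_opp alpha : Om s t alpha -> Om s t (- alpha).
Proof.
move=> [ra ta]; split=> [S|S i]; rewrite ffunE; first exact: regN.
by rewrite oppr_eq0; apply: ta.
Qed.

Lemma Om_sum (I : Type) (r : seq I) (P : pred I) (F : I -> aform) :
  (forall l, P l -> Om s t (F l)) -> Om s t (\sum_(l <- r | P l) F l).
Proof.
by move=> H; elim/big_rec: _ => [|l u Pl uO]; [exact: Om0|apply: Om_add => //; apply: H].
Qed.

Lemma Om_lw i alpha : i \in t -> Om s t alpha -> Om s t (lw i alpha).
Proof.
move=> it [ra ta]; split=> [S|S j]; rewrite ffunE; case: ifP => iS; rewrite ?reg0 ?eqxx //.
  by rewrite regM // -signr_odd regX // regN // reg1.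
rewrite mulf_eq0 negb_or => /andP[_] aS jS.
have [->//|ji] := eqVneq j i; apply: ta aS _.
by rewrite !inE ji.
Qed.

Lemma tw_reg a i f : f \in reg s -> i \in s \/ a i = 0 -> tw a i f \in reg s.
Proof.
move=> fr ia; rewrite /tw regD ?(reg_dd (reg_ok X us)) //.
case: ia => [is_|->]; last by rewrite rho0 !mul0r reg0.
by rewrite !regM // ?(reg_zV (reg_ok X us)) // (reg_cst (reg_ok X us)).
Qed.

Lemma Om_tw a i alpha : i \in s \/ a i = 0 -> Om s t alpha -> Om s t (fmap (tw a i) alpha).
Proof.
move=> ia [ra ta]; split=> [S|S j]; rewrite ffunE; first exact: tw_reg.
have [->|aS _] := eqVneq (alpha S) 0; last exact: ta.
by rewrite tw0 eqxx.
Qed.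

Lemma tw_out a i f : supported a s -> i \notin s -> f \in reg s -> tw a i f = 0.
Proof.
move=> sa is_ fr; rewrite /tw (sa _ is_) rho0 !mul0r addr0.
exact: (reg_horizontal (reg_ok X us)).
Qed.

Lemma Om_nab a alpha : supported a s -> {subset s <= t} -> Om s t alpha -> Om s t (nab a alpha).
Proof.
move=> sa st aO; apply: Om_sum => i _; have [is_|is_] := boolP (i \in s).
  by apply: Om_lw; [exact: st|apply: Om_tw => //; left].
rewrite (_ : fmap _ _ = 0) ?lw0; first exact: Om0.
by apply/ffunP => S; rewrite !ffunE tw_out //; apply: aO.1.
Qed.

Lemma Om_sub t' alpha : {subset t <= t'} -> Om s t alpha -> Om s t' alpha.
Proof. by move=> tt [ra ta]; split=> // S i aS iS; apply: tt; apply: ta aS iS. Qed.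

Lemma Om_free k alpha : k \notin t -> Om s t alpha -> free_of k alpha.
Proof.
move=> kt [_ ta] S kS; apply/eqP; apply: contraNT kt => aS.
exact: ta aS kS.
Qed.

End OmClosure.

Lemma Om_cons k s t alpha : uniq (k :: s) -> Om s t alpha -> Om (k :: s) t alpha.
Proof. by move=> us [ra ta]; split=> // S; apply: reg_cons. Qed.

Lemma supported_upd a k s d : supported a (k :: s) -> is_valid s (a k) d ->
  supported (upd a k d) s.
Proof.
move=> sa vd i is_; rewrite /upd; case: eqP => // /eqP ik.
have ai : a i = 0 by apply: sa; rewrite inE negb_or ik.
case: d vd => [j js|//]; case: eqP => // ij.
by move: is_; rewrite ij (js : j \in s).
Qed.

Section Fibration.
Variables (k : 'I_n) (s : seq 'I_n) (a : 'I_n -> rat).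
Hypothesis us : uniq (k :: s).
Let us' : uniq s. Proof. by case/andP: us. Qed.
Let ks : k \notin s. Proof. by case/andP: us. Qed.
Hypothesis sa : supported a (k :: s).
Local Notation valid := (is_valid s (a k)).

Lemma Om_block d theta : valid d -> Om s s theta -> Om (k :: s) (k :: s) (block k d (a k) theta).
Proof.
move=> vd tO; have tO' : Om (k :: s) (k :: s) theta.
  by apply: Om_cons => //; apply: Om_sub tO => i; rewrite inE orbC => ->.
case: d vd => [j js|[] _] /=.
- have jks : j \in k :: s by rewrite inE (js : j \in s) orbT.
  apply: Om_add => //; last apply: Om_opp => //; apply: Om_fmul => //.
  + by apply: reg_ecoef; rewrite ?mem_head.
  + by apply: Om_lw; rewrite ?mem_head.
  + by apply: reg_ecoef; rewrite ?mem_head.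
  by apply: Om_lw.
- apply: Om_fmul => //; first by apply: reg_zexp; rewrite ?mem_head.
  by apply: Om_lw; rewrite ?mem_head.
by apply: Om_fmul => //; apply: reg_zexp; rewrite ?mem_head.
Qed.

Lemma free_theta theta : Om s s theta -> free_of k theta.
Proof. by apply: Om_free; apply: ks. Qed.

Lemma coef_dz_block d theta : valid d -> Om s s theta ->
  coef_dz k (block k d (a k) theta) = fmul (hcoef X k (a k) d) theta.
Proof.
move=> vd tO; have ft := free_theta tO; case: d vd => [j js|[] _] /=.
- have jk : j != k by apply: contraNneq ks => <-; exact: js.
  rewrite coef_dzD coef_dz_fmul coef_dz_lw // -fmulNl coef_dz_fmul.
  by rewrite (coef_dz_of_free (free_lw jk ft)) fmulr0 addr0.
- by rewrite coef_dz_fmul coef_dz_lw.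
by rewrite coef_dz_fmul coef_dz_of_free // fmulr0 fmul0.
Qed.

Lemma coef_dz_nab (g : aform) : free_of k g -> coef_dz k (nab a g) = fmap (tw a k) g.
Proof.
move=> fg; have ft i : free_of k (fmap (tw a i) g).
  by move=> S kS; rewrite ffunE fg // tw0.
rewrite coef_dz_sum (bigD1 k) //= coef_dz_lw // big1 ?addr0 // => i ik.
by rewrite coef_dz_of_free //; apply: free_lw.
Qed.

(** [fiber_exists] is applied to each coefficient of [coef_dz k eta]; what is left
    of [eta] has no [dz_k]. *)
Lemma form_exists eta : Om (k :: s) (k :: s) eta -> exists (g : aform) (theta : code -> aform) eta0,
  [/\ Om (k :: s) s g, forall d, Om s s (theta d), Om (k :: s) s eta0
   & eta = nab a g + \sum_(d | valid d && ~~ is_open d) block k d (a k) (theta d) + eta0].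
Proof.
move=> eO; pose u := coef_dz k eta.
have uO : Om (k :: s) s u.
  split=> [S|S i]; rewrite ffunE; case: ifP => kS; rewrite ?reg0 ?eqxx //.
    by rewrite regM // ?(eO.1) // -signr_odd regX // regN // reg1.
  rewrite mulf_eq0 negb_or => /andP[_ eS] iS.
  have : i \in k :: s by apply: eO.2 eS _; rewrite !inE iS orbT.
  by rewrite inE => /predU1P[ik|//]; rewrite ik kS in iS.
have /choice[h hP] : forall S, exists gc : K * (code -> K),
    [/\ gc.1 \in reg (k :: s), forall d, gc.2 d \in reg s
      & u S = tw1 X k (a k) gc.1 + \sum_(d | valid d && ~~ is_open d) gc.2 d * hcoef X k (a k) d].
  move=> S; have [g [c [gB cA E]]] := fiber_exists (a k) us (uO.1 S).
  by exists (g, c).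
pose g : aform := [ffun S : {set 'I_n} => if [forall i in S, i \in s] then (h S).1 else 0].
pose theta d : aform := [ffun S : {set 'I_n} => if [forall i in S, i \in s] then (h S).2 d else 0].
have gO : Om (k :: s) s g.
  split=> [S|S i]; rewrite ffunE; case: ifP => [/forall_inP Ss|_]; rewrite ?reg0 ?eqxx //.
    by case: (hP S).
  by move=> _ /Ss.
have tO d : Om s s (theta d).
  split=> [S|S i]; rewrite ffunE; case: ifP => [/forall_inP Ss|_]; rewrite ?reg0 ?eqxx //.
    by case: (hP S).
  by move=> _ /Ss.
pose eta0 := eta - (nab a g + \sum_(d | valid d && ~~ is_open d) block k d (a k) (theta d)).
have e0O : Om (k :: s) (k :: s) eta0.
  apply: Om_add => //; apply: Om_opp => //; apply: Om_add => //.
    by apply: Om_nab => //; apply: Om_sub gO => i; rewrite inE orbC => ->.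
  by apply: Om_sum => // d /andP[vd _]; apply: Om_block.
have c0 : coef_dz k eta0 = 0.
  have fg : free_of k g := Om_free ks gO.
  have NE beta : - beta = fmul (-1) beta by rewrite fmulNl fmul1.
  rewrite /eta0 coef_dzD NE coef_dz_fmul coef_dzD coef_dz_nab // coef_dz_sum.
  apply/eqP; rewrite fmulNl fmul1 subr_eq0; apply/eqP/ffunP => S; rewrite [RHS]ffunE.
  rewrite sum_ffunE [in RHS]ffunE.
  have -> : \sum_(d | valid d && ~~ is_open d) coef_dz k (block k d (a k) (theta d)) S
     = \sum_(d | valid d && ~~ is_open d) theta d S * hcoef X k (a k) d.
    by apply: eq_bigr => d /andP[vd _]; rewrite coef_dz_block // ffunE mulrC.
  case: (boolP [forall i in S, i \in s]) => Ss.
    have [_ _ ->] := hP S; rewrite ffunE Ss; congr (_ + _).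
    by apply: eq_bigr => d _; rewrite ffunE Ss.
  have -> : u S = 0.
    apply/eqP; apply: contraNT Ss => uS; apply/forall_inP => i; exact: uO.2 uS.
  rewrite ffunE (negPf Ss) tw0 add0r big1 // => d _.
  by rewrite ffunE (negPf Ss) mul0r.
exists g, theta, eta0; split=> //; last by rewrite /eta0 addrC subrK.
split=> [S|S i eS iS]; first exact: e0O.1.
have := e0O.2 S i eS iS; rewrite inE => /predU1P[ik|//]; move: eS.
rewrite (dz_decomposition k eta0) c0 lw0 add0r ffunE -ik iS.
by rewrite eqxx.
Qed.

(** [fiber_unique] applied to each coefficient of the contraction along [z_k]. *)
Lemma form_unique (g : aform) (theta : code -> aform) zeta :
  Om (k :: s) s g -> (forall d, valid d -> ~~ is_open d -> Om s s (theta d)) ->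
  free_of k zeta ->
  \sum_(d | valid d && ~~ is_open d) block k d (a k) (theta d) + nab a g + zeta = 0 ->
  (forall d, valid d -> ~~ is_open d -> theta d = 0) /\ (forall S, tw a k (g S) = 0).
Proof.
move=> gO tO fz /(congr1 (coef_dz k)); have fg : free_of k g := Om_free ks gO.
rewrite !coef_dzD coef_dz0 coef_dz_sum coef_dz_nab // (coef_dz_of_free fz) addr0 => H.
have HS S : tw1 X k (a k) (g S)
    + \sum_(d | valid d && ~~ is_open d) theta d S * hcoef X k (a k) d = 0.
  have := congr1 (fun w : aform => w S) H; rewrite !ffunE sum_ffunE addrC => {2}<-.
  congr (_ + _); apply: eq_bigr => d /andP[vd od].
  by rewrite coef_dz_block ?ffunE 1?mulrC //; apply: tO.
have t0 d : valid d -> ~~ is_open d -> theta d = 0.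
  move=> vd od; apply/ffunP => S; rewrite ffunE.
  apply: (fiber_unique us (gO.1 S) _ (HS S) vd od) => d' vd' od'.
  by apply: (tO _ vd' od').1.
split=> // S; have := HS S; rewrite big1 ?addr0 // => d /andP[vd od].
by rewrite t0 // ffunE mul0r.
Qed.

Lemma form_horizontal (g : aform) : Om (k :: s) s g -> (forall S, tw a k (g S) = 0) ->
  if a k \is a Num.int then exists2 xi, Om s s xi & g = block k (inr false) (a k) xi
  else g = 0.
Proof.
move=> gO g0; case: ifP => aint; last first.
  apply/ffunP => S; rewrite ffunE.
  by have := fiber_horizontal us (gO.1 S) (g0 S); rewrite aint.
(* horizontal functions are multiples of the monomial of the open root *)
exists (fmul (z k ^ (Num.floor (a k))) g).
  split=> [S|S i]; rewrite ffunE.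
    have := fiber_horizontal us (gO.1 S) (g0 S); rewrite aint => -[c cA ->].
    by rewrite mulrA -expfzDr ?z_neq0 // subrr expr0z mul1r.
  by rewrite mulf_eq0 negb_or => /andP[_]; apply: gO.2.
by rewrite /block fmulA -expfzDr ?z_neq0 // addNr expr0z fmul1.
Qed.
End Fibration.

End RegularForms.

(** * Relations between blocks *)

Section FloorSums.
Implicit Types p q : rat.

Lemma ceil_bounds p : (Num.ceil p)%:~R - 1 < p /\ p <= (Num.ceil p)%:~R.
Proof. by have /andP[] := ceil_itv p; rewrite rmorphB. Qed.

Lemma floor_bounds p : (Num.floor p)%:~R <= p /\ p < (Num.floor p)%:~R + 1.
Proof. by have /andP[] := floor_itv p; rewrite rmorphD. Qed.

Lemma floorD_ceil p q :
  Num.floor (p + q) = Num.ceil p + Num.floor q \/ Num.floor (p + q) = Num.ceil p + Num.floor q - 1.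
Proof.
have [p1 p2] := ceil_bounds p; have [q1 q2] := floor_bounds q.
have [] := floor_bounds (p + q).
move: (Num.ceil p) (Num.floor q) (Num.floor (p + q)) p1 p2 q1 q2 => P Q R p1 p2 q1 q2 r1 r2.
have : R%:~R < (P + Q + 1)%:~R :> rat by rewrite !intrD; lra.
have : (P + Q)%:~R < (R + 2)%:~R :> rat by rewrite !intrD; lra.
rewrite !ltr_int; lia.
Qed.

Lemma ceilD p q :
  Num.ceil (p + q) = Num.ceil p + Num.ceil q \/ Num.ceil (p + q) = Num.ceil p + Num.ceil q - 1.
Proof.
have [p1 p2] := ceil_bounds p; have [q1 q2] := ceil_bounds q.
have [] := ceil_bounds (p + q).
move: (Num.ceil p) (Num.ceil q) (Num.ceil (p + q)) p1 p2 q1 q2 => P Q R p1 p2 q1 q2 r1 r2.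
have : R%:~R < (P + Q + 1)%:~R :> rat by rewrite !intrD; lra.
have : (P + Q)%:~R < (R + 2)%:~R :> rat by rewrite !intrD; lra.
rewrite !ltr_int; lia.
Qed.

Lemma floor_int_sum p q : p + q \is a Num.int -> Num.floor (p + q) = Num.ceil p + Num.floor q.
Proof.
move=> pq; have [p1 p2] := ceil_bounds p; have [q1 q2] := floor_bounds q.
move: pq; rewrite intrEfloor => /eqP.
move: (Num.ceil p) (Num.floor q) (Num.floor (p + q)) p1 p2 q1 q2 => P Q R p1 p2 q1 q2 r.
have : R%:~R < (P + Q + 1)%:~R :> rat by rewrite !intrD; lra.
have : (P + Q)%:~R < (R + 1)%:~R :> rat by rewrite !intrD; lra.
rewrite !ltr_int; lia.
Qed.

End FloorSums.

Section Relations.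
Variables (C : numFieldType) (K : fieldType) (n : nat) (X : coordinates C K n).
Local Notation z := (coord X).
Local Notation block := (block X).
Local Notation upd := (@upd n).
Local Notation ecoef := (ecoef X).
Local Notation aform := {ffun {set 'I_n} -> K}.
Local Notation code := ('I_n + bool)%type.
Implicit Types (i j k m : 'I_n) (s : seq 'I_n) (a : 'I_n -> rat) (p q : rat).
Implicit Types (alpha beta : aform) (d c : code).

Let zn i j : i != j -> z i != z j. Proof. exact: z_neq. Qed.
Let z0 i : z i != 0. Proof. exact: z_neq0. Qed.

(** The coefficients of the three products of two differentials are instances of
    [three_term], where both weights are rounded up, or one is rounded up and the
    other down. *)
Lemma block_three_term i m k p q alpha : i != m -> i != k -> m != k ->
  block i (inl m) p (block m (inl k) (q + p) alpha)
  = block m (inl i) q (block i (inl k) (p + q) alpha)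
    + block i (inl k) p (block m (inl k) q alpha).
Proof.
move=> im ik mk; rewrite (addrC q).
have E1 := three_term (z0 i) (z0 m) (z0 k) (zn im) (zn ik) (zn mk) (ceilD p q).
have E2 := three_term (z0 i) (z0 m) (z0 k) (zn im) (zn ik) (zn mk) (floorD_ceil p q).
have E3 : Num.floor (p + q) = Num.floor p + Num.ceil q
    \/ Num.floor (p + q) = Num.floor p + Num.ceil q - 1.
  by rewrite (addrC p) (addrC (Num.floor p)); apply: floorD_ceil.
have {}E3 := three_term (z0 i) (z0 m) (z0 k) (zn im) (zn ik) (zn mk) E3.
rewrite /= !(lwD, lwN, lw_fmul, lw2, fmulDr, fmulN, fmulr0) (lwC m i) (lwC k m).
rewrite !(fmulN, fmulr0).
apply/ffunP => S; move: (lw i (lw m alpha)) (lw i (lw k alpha)) (lw m (lw k alpha)).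
move=> A B D; rewrite !ffunE; move: (A S) (B S) (D S) => u v w {A B D}.
rewrite /ecoef; move/eqP: E1; rewrite -subr_eq0 => /eqP E1.
move/eqP: E2; rewrite -subr_eq0 => /eqP E2; move/eqP: E3; rewrite -subr_eq0 => /eqP E3.
apply/eqP; rewrite -subr_eq0; apply/eqP.
have : forall x y t : K, x = 0 -> y = 0 -> t = 0 -> u * x - v * y + w * t = 0.
  by move=> x y t -> -> ->; rewrite !mulr0 subrr addr0.
move=> /(_ _ _ _ E1 E2 E3) {3}<-; ring.
Qed.

Lemma block_reverse_open i m p q alpha : i != m -> p + q \is a Num.int ->
  block i (inl m) p (block m (inr false) (q + p) alpha)
  = block m (inl i) q (block i (inr false) (p + q) alpha).
Proof.
move=> im pq; rewrite (addrC q).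
have N1 := floor_int_sum pq; have N2 : Num.floor (p + q) = Num.floor p + Num.ceil q.
  by rewrite addrC floor_int_sum 1?addrC.
have := reverse_edge (Num.ceil p) (Num.floor q) (z0 i) (z0 m) (zn im).
have := reverse_edge (Num.floor p) (Num.ceil q) (z0 i) (z0 m) (zn im).
rewrite -N1 -N2 -/(ecoef i m _) -/(ecoef m i _) => E2 E1.
rewrite /= !lw_fmul !fmulA -!fmulNl [LHS]addrC.
by rewrite E1 E2 mulNr opprK mulNr.
Qed.

Lemma block_reverse_closed i m p q alpha : i != m -> p + q \is a Num.int ->
  block i (inl m) p (block m (inr true) (q + p) alpha)
  = block m (inl i) q (block i (inr true) (p + q) alpha)
    + (if p \is a Num.int then block i (inr true) p (block m (inr true) q alpha) else 0).
Proof.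
move=> im pq; rewrite (addrC q); have N := floor_int_sum pq.
rewrite /= !(lw_fmul, lw2, fmulr0) (lwC m i) !fmulN !fmulA subr0.
rewrite subr0 -fmulNl -mulNr.
have [pint|pint] := boolP (p \is a Num.int).
  have qint : q \is a Num.int by rewrite -[q](addKr p) addrC rpredB.
  have := reverse_edge_closed (Num.floor p) (Num.floor q) (z0 i) (z0 m) (zn im).
  move: N; rewrite !ceil_floor pint qint /= !addr0 => ->.
  rewrite -/(ecoef i m _) -/(ecoef m i _) => ->.
  by rewrite fmulDl.
have qint : q \isn't a Num.int.
  by apply: contra pint => qint; rewrite -[p](addrK q) rpredB.
rewrite addr0 N !ceil_floor pint qint /=; congr fmul.
by apply: reverse_edge_split; rewrite ?zn // addrAC.
Qed.

Lemma block_anti i d p m c q alpha : ~~ is_open d -> ~~ is_open c ->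
  block i d p (block m c q alpha) = - block m c q (block i d p alpha).
Proof. by move=> od oc; rewrite blockC (negPf od) (negPf oc). Qed.

Lemma upd_same a k d : upd a k d k = 0.
Proof. by rewrite /upd eqxx. Qed.

Lemma upd_neq a k d i : i != k -> d != inl i -> upd a k d i = a i.
Proof.
rewrite /upd => /negPf->; case: d => // j ji; case: eqP => // ij.
by rewrite ij eqxx in ji.
Qed.

Lemma upd_target a k j : j != k -> upd a k (inl j) j = a j + a k.
Proof. by rewrite /upd => /negPf->; rewrite eqxx. Qed.

Lemma updC a i c m d : i != m -> c != inl m -> d != inl i ->
  upd (upd a m d) i c = upd (upd a i c) m d.
Proof.
move=> im cm di; apply: funext => x.
have fim := negPf im; have fmi : (m == i) = false by rewrite eq_sym.
have inlE j l : (inl j == inl l :> code) = (j == l) by [].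
have [xi|xi] := eqVneq x i; last have [xm|xm] := eqVneq x m.
- rewrite xi upd_same upd_neq // upd_same //.
- by rewrite xm upd_same upd_neq ?fmi // upd_same.
case: c cm => [j|e] cm; case: d di => [j'|e'] di; rewrite ?inlE in cm di;
  rewrite /upd ?(negPf xi) ?(negPf xm) ?fim ?fmi 1?(eq_sym m j) 1?(eq_sym i j')
    ?(negPf cm) ?(negPf di) //.
by case: (x == j); case: (x == j'); rewrite // addrAC.
Qed.

Lemma upd_chain a i m k : i != m -> i != k -> m != k ->
  upd (upd a i (inl m)) m (inl k) = upd (upd a m (inl i)) i (inl k).
Proof.
move=> im ik mk; apply: funext => x.
have fim := negPf im; have fmi : (m == i) = false by rewrite eq_sym.
have inlE j l : (inl j == inl l :> code) = (j == l) by [].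
have [xi|xi] := eqVneq x i; last have [xm|xm] := eqVneq x m.
- by rewrite xi upd_same upd_neq ?inlE 1?(eq_sym k) // upd_same.
- by rewrite xm upd_same upd_neq ?inlE ?fmi 1?(eq_sym k) // upd_same.
rewrite /upd (negPf xi) (negPf xm) !eqxx fim fmi.
by case: eqP => // _; rewrite (addrC (a m)).
Qed.

Lemma upd_fork a i m k : i != m -> i != k -> m != k ->
  upd (upd a m (inl k)) i (inl k) = upd (upd a i (inl m)) m (inl k).
Proof.
move=> im ik mk; apply: funext => x.
have fim := negPf im; have fmi : (m == i) = false by rewrite eq_sym.
have inlE j l : (inl j == inl l :> code) = (j == l) by [].
have [xi|xi] := eqVneq x i; last have [xm|xm] := eqVneq x m.
- by rewrite xi upd_same upd_neq ?inlE 1?(eq_sym k) // upd_same.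
- by rewrite xm upd_same upd_neq ?inlE ?fmi 1?(eq_sym k) // upd_same.
rewrite /upd (negPf xi) (negPf xm) !eqxx fim fmi (negPf ik).
by case: eqP => // _; rewrite -addrA.
Qed.

Lemma upd_chain_root a i m e e' : i != m ->
  upd (upd a i (inl m)) m (inr e) = upd (upd a m (inl i)) i (inr e').
Proof.
move=> im; apply: funext => x.
have mi : m != i by rewrite eq_sym.
have inlE j l : (inl j == inl l :> code) = (j == l) by [].
have [xi|xi] := eqVneq x i; last have [xm|xm] := eqVneq x m.
- by rewrite xi upd_same upd_neq // upd_same.
- by rewrite xm upd_same upd_neq // upd_same.
by rewrite /upd (negPf xi) (negPf xm).
Qed.
End Relations.

(** * Cocycles are spanned by products of blocks *)

Section Span.
Variables (C : numFieldType) (K : fieldType) (n : nat) (X : coordinates C K n).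
Local Notation z := (coord X).
Local Notation cst := (cst X).
Local Notation nab := (nab X).
Local Notation block := (block X).
Local Notation upd := (@upd n).
Local Notation aform := {ffun {set 'I_n} -> K}.
Local Notation code := ('I_n + bool)%type.
Local Notation Om := (Om X).
Local Notation unit := (unit_form K n).
Implicit Types (i j k m : 'I_n) (s : seq 'I_n) (a : 'I_n -> rat) (p q : rat).
Implicit Types (alpha beta eta u v w : aform) (d c : code) (G : aform -> Prop).

Inductive lspan G : aform -> Prop :=
  | lspan0 : lspan G 0
  | lspan_step (q : C) u v : G u -> lspan G v -> lspan G (fmul (cst q) u + v).

Lemma lspan_gen G u : G u -> lspan G u.
Proof.
move=> Gu; rewrite -[u]addr0 -[u]fmul1 -(rmorph1 cst); apply: lspan_step => //; exact: lspan0.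
Qed.

Lemma lspan_add G u v : lspan G u -> lspan G v -> lspan G (u + v).
Proof.
by move=> Gu Gv; elim: Gu => [|q w w' Gw _ IH]; [rewrite add0r|rewrite -addrA; apply: lspan_step].
Qed.

Lemma lspan_scale G (q : C) u : lspan G u -> lspan G (fmul (cst q) u).
Proof.
elim=> [|p v w Gv _ IH]; first by rewrite fmulr0; exact: lspan0.
by rewrite fmulDr fmulA -rmorphM; apply: lspan_step.
Qed.

Lemma lspan_opp G u : lspan G u -> lspan G (- u).
Proof. by move=> /(lspan_scale (-1)); rewrite rmorphN rmorph1 fmulNl fmul1. Qed.

Lemma lspan_sum G (I : Type) (r : seq I) (P : pred I) (F : I -> aform) :
  (forall l, P l -> lspan G (F l)) -> lspan G (\sum_(l <- r | P l) F l).
Proof.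
by move=> H; elim/big_rec: _ => [|l u Pl uG]; [exact: lspan0|apply: lspan_add => //; apply: H].
Qed.

Lemma lspan_map G G' (T : aform -> aform) :
  T 0 = 0 -> (forall u v, T (u + v) = T u + T v) ->
  (forall (q : C) u, T (fmul (cst q) u) = fmul (cst q) (T u)) ->
  (forall u, G u -> lspan G' (T u)) -> forall u, lspan G u -> lspan G' (T u).
Proof.
move=> T0 TD TZ TG u; elim=> [|q v w Gv _ IH]; first by rewrite T0; exact: lspan0.
by rewrite TD TZ; apply: lspan_add => //; apply: lspan_scale; apply: TG.
Qed.

(** Spanned by the products of valid blocks in the order [s], with the exponents
    passed on from each variable to the following ones. *)
Fixpoint bspan s : ('I_n -> rat) -> aform -> Prop :=
  if s is k :: s' then fun a => lspan (fun u => exists d v,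
      [/\ is_valid s' (a k) d, bspan s' (upd a k d) v & u = block k d (a k) v])
  else fun _ => lspan (eq unit).

Arguments bspan : simpl never.

Lemma bspan_gen s a : exists G, bspan s a = lspan G.
Proof. by case: s => [|k s]; eexists. Qed.

Lemma bspan_0 s a : bspan s a 0.
Proof. have [G ->] := bspan_gen s a; exact: lspan0. Qed.
Lemma bspan_add s a u v : bspan s a u -> bspan s a v -> bspan s a (u + v).
Proof. have [G ->] := bspan_gen s a; exact: lspan_add. Qed.
Lemma bspan_opp s a u : bspan s a u -> bspan s a (- u).
Proof. have [G ->] := bspan_gen s a; exact: lspan_opp. Qed.
Lemma bspan_scale s a (q : C) u : bspan s a u -> bspan s a (fmul (cst q) u).
Proof. have [G ->] := bspan_gen s a; exact: lspan_scale. Qed.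
Lemma bspan_sum s a (I : Type) (r : seq I) (P : pred I) (F : I -> aform) :
  (forall l, P l -> bspan s a (F l)) -> bspan s a (\sum_(l <- r | P l) F l).
Proof. have [G ->] := bspan_gen s a; exact: lspan_sum. Qed.

Lemma bspan_block k s a d v : is_valid s (a k) d -> bspan s (upd a k d) v ->
  bspan (k :: s) a (block k d (a k) v).
Proof. by move=> vd Vv; apply: lspan_gen; exists d, v. Qed.

(** The block of [i] anticommutes with the first block, unless [i] has an edge to
    the first variable [m]. Then the three-term relation, or the reversal of the
    edge if [m] is a root, replaces the two blocks by pairs in which the block of
    [m] comes first and the other one is covered by the induction hypothesis. *)
Lemma bspan_leaf s : uniq s -> forall a i c v, i \in s -> is_valid (rem i s) (a i) c ->
  bspan (rem i s) (upd a i c) v -> bspan s a (block i c (a i) v).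
Proof.
elim: s => [//|m s IH] us a i c v; have ms : m \notin s by case/andP: us.
have us' : uniq s by case/andP: us.
rewrite [rem _ _]/=; have [-> _|mi] := eqVneq m i; first exact: bspan_block.
rewrite inE eq_sym (negPf mi) /= => is_.
have im : i != m by rewrite eq_sym.
have ri : i \notin rem i s by rewrite mem_rem_uniq // !inE eqxx.
have rs x : x \in rem i s -> x \in s by apply: mem_rem.
have inlE j l : (inl j == inl l :> code) = (j == l) by [].
have [G' VE] := bspan_gen (m :: s) a.
move=> vc Vv; rewrite VE; apply: lspan_map Vv.
- exact: block0.
- exact: blockD.
- by move=> q u; apply: blockZ.
move=> u [c' [v' [vc' Vv' ->]]]; rewrite -VE.
have c'i : c' != inl i.
  case: c' vc' {Vv'} => // j js; rewrite inlE.
  by apply: contraNneq ri => ji; rewrite -{1}ji; exact: js.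
have [cm|cm] := eqVneq c (inl m); last first.
  rewrite (upd_neq a mi cm) blockC.
  have V1 : bspan (m :: s) a (block m c' (a m) (block i c (a i) v')).
    apply: bspan_block.
      move: vc'; rewrite (upd_neq a mi cm); case: (c') => [j /rs //|//].
    rewrite -(upd_neq a im c'i); apply: IH => //.
      rewrite (upd_neq a im c'i); case: (c) cm vc => [j jm|//].
      by rewrite /= inE; case/predU1P => [jE|//]; rewrite jE eqxx in jm.
    by rewrite (updC a im cm c'i).
  by case: ifP => _ //; apply: bspan_opp.
move: vc vc' Vv'; rewrite {}cm upd_target // => _.
case: c' c'i => [k|e] c'i vc' Vv'.
  have ks : k \in rem i s := vc'.
  have ik : i != k by rewrite eq_sym -inlE.
  have mk : m != k by apply: contraNneq ms => ->; apply: rs.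
  rewrite block_three_term //; apply: bspan_add.
    apply: bspan_block => //.
    rewrite -[X in block i _ X](_ : upd a m (inl i) i = _); last by rewrite upd_target.
    by apply: IH; rewrite // -upd_chain.
  rewrite block_anti //; apply: bspan_opp; apply: bspan_block; first exact: rs.
  rewrite -[X in block i _ X](upd_neq a im (_ : inl k != inl i)) ?inlE 1?eq_sym //.
  apply: IH => //.
  by rewrite upd_fork.
have aint : a m + a i \is a Num.int := vc'.
have aint' : a i + a m \is a Num.int by rewrite addrC.
have V2 e' : bspan (rem i s) (upd (upd a m (inl i)) i (inr e')) v'.
  by rewrite -(upd_chain_root a e e' im).
have main e' : bspan (m :: s) a (block m (inl i) (a m) (block i (inr e') (a i + a m) v')).
  apply: bspan_block => //.
  rewrite -[X in block i _ X](_ : upd a m (inl i) i = _); last by rewrite upd_target.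
  by apply: IH => //=; rewrite upd_target // addrC.
case: e {c'i vc'} Vv' => Vv'; last by rewrite block_reverse_open.
rewrite block_reverse_closed //; apply: bspan_add; first exact: main.
case: ifP => aiint; last exact: bspan_0.
have amint : a m \is a Num.int by rewrite -[a m](addrK (a i)) rpredB.
rewrite block_anti //; apply: bspan_opp; apply: bspan_block => //.
rewrite -[X in block i _ X](upd_neq a im (_ : inr true != inl i)) //.
apply: IH => //; first by rewrite /= upd_neq.
rewrite (_ : upd _ _ _ = upd (upd a i (inl m)) m (inr true)) //.
apply: funext => x; have [xi|xi] := eqVneq x i; last have [xm|xm] := eqVneq x m.
- by rewrite xi upd_same upd_neq // upd_same.
- by rewrite xm upd_same upd_neq // upd_same.
by rewrite /upd (negPf xi) (negPf xm).
Qed.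

Lemma bspan_spec s a v : uniq s -> supported a s -> bspan s a v -> Om s s v /\ nab a v = 0.
Proof.
elim: s a v => [|k s IH] a v us sa /=.
  elim=> [|q u w <- _ [wO w0]]; first by split; [exact: Om0|exact: nab0].
  have unitO : Om [::] [::] unit.
    split=> [S|S i]; rewrite ffunE; first by case: ifP; rewrite ?reg0 ?reg1.
    by have [->|_] := eqVneq S set0; rewrite ?inE ?eqxx.
  split.
    apply: Om_add => //; apply: Om_fmul => //.
    exact: (reg_cst (reg_nil X)).
  rewrite nabD nab_cst w0 addr0 (_ : nab a unit = 0) ?fmulr0 //.
  rewrite /nab big1 // => i _; rewrite (_ : fmap _ _ = 0) ?lw0 //.
  apply/ffunP => S; rewrite [LHS]ffunE [RHS]ffunE.
  by apply: (@tw_out _ _ _ _ [::]) => //; apply: unitO.1.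
have us' : uniq s by case/andP: us.
elim=> [|q u w [d [v' [vd Vv ->]]] _ [wO w0]]; first by split; [exact: Om0|exact: nab0].
have [vO v0] := IH _ _ us' (supported_upd sa vd) Vv.
split.
  apply: Om_add => //; apply: Om_fmul => //; first exact: (reg_cst (reg_ok X us)).
  exact: Om_block.
rewrite nabD nab_cst w0 addr0 nab_block ?v0 ?block0.
  by rewrite /wsign; case: ifP; rewrite ?oppr0 fmulr0.
case: (d) vd => // j js; apply: contraTneq us => ->.
by rewrite /= (js : j \in s).
Qed.

Lemma valid_nab k s a d theta : uniq (k :: s) -> is_valid s (a k) d ->
  nab a (block k d (a k) theta) = wsign d (block k d (a k) (nab (upd a k d) theta)).
Proof.
move=> us vd; apply: nab_block; case: d vd => // j js.
by apply: contraTneq us => ->; rewrite /= (js : j \in s).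
Qed.

Lemma block_open_inj k q u : block k (inr false) q u = 0 -> u = 0.
Proof.
move=> /(congr1 (fmul (z k ^ Num.floor q))).
by rewrite /= fmulA fmulr0 -expfzDr ?z_neq0 // subrr expr0z fmul1.
Qed.

(** Along the fibre, [eta] is exact up to a sum of non-open blocks of forms
    [theta d] and a form [e0] without [dz_k]. Since [eta] is closed, uniqueness on
    the fibre makes each [theta d] closed for the exponents [upd a k d] and makes
    [e0] horizontal, that is an open block of a closed form or zero; the induction
    hypothesis applies to these forms in one variable less. *)
Theorem cocycle_span s a eta : uniq s -> supported a s -> Om s s eta -> nab a eta = 0 ->
  exists v xi, [/\ bspan s a v, Om s s xi & eta = v + nab a xi].
Proof.
elim: s a eta => [|k s IH] a eta us sa eO eta0.
  exists eta, 0; split=> //; [|exact: Om0|by rewrite nab0 addr0].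
  have /asboolP[q qE] := eO.1 set0.
  have -> : eta = fmul (cst q) unit + 0.
    apply/ffunP => S; rewrite !ffunE addr0; case: eqP => [->|/eqP S0].
      by rewrite mulr1.
    rewrite mulr0; apply/eqP; apply: contraNT S0 => eS; apply/eqP/setP => i.
    by rewrite inE; apply/negP => /(eO.2 S i eS).
  by apply: lspan_step => //; exact: lspan0.
have us' : uniq s by case/andP: us.
have [g [theta [e0 [gO tO e0O eE]]]] := form_exists us sa eO.
set sm := \sum_(d | _) _ in eE.
have vO : forall d, is_valid s (a k) d -> supported (upd a k d) s.
  by move=> d; apply: supported_upd.
pose sg (d : code) := is_valid s (a k) d && ~~ is_open d.
have smE : nab a sm = \sum_(d | sg d) block k d (a k) (- nab (upd a k d) (theta d)).
  rewrite /sm nab_sum; apply: eq_bigr => d /andP[vd od].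
  by rewrite (valid_nab _ us vd) /wsign (negPf od) blockN.
have H : \sum_(d | sg d) block k d (a k) (- nab (upd a k d) (theta d)) + nab a e0 + 0 = 0.
  by rewrite -smE addr0 -nabD -[RHS]eta0 eE !nabD nab_nab add0r.
have f0 : free_of k (0 : aform) by move=> S _; rewrite ffunE.
have nO d : is_valid s (a k) d -> ~~ is_open d -> Om s s (- nab (upd a k d) (theta d)).
  by move=> vd _; apply: Om_opp => //; apply: Om_nab => //; apply: vO.
have [t0 e00] := form_unique us e0O nO f0 H.
have cl d : is_valid s (a k) d -> ~~ is_open d -> exists vx : aform * aform,
    [/\ bspan s (upd a k d) vx.1, Om s s vx.2 & theta d = vx.1 + nab (upd a k d) vx.2].
  move=> vd od; have := t0 d vd od => /eqP; rewrite oppr_eq0 => /eqP td.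
  by have [v [xi [? ? ?]]] := IH _ _ us' (vO d vd) (tO d) td; exists (v, xi).
have /choice[h hP] : forall d, exists vx : aform * aform, sg d ->
    [/\ bspan s (upd a k d) vx.1, Om s s vx.2 & theta d = vx.1 + nab (upd a k d) vx.2].
  move=> d; case: (boolP (sg d)) => [/andP[vd od]|_]; last by exists (0, 0).
  by have [vx ?] := cl d vd od; exists vx.
have [v0 [x0 [V0 x0O e0E]]] : exists v0 x0,
    [/\ bspan (k :: s) a v0, Om (k :: s) (k :: s) x0 & e0 = v0 + nab a x0].
  have := form_horizontal us e0O e00; case: ifP => aint; last first.
    by move=> ->; exists 0, 0; split; [exact: bspan_0|exact: Om0|rewrite nab0 addr0].
  move=> [xi xiO xiE].
  have vd : is_valid s (a k) (inr false) by [].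
  have nx : nab (upd a k (inr false)) xi = 0.
    apply: (@block_open_inj k (a k)).
    have := valid_nab xi us vd; rewrite /wsign /is_open eqxx -xiE => <-.
    have smz : nab a sm = 0.
      by rewrite smE big1 // => d /andP[vd' od']; rewrite t0 // block0.
    by move: eta0; rewrite eE !nabD nab_nab smz !add0r.
  have [v [y [Vv yO E]]] := IH _ _ us' (vO _ vd) xiO nx.
  exists (block k (inr false) (a k) v), (block k (inr false) (a k) y).
  split; [exact: bspan_block|exact: Om_block|].
  by rewrite (valid_nab y us vd) /wsign /is_open eqxx -blockD -E.
exists (\sum_(d | sg d) block k d (a k) (h d).1 + v0).
exists (g - \sum_(d | sg d) block k d (a k) (h d).2 + x0); split.
- apply: bspan_add => //; apply: bspan_sum => d sd; have [Vd _ _] := hP d sd.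
  by apply: bspan_block => //; case/andP: sd.
- apply: Om_add => //; apply: Om_add => //.
    by apply: Om_sub gO => i; rewrite inE orbC => ->.
  apply: Om_opp => //; apply: Om_sum => // d sd; have [_ xO _] := hP d sd.
  by apply: Om_block => //; case/andP: sd.
rewrite !nabD nabN nab_sum eE.
have -> : sm = \sum_(d | sg d) block k d (a k) (h d).1
             - \sum_(d | sg d) nab a (block k d (a k) (h d).2).
  rewrite /sm -sumrB; apply: eq_bigr => d sd; have [_ _ ->] := hP d sd.
  case/andP: sd => vd od; rewrite (valid_nab _ us vd) /wsign (negPf od) opprK.
  by rewrite blockD.
rewrite e0E; move: (\sum_(d | _) _) (\sum_(d | _) _) (nab a g) (nab a x0) => A B D y.
by apply/ffunP => S; rewrite !ffunE; ring.
Qed.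
End Span.

(** * Independence of the products of blocks *)

Section Codes.
Variables (C : numFieldType) (K : fieldType) (n : nat) (X : coordinates C K n).
Local Notation cst := (cst X).
Local Notation tw := (tw X).
Local Notation nab := (nab X).
Local Notation block := (block X).
Local Notation upd := (@upd n).
Local Notation aform := {ffun {set 'I_n} -> K}.
Local Notation code := ('I_n + bool)%type.
Local Notation Om := (Om X).
Local Notation unit := (unit_form K n).
Local Notation bspan := (bspan X).
Local Notation lspan := (lspan X).
Implicit Types (i j k m : 'I_n) (s : seq 'I_n) (a : 'I_n -> rat) (p q : rat).
Implicit Types (alpha beta eta u v w : aform) (d : code) (phi psi : 'I_n -> code).

Fixpoint code_product phi s a : aform :=
  if s is k :: s' then block k (phi k) (a k) (code_product phi s' (upd a k (phi k))) else unit.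

Fixpoint valid_codes phi s a : bool :=
  if s is k :: s' then is_valid s' (a k) (phi k) && valid_codes phi s' (upd a k (phi k)) else true.

Lemma eq_code_product phi psi s a : {in s, phi =1 psi} ->
  code_product phi s a = code_product psi s a.
Proof.
elim: s a => //= k s IH a E; rewrite E ?mem_head // IH // => i is_.
by rewrite E // inE is_ orbT.
Qed.

Lemma eq_valid_codes phi psi s a : {in s, phi =1 psi} -> valid_codes phi s a = valid_codes psi s a.
Proof.
elim: s a => //= k s IH a E; rewrite E ?mem_head // IH // => i is_.
by rewrite E // inE is_ orbT.
Qed.

Lemma bspan_code_product phi s a : valid_codes phi s a -> bspan s a (code_product phi s a).
Proof.
elim: s a => [|k s IH] a /=; first by move=> _; apply: lspan_gen.
by move=> /andP[vd vp]; apply: bspan_block => //; apply: IH.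
Qed.

Lemma bspan_codes s a v : uniq s -> bspan s a v ->
  lspan (fun u => exists2 phi, valid_codes phi s a & u = code_product phi s a) v.
Proof.
elim: s a v => [|k s IH] a v us.
  elim=> [|q u w <- _ IHw]; first exact: lspan0.
  by apply: lspan_step => //; exists (fun=> inr false).
have us' : uniq s by case/andP: us.
have ks : k \notin s by case/andP: us.
elim=> [|q u w [d [v' [vd Vv ->]]] _ IHw]; first exact: lspan0.
apply: lspan_add => //; apply: lspan_scale.
apply: (lspan_map _ _ _ _ (IH _ _ us' Vv)).
- exact: block0.
- exact: blockD.
- by move=> c x; apply: blockZ.
move=> x [phi vphi ->]; apply: lspan_gen.
(* phi is only relevant on s, which does not contain k *)
pose psi i := if i == k then d else phi i.
have E : {in s, phi =1 psi}.
  by move=> i is_; rewrite /psi; case: eqP => // ik; rewrite ik (negPf ks) in is_.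
have psik : psi k = d by rewrite /psi eqxx.
exists psi; rewrite /= psik -?(eq_valid_codes _ E) -?(eq_code_product _ E) ?vd //.
Qed.

(** Grouped by the code of the first variable, an exact combination of products is
    a sum of blocks, and uniqueness on the fibre makes each group exact in one
    variable less. *)
Theorem independence s : forall a (I : finType) (P : {pred I}) (phi : I -> 'I_n -> code)
    (c : I -> C) eta,
  uniq s -> supported a s ->
  (forall l, l \in P -> valid_codes (phi l) s a) ->
  {in P &, forall l l', {in s, phi l =1 phi l'} -> l = l'} ->
  Om s s eta ->
  \sum_(l in P) fmul (cst (c l)) (code_product (phi l) s a) = nab a eta ->
  forall l, l \in P -> c l = 0.
Proof.
elim: s => [|k s IH] a I P phi c eta us sa vP iP eO H i iPi.
  have nz : nab a eta = 0.
    rewrite /nab big1 // => j _; rewrite (_ : fmap _ _ = 0) ?lw0 //.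
    apply/ffunP => S; rewrite [LHS]ffunE [RHS]ffunE.
    by apply: (@tw_out _ _ _ _ [::]) => //; apply: eO.1.
  move: H; rewrite nz (big_pred1 i) => [|j]; last first.
    apply/idP/eqP => [jP|->//]; exact: iP.
  move/(congr1 (fun u : aform => u set0)); rewrite !ffunE eqxx mulr1 => /eqP.
  by rewrite fmorph_eq0 => /eqP.
have us' : uniq s by case/andP: us.
have ks : k \notin s by case/andP: us.
have [g [theta [e0 [gO tO e0O eE]]]] := form_exists us sa eO.
pose sg (d : code) := is_valid s (a k) d && ~~ is_open d.
pose Pd d : {pred I} := [pred j | (j \in P) && (phi j k == d)].
pose v d := \sum_(j in Pd d) fmul (cst (c j)) (code_product (phi j) s (upd a k d)).
have Pv (j : I) : j \in P ->
    is_valid s (a k) (phi j k) && valid_codes (phi j) s (upd a k (phi j k)).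
  by move=> /vP.
have PdV d (j : I) : j \in Pd d -> is_valid s (a k) d /\ valid_codes (phi j) s (upd a k d).
  by rewrite inE => /andP[/Pv /andP[H1 H2] /eqP E]; rewrite -E.
have sumE : \sum_(j in P) fmul (cst (c j)) (code_product (phi j) (k :: s) a)
    = \sum_d block k d (a k) (v d).
  rewrite (partition_big (fun j : I => phi j k) xpredT) //=; apply: eq_bigr => d _.
  rewrite block_sum; apply: eq_big => [j|j /andP[_ /eqP->]]; first by rewrite inE.
  by rewrite blockZ.
have v0 d : ~~ is_valid s (a k) d -> v d = 0.
  move=> nv; rewrite /v big_pred0 // => j; apply/negP => /PdV[vd _].
  by rewrite vd in nv.
have vO d : Om s s (v d).
  apply: Om_sum => // j /PdV[vd vj]; apply: Om_fmul => //.
    exact: (reg_cst (reg_ok X us')).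
  by have [] := bspan_spec us' (supported_upd sa vd) (bspan_code_product vj).
have sum2 : \sum_d block k d (a k) (v d) = \sum_(d | sg d) block k d (a k) (v d)
    + block k (inr false) (a k) (v (inr false)).
  rewrite (bigD1 (inr false)) //= addrC; congr (_ + _).
  rewrite big_mkcond [RHS]big_mkcond; apply: eq_bigr => d _.
  rewrite /sg /is_open; case: eqP => //= _; first by rewrite andbF.
  by rewrite andbT; case: ifP => // /negbT /v0->; rewrite block0.
have nabE : nab a eta = \sum_(d | sg d) block k d (a k) (- nab (upd a k d) (theta d)) + nab a e0.
  rewrite eE !nabD nab_nab add0r nab_sum; congr (_ + _); apply: eq_bigr => d /andP[vd od].
  by rewrite (@valid_nab _ _ _ X k s a d _ us vd) /wsign (negPf od) blockN.
have fz : free_of k (block k (inr false) (a k) (v (inr false))).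
  by apply: free_fmul; apply: Om_free (vO _).
have H2 : \sum_(d | sg d) block k d (a k) (v d + nab (upd a k d) (theta d)) + nab a (- e0)
    + block k (inr false) (a k) (v (inr false)) = 0.
  have := H; rewrite sumE sum2 nabE => /eqP; rewrite -subr_eq0 => /eqP E; rewrite -[RHS]E {E}.
  have -> : \sum_(d | sg d) block k d (a k) (v d + nab (upd a k d) (theta d))
    = \sum_(d | sg d) block k d (a k) (v d)
      - \sum_(d | sg d) block k d (a k) (- nab (upd a k d) (theta d)).
    rewrite -sumrB; apply: eq_bigr => d _; by rewrite -blockN -blockD opprK.
  rewrite nabN; move: (\sum_(d | _) _) (\sum_(d | _) _) (nab _ _) (block _ _ _ _) => A B D E.
  by apply/ffunP => S; rewrite !ffunE; ring.
have e0N : Om (k :: s) s (- e0) by apply: Om_opp.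
have nO d : is_valid s (a k) d -> ~~ is_open d -> Om s s (v d + nab (upd a k d) (theta d)).
  move=> vd _; apply: Om_add => //; apply: Om_nab => //; exact: supported_upd sa vd.
have [t0 e00] := form_unique us e0N nO fz H2.
have vi : is_valid s (a k) (phi i k) by case/andP: (Pv i iPi).
suff [x xO xE] : exists2 x, Om s s x & v (phi i k) = nab (upd a k (phi i k)) x.
  apply: (IH (upd a k (phi i k)) I (Pd (phi i k)) phi c x us' (supported_upd sa vi)) => //.
  - by move=> j /PdV[].
  - move=> j l; rewrite !inE => /andP[jP /eqP jk] /andP[lP /eqP lk] E; apply: iP => // m.
    by rewrite inE => /predU1P[->|/E//]; rewrite jk lk.
  by rewrite inE iPi eqxx.
have [od|od] := boolP (is_open (phi i k)); last first.
  exists (- theta (phi i k)); first exact: Om_opp.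
  by rewrite nabN; apply/eqP; rewrite -addr_eq0; apply/eqP/t0.
have oE : phi i k = inr false by apply/eqP.
rewrite oE in vi *; have aint : a k \is a Num.int := vi.
have e01 S : tw a k (e0 S) = 0.
  by have := e00 S; rewrite ffunE twN => /eqP; rewrite oppr_eq0 => /eqP.
have := form_horizontal us e0O e01; rewrite aint => -[xi xiO xiE].
exists xi => //; apply/eqP; rewrite -subr_eq0; apply/eqP; apply: (@block_open_inj _ _ _ X k (a k)).
have nx := @valid_nab _ _ _ X k s a _ xi us vi; rewrite /wsign /is_open eqxx -xiE in nx.
rewrite blockD blockN -nx; move: H2.
rewrite big1 => [|d /andP[vd od']]; last by rewrite t0 // block0.
by rewrite add0r nabN addrC.
Qed.
End Codes.

(** * Forests and their codes *)

Section FunctionalGraph.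
Variable T : finType.
Variable e : rel T.
Implicit Types x y w : T.

Lemma undirected_sym : connect_sym (fun x y => e x y || e y x).
Proof. by apply: sym_connect_sym => x y; rewrite orbC. Qed.

Lemma connect_first x y : connect e x y -> x = y \/ exists2 x1, e x x1 & connect e x1 y.
Proof.
case/connectP=> [[|x1 p]] /= => [_ ->|/andP[xx1 px1] ->]; first by left.
by right; exists x1 => //; apply/connectP; exists p.
Qed.

Lemma connect_last x y : connect e x y -> x = y \/ exists2 y1, connect e x y1 & e y1 y.
Proof.
case/connectP=> p; elim/last_ind: p => [|p y1 _] /=; first by move=> _ ->; left.
rewrite rcons_path last_rcons => /andP[xp py] ->; right.
by exists (last x p) => //; apply/connectP; exists p.
Qed.

Hypothesis acyclic : forall x y, e x y -> ~~ connect e y x.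

Lemma reach_sink x : exists2 y, connect e x y & forall w, ~~ e y w.
Proof.
have [m] := ubnP #|connect e x|; elim: m x => // m IH x; rewrite ltnS => xm.
have [/existsP[y xy]|] := boolP [exists y, e x y]; last first.
  by rewrite negb_exists => /forallP xs; exists x.
have [|w yw ws] := IH y; last by exists w => //; apply: connect_trans (connect1 xy) yw.
apply: leq_trans xm; apply: proper_card; apply/properP; split.
  by apply/subsetP => w; rewrite !inE; apply: connect_trans; apply: connect1.
exists x; first by rewrite inE connect0.
by rewrite inE acyclic.
Qed.

Hypothesis functional : forall x y w, e x y -> e x w -> y = w.

Lemma connect_comparable x y w : connect e x y -> connect e x w ->
  connect e y w \/ connect e w y.
Proof.
case/connectP=> p; elim: p x => [|x1 p IH] x /=; first by move=> _ ->; left.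
move=> /andP[xx1 px1] yE xw.
have [xw'|[x2 xx2 x2w]] := connect_first xw.
  right; rewrite -xw' yE; apply/connectP; exists (x1 :: p) => //=; by rewrite xx1.
by apply: (IH x1) => //; rewrite (functional xx1 xx2).
Qed.

(** The vertices reached from [x] form a path. *)
Lemma unique_predecessor x y y' w : connect e x y -> e y w -> connect e x y' -> e y' w -> y = y'.
Proof.
have half u v : connect e u v -> e u w -> e v w -> u = v.
  move=> uv uw vw; case: (connect_first uv) => // -[u1 uu1 u1v].
  by have := acyclic vw; rewrite (functional uw uu1) u1v.
move=> xy yw xy' yw'; have [yy'|y'y] := connect_comparable xy xy'.
  exact: half.
by symmetry; apply: half.
Qed.

(** A path that starts at a sink and ignores directions only ever climbs against
    the edges, as each other vertex of it has its only edge towards the sink. *)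
Lemma sink_below r x : (forall w, ~~ e r w) ->
  connect (fun x y => e x y || e y x) r x -> connect e x r.
Proof.
move=> rs /connectP[p]; elim/last_ind: p x => [|p y IH] x /=; first by move=> _ ->.
rewrite rcons_path last_rcons => /andP[rp py] ->.
have := IH _ rp erefl; set u := last r p in py *; case/orP: py => uy ur.
  case: (connect_first ur) => [ur'|[u1 uu1 u1r]].
    by have := rs y; rewrite -ur' uy.
  by rewrite (functional uy uu1).
exact: connect_trans (connect1 uy) ur.
Qed.
End FunctionalGraph.

Section ForestCodes.
Variable n : nat.
Local Notation code := ('I_n + bool)%type.
Implicit Types (F : rooted_graph n) (i j k : 'I_n) (phi : 'I_n -> code).

(** A vertex that is neither a root nor the source of an edge does not occur in a
    forest. *)
Definition forest_code F i : code :=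
  if i \in open_roots F then inr false else
  if i \in closed_roots F then inr true else
  if [pick j | arrow (edges F) i j] is Some j then inl j else inr false.

Section Forest.
Variable F : rooted_graph n.
Hypothesis FF : F \in forests n.
Local Notation E := (edges F).
Local Notation e := (arrow E).

Lemma component_tree i : directed_tree (component E i) (E :&: setX (component E i) (component E i)).
Proof.
move: FF; rewrite inE => /and3P[/forall_inP H _ _]; apply: H.
by apply: imset_f.
Qed.

Lemma in_component i : i \in component E i.
Proof. by rewrite inE connect0. Qed.

Lemma component_step i j k : j \in component E i -> e j k -> k \in component E i.
Proof.
rewrite !inE => ij jk; apply: connect_trans ij (connect1 _); by rewrite jk.
Qed.

Lemma component_arrow i j k : j \in component E i ->
  arrow (E :&: setX (component E i) (component E i)) j k = e j k.
Proof.
move=> ji; rewrite /arrow inE in_setX /= ji /=.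
apply/andP/idP => [[]//|jk]; split=> //; exact: component_step jk.
Qed.

Lemma component_outdeg i j : j \in component E i ->
  outdeg (E :&: setX (component E i) (component E i)) j = outdeg E j.
Proof.
by move=> ji; apply: eq_card => k; rewrite inE [RHS]inE component_arrow.
Qed.

Lemma forest_functional i j k : e i j -> e i k -> j = k.
Proof.
move=> ij ik; have /and5P[_ _ _ _ /andP[_ /forall_inP H]] := component_tree i.
have := H i (in_component i); rewrite component_outdeg ?in_component //.
move=> H1; have {}H1 : (outdeg E i <= 1)%N by case/orP: H1 => /eqP->.
by apply: (card_le1_eqP H1); rewrite inE.
Qed.

Lemma forest_acyclic i j : e i j -> ~~ connect e j i.
Proof.
move=> ij; have /and5P[_ _ _ /forallP/(_ i)/forallP/(_ j) + _] := component_tree i.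
have ii := in_component i.
rewrite component_arrow // ij /=; apply: contraNN => /connectP[p].
have : j \in component E i by apply: component_step ij.
elim: p j {ij} => [|k p IH] j ji /=; first by move=> _ ->; rewrite connect0.
move=> /andP[jk kp] pi; apply: connect_trans (connect1 _) (IH k _ kp pi).
  by rewrite component_arrow.
exact: component_step jk.
Qed.

Lemma root_outdeg i : (i \in open_roots F :|: closed_roots F) = (outdeg E i == 0%N).
Proof. by move: FF; rewrite inE => /and3P[_ _ /eqP->]; rewrite inE. Qed.

Lemma outdeg0P i : reflect (forall j, ~~ e i j) (outdeg E i == 0%N).
Proof.
rewrite cards_eq0; apply: (iffP eqP) => [H j|H].
  by have /setP/(_ j) := H; rewrite !inE => /negbT.
by apply/setP => j; rewrite !inE; apply/negbTE.
Qed.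

Lemma forest_code_open i : (forest_code F i == inr false) = (i \in open_roots F).
Proof.
rewrite /forest_code; case: ifP => // oi; case: ifP => // ci.
case: pickP => // H; have := root_outdeg i; rewrite in_setU oi ci /=.
by move/esym/negP; case; apply/outdeg0P => j; rewrite H.
Qed.

Lemma forest_code_closed i : (forest_code F i == inr true) = (i \in closed_roots F).
Proof.
have disj : [disjoint open_roots F & closed_roots F] by move: FF; rewrite inE => /and3P[].
rewrite /forest_code; case: ifP => [oi|oi].
  by rewrite (disjointFr disj oi).
by case: ifP => // ci; case: pickP.
Qed.

Lemma forest_code_edge i j : (forest_code F i == inl j) = e i j.
Proof.
have := root_outdeg i; rewrite in_setU /forest_code.
case: ifP => [oi|oi] /=; first by move/esym/outdeg0P/(_ j)/negPf->.
case: ifP => [ci|ci] /=; first by move/esym/outdeg0P/(_ j)/negPf->.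
move/esym/negbT => od; case: pickP => [k ik|H].
  apply/eqP/idP => [[<-]//|ij]; congr inl; exact: forest_functional ij.
by case/negP: od; apply/outdeg0P => k; rewrite H.
Qed.

Lemma component_root r : outdeg E r = 0%N -> component E r = [set k | preceq F k r].
Proof.
move=> r0; apply/setP => k; rewrite !inE; apply/idP/idP => [|kr].
  apply: sink_below; first exact: forest_functional.
  by apply/outdeg0P/eqP.
rewrite (undirected_sym e r k); move: kr; apply: connect_sub => x y xy.
by apply: connect1; rewrite xy.
Qed.

(** The vertices below [j] are partitioned by the last vertex before [j] on their
    path. *)
Lemma weight_step (a : 'I_n -> rat) j :
  weight a F j = a j + \sum_(i | e i j) weight a F i.
Proof.
rewrite {1}/weight (bigD1 j) /=; last by rewrite /preceq connect0.
congr (_ + _).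
(* the last vertex before j on the path from k *)
pose p k := odflt j [pick i | preceq F k i && e i j].
rewrite (partition_big p (fun i => e i j)) /=; last first.
  move=> k /andP[kj kNj]; rewrite /p; case: pickP => [i /andP[]//|H].
  have [kE|[i ki ij]] := connect_last kj; first by rewrite kE eqxx in kNj.
  by have := H i; rewrite /preceq ki ij.
apply: eq_bigr => i ij; apply: eq_bigl => k; apply/idP/idP.
  move=> /andP[/andP[kj kNj] /eqP <-]; rewrite /p; case: pickP => [l /andP[]//|H] /=.
  exact: kj.
move=> ki; have kj : preceq F k j by apply: connect_trans ki (connect1 ij).
rewrite kj /=; apply/andP; split.
  by apply: contraL ki => /eqP->; apply: forest_acyclic.
rewrite /p; case: pickP => [l /andP[kl lj]|/(_ i)]; last by rewrite ki ij.
apply/eqP/(unique_predecessor forest_acyclic forest_functional kl lj ki ij).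
Qed.

End Forest.
End ForestCodes.

Section CodesAndForests.
Variable n : nat.
Variable a : 'I_n -> rat.
Local Notation code := ('I_n + bool)%type.
Local Notation upd := (@upd n).
Implicit Types (F : rooted_graph n) (i j k c x : 'I_n) (phi : 'I_n -> code) (s : seq 'I_n).

Lemma root_weight_int F i e :
  F \in int_forests a -> forest_code F i = inr e -> weight a F i \is a Num.int.
Proof.
rewrite inE => /andP[FF /forall_inP H] iE.
have i0 : outdeg (edges F) i = 0%N.
  apply/eqP; rewrite -(root_outdeg FF) in_setU -(forest_code_open FF) -(forest_code_closed FF) iE.
  by case: (e).
have /H : component (edges F) i \in components (edges F) by apply: imset_f.
by rewrite (component_root FF i0); congr (_ \is a _); apply: eq_bigl => k; rewrite inE.
Qed.

Definition graph_of phi : rooted_graph n :=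
  ([set e | phi e.1 == inl e.2], [set i | phi i == inr false], [set i | phi i == inr true]).

Lemma graph_of_forest_code F : F \in forests n -> graph_of (forest_code F) = F.
Proof.
move=> FF; rewrite /graph_of [RHS]surjective_pairing [F.1 in RHS]surjective_pairing.
congr (_, _, _).
- by apply/setP => -[i j]; rewrite inE /= forest_code_edge.
- by apply/setP => i; rewrite inE forest_code_open.
by apply/setP => i; rewrite inE forest_code_closed.
Qed.

Definition increasing phi := forall i j, phi i = inl j -> (i < j)%N.

Lemma increasing_forest_code F : F \in forests n -> rectified F -> increasing (forest_code F).
Proof.
move=> FF /forallP H i j /eqP; rewrite forest_code_edge // => ij.
by have /forallP/(_ j) := H i; rewrite ij.
Qed.

Section GraphOf.
Variable phi : 'I_n -> code.
Hypothesis incr : increasing phi.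
Local Notation F := (graph_of phi).
Local Notation E := (edges F).
Local Notation e := (arrow E).

Lemma graph_arrow i j : e i j = (phi i == inl j).
Proof. by rewrite /arrow inE. Qed.

Lemma graph_functional i j k : e i j -> e i k -> j = k.
Proof. by rewrite !graph_arrow => /eqP-> /eqP[]. Qed.

Lemma graph_connect i j : connect e i j -> (i <= j)%N.
Proof.
case/connectP=> p; elim: p i => [|k p IH] i /=; first by move=> _ ->.
rewrite graph_arrow => /andP[/eqP/incr ik kp] pj.
exact: leq_trans (ltnW ik) (IH k kp pj).
Qed.

Lemma graph_acyclic i j : e i j -> ~~ connect e j i.
Proof.
rewrite graph_arrow => /eqP/incr ij; apply/negP => /graph_connect.
by rewrite leqNgt ij.
Qed.

Lemma graph_sink i : (forall j, ~~ e i j) <-> exists b, phi i = inr b.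
Proof.
split=> [H|[b E] j]; last by rewrite graph_arrow E.
case E : (phi i) => [j|b]; last by exists b.
by have := H j; rewrite graph_arrow E eqxx.
Qed.

Lemma graph_is_forest : F \in forests n.
Proof.
rewrite inE; apply/and3P; split; last 2 first.
- by apply/pred0P => i /=; rewrite !inE; case: (phi i) => [//|[]].
- apply/eqP/setP => i; rewrite !inE; apply/idP/idP => [H|].
    have /graph_sink Hs : exists b, phi i = inr b.
      by case/orP: H => /eqP->; eexists.
    exact/outdeg0P.
  by move=> /outdeg0P/graph_sink[[] ->]; rewrite eqxx ?orbT.
apply/forall_inP => T /imsetP[i0 _ ->]; set T0 := component E i0.
have stepT j k := @component_step n F i0 j k.
have conT j k : j \in T0 -> connect e j k -> k \in T0.
  move=> jT /connectP[p]; elim: p j jT => [|l p IH] j jT /=; first by move=> _ ->.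
  by move=> /andP[/(stepT _ _ jT) lT lp]; apply: IH.
have arrowT j k : arrow (E :&: setX T0 T0) j k -> e j k.
  by rewrite /arrow inE => /andP[].
have outT j := @component_outdeg n F i0 j.
have i0T : i0 \in T0 := in_component F i0.
apply/and5P; split; last (apply/andP; split).
- by apply/set0Pn; exists i0.
- exact: subsetIr.
- apply/forallP => j; apply/negP => /arrowT; rewrite graph_arrow => /eqP/incr.
  by rewrite ltnn.
- apply/forallP => j; apply/forallP => k; apply/implyP => /arrowT jk.
  apply: contra (graph_acyclic jk); apply: connect_sub => x y xy.
  by apply: connect1; apply: arrowT.
- have [r i0r rs] := reach_sink graph_acyclic i0.
  have rT : r \in T0 by apply: conT i0r.
  apply/cards1P; exists r; apply/setP => x; rewrite !inE.
  apply/andP/eqP => [[xT]|->]; last first.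
    split; first by move: rT; rewrite inE.
    by rewrite outT //; apply/outdeg0P.
  rewrite outT ?inE // => /outdeg0P xs.
  have rx : connect (fun x y => e x y || e y x) r x.
    by apply: connect_trans xT; rewrite undirected_sym; move: rT; rewrite inE.
  have := sink_below graph_functional rs rx.
  by move/connect_first => [//|[x1 xx1]]; have := xs x1; rewrite xx1.
apply/forall_inP => j jT; rewrite outT //.
have : (outdeg E j <= 1)%N.
  by apply/card_le1_eqP => k l; rewrite inE => jk; rewrite inE => jl; apply: graph_functional jl jk.
by case: (outdeg E j) => [|[]].
Qed.

Lemma graph_rectified : rectified F.
Proof.
by apply/forallP => i; apply/forallP => j; apply/implyP; rewrite graph_arrow => /eqP/incr.
Qed.

Lemma forest_code_graph : forest_code F =1 phi.
Proof.
move=> i; apply/eqP; case E : (phi i) => [j|[]].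
- by rewrite (forest_code_edge graph_is_forest) graph_arrow E.
- by rewrite (forest_code_closed graph_is_forest) inE E.
by rewrite (forest_code_open graph_is_forest) inE E.
Qed.

Lemma graph_is_int : (forall i b, phi i = inr b -> weight a F i \is a Num.int) ->
  F \in int_forests a.
Proof.
move=> H; rewrite inE graph_is_forest /=; apply/forall_inP => T /imsetP[i _ ->].
have [r ir rs] := reach_sink graph_acyclic i.
have /graph_sink[b rb] := rs.
have irs : connect (fun x y => e x y || e y x) i r.
  move: ir; apply: connect_sub => x y xy; apply: connect1; by rewrite xy.
have -> : component E i = component E r.
  by apply/setP => x; rewrite !inE; apply: (same_connect (undirected_sym e)).
have r0 : outdeg E r = 0%N by apply/eqP/outdeg0P.
rewrite (component_root graph_is_forest r0).
have := H r b rb; congr (_ \is a _).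
by rewrite /weight; apply: eq_bigl => k; rewrite inE.
Qed.
End GraphOf.

(** The exponents after the vertices outside [s] have been integrated out, leaves
    first. *)
Definition residual F s : 'I_n -> rat := fun j =>
  if j \in s then a j + \sum_(i | (i \notin s) && arrow (edges F) i j) weight a F i else 0.

Section Residual.
Variable F : rooted_graph n.
Hypothesis FF : F \in forests n.
Local Notation e := (arrow (edges F)).

Lemma residual_all s : (forall i, i \in s) -> residual F s = a.
Proof.
move=> all_s; apply: funext => j; rewrite /residual all_s big1 ?addr0 // => i.
by rewrite all_s.
Qed.

Lemma residual_leaf s i : i \in s -> (forall c, e c i -> c \notin s) ->
  residual F s i = weight a F i.
Proof.
move=> is_ leaf; rewrite /residual is_ (weight_step FF); congr (_ + _).
by apply: eq_bigl => c; case ci : (e c i); rewrite ?andbF // leaf.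
Qed.

Lemma residual_upd s i : uniq s -> i \in s -> (forall c, e c i -> c \notin s) ->
  (forall j, forest_code F i = inl j -> j \in s) ->
  upd (residual F s) i (forest_code F i) = residual F (rem i s).
Proof.
move=> us is_ leaf up; apply: funext => x; rewrite /upd (residual_leaf is_ leaf).
rewrite /residual mem_rem_uniq // inE.
have [->//|xi] /= := eqVneq x i.
have sumE : x \in s -> \sum_(c | (c \notin rem i s) && e c x) weight a F c
    = \sum_(c | (c \notin s) && e c x) weight a F c + (if e i x then weight a F i else 0).
  move=> xs; have mr c : (c \notin rem i s) = (c == i) || (c \notin s).
    by rewrite mem_rem_uniq // inE negb_and negbK.
  case: ifP => ix.
    rewrite (bigD1 i) /=; last by rewrite mr eqxx ix.
    rewrite addrC; congr (_ + _); apply: eq_bigl => c; rewrite mr.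
    have [->|ci] := eqVneq c i; first by rewrite is_ /= andbF.
    by rewrite /= andbT.
  rewrite addr0; apply: eq_bigl => c; rewrite mr.
  by have [->|ci] := eqVneq c i; rewrite ?ix ?andbF.
case E : (forest_code F i) up => [j|b] up.
  have ij : e i j by rewrite -(forest_code_edge FF) E.
  have [xj|xj] := eqVneq x j.
    have js : j \in s by apply: up.
    rewrite xj in sumE *; by rewrite js sumE // ij addrA.
  case: ifP => // xs; rewrite sumE // ifF ?addr0 //.
  by apply: contraNF xj => ix; rewrite (forest_functional FF ij ix).
case: ifP => // xs; rewrite sumE // ifF ?addr0 //.
by rewrite -(forest_code_edge FF) E.
Qed.

Lemma leaf_exists s : s != [::] -> exists2 i, i \in s & forall c, e c i -> c \notin s.
Proof.
case: s => [//|i0 s] _; set s' := i0 :: s.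
have i0s : i0 \in s' by rewrite mem_head.
(* a vertex of s with the fewest vertices below it *)
case: (arg_minnP (fun i => #|[set k | preceq F k i]|) i0s) => i is_ imin.
exists i => // c ci; apply/negP => cs; have := imin c cs; rewrite leqNgt => /negP; apply.
apply: proper_card; apply/properP; split.
  apply/subsetP => k; rewrite !inE => kc; exact: connect_trans kc (connect1 ci).
exists i; first by rewrite inE /preceq connect0.
by rewrite inE; apply: (forest_acyclic FF).
Qed.

End Residual.
End CodesAndForests.

(** * Products of blocks of forests *)

Section ForestForms.
Variables (C : numFieldType) (K : fieldType) (n : nat) (X : coordinates C K n).
Variable a : 'I_n -> rat.
Local Notation cst := (cst X).
Local Notation block := (block X).
Local Notation upd := (@upd n).
Local Notation aform := {ffun {set 'I_n} -> K}.
Local Notation code := ('I_n + bool)%type.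
Local Notation unit := (unit_form K n).
Local Notation bspan := (bspan X).
Local Notation residual := (residual a).
Local Notation weight := (weight a).
Implicit Types (F : rooted_graph n) (i j k c x : 'I_n) (phi : 'I_n -> code) (s : seq 'I_n).

Definition forest_product F s : aform :=
  foldr (fun i => block i (forest_code F i) (weight F i)) unit s.

Lemma forest_product_rem F s i : i \in s -> exists b : bool,
  forest_product F s
  = fmul ((-1) ^+ b) (block i (forest_code F i) (weight F i) (forest_product F (rem i s))).
Proof.
elim: s => //= k s IH; rewrite inE eq_sym; have [->|ki] /= := eqVneq k i.
  by move=> _; exists false; rewrite expr0 fmul1.
move=> is_; have [b ->] := IH is_; rewrite blockZ blockC; case: ifP => _.
  by exists b.
exists (~~ b); rewrite fmulN -fmulNl; congr (fmul _ _).
by case: (b); rewrite ?expr0 ?expr1 ?opprK.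
Qed.

Definition up_closed F s := forall i j, i \in s -> forest_code F i = inl j -> j \in s.

Lemma up_closed_rem F s i : uniq s -> (forall c, arrow (edges F) c i -> c \notin s) ->
  F \in forests n -> up_closed F s -> up_closed F (rem i s).
Proof.
move=> us leaf FF up k j; rewrite !mem_rem_uniq // !inE => /andP[ki ks] kj.
rewrite (up k j ks kj) andbT; apply: contraL ks => /eqP ji; apply: leaf.
by rewrite -(forest_code_edge FF) kj ji.
Qed.

Lemma leaf_valid F s i : F \in int_forests a -> uniq s -> up_closed F s -> i \in s ->
  is_valid (rem i s) (weight F i) (forest_code F i).
Proof.
move=> FI us up is_; have FF : F \in forests n by move: FI; rewrite inE => /andP[].
case E : (forest_code F i) => [j|b]; last exact: (root_weight_int FI E).
rewrite /= mem_rem_uniq // inE (up i j is_ E) andbT.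
have ij : arrow (edges F) i j by rewrite -(forest_code_edge FF) E.
by apply: contraTneq ij => ->; apply/negP => ii; have := forest_acyclic FF ii; rewrite connect0.
Qed.

(** Removal of the leaves one after the other. *)
Theorem forest_in_bspan F s : F \in int_forests a -> uniq s -> up_closed F s ->
  bspan s (residual F s) (forest_product F s).
Proof.
move=> FI; have FF : F \in forests n by move: FI; rewrite inE => /andP[].
have [m] := ubnP (size s); elim: m s => // m IH s; rewrite ltnS => sm us up.
case: (eqVneq s [::]) sm us up => [-> _ _ _|s0 sm us up]; first exact: lspan_gen.
have [i is_ leaf] := leaf_exists FF s0.
have [b ->] := forest_product_rem F is_.
have -> : (-1) ^+ b = cst ((-1) ^+ b) by rewrite rmorphXn rmorphN rmorph1.
apply: bspan_scale; rewrite -(residual_leaf a FF is_ leaf); apply: bspan_leaf => //.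
  by rewrite residual_leaf //; apply: leaf_valid.
rewrite residual_upd //; last by move=> j; apply: up.
apply: IH; [|exact: rem_uniq|exact: up_closed_rem].
by rewrite size_rem // prednK //; case: (s) is_.
Qed.

Lemma sorted_leaf F k s : F \in forests n -> increasing (forest_code F) ->
  pairwise (fun i j : 'I_n => (i < j)%N) (k :: s) -> up_closed F (k :: s) ->
  (forall c, arrow (edges F) c k -> c \notin k :: s) /\ up_closed F s.
Proof.
move=> FF incr; rewrite pairwise_cons => /andP[/allP ks _] up; split=> [c|i j is_ ij].
  rewrite -(forest_code_edge FF) => /eqP/incr ck; rewrite inE negb_or; apply/andP; split.
    by apply: contraTneq ck => ->; rewrite ltnn.
  by apply/negP => /ks; rewrite ltnNge (ltnW ck).
have := up i j _ ij; rewrite !inE is_ orbT => /(_ isT)/predU1P[jk|//].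
by have := ltn_trans (ks i is_) (incr i j ij); rewrite jk ltnn.
Qed.

Lemma sorted_uniq s : pairwise (fun i j : 'I_n => (i < j)%N) s -> uniq s.
Proof.
elim: s => //= k s IH /andP[/allP ks /IH->]; rewrite andbT.
by apply/negP => /ks; rewrite ltnn.
Qed.

(** The smallest vertex is a leaf, so that the order of the variables is an order
    of removal of leaves. *)
Lemma residual_cons F k s : F \in forests n -> increasing (forest_code F) ->
  pairwise (fun i j : 'I_n => (i < j)%N) (k :: s) -> up_closed F (k :: s) ->
  residual F (k :: s) k = weight F k
  /\ upd (residual F (k :: s)) k (forest_code F k) = residual F s.
Proof.
move=> FF incr ps up; have [leaf _] := sorted_leaf FF incr ps up.
have kk : k \in k :: s by rewrite mem_head.
split; first exact: residual_leaf.
rewrite residual_upd //; [|exact: sorted_uniq|by move=> j; apply: up].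
by rewrite /= eqxx.
Qed.

Lemma code_product_forest F s : F \in forests n -> increasing (forest_code F) ->
  pairwise (fun i j : 'I_n => (i < j)%N) s -> up_closed F s ->
  code_product X (forest_code F) s (residual F s) = forest_product F s.
Proof.
move=> FF incr; elim: s => //= k s IH ps up.
have [_ up'] := sorted_leaf FF incr ps up; have [-> ->] := residual_cons FF incr ps up.
by rewrite IH //; case/andP: ps.
Qed.

Lemma valid_codes_forest F s : F \in int_forests a -> increasing (forest_code F) ->
  pairwise (fun i j : 'I_n => (i < j)%N) s -> up_closed F s ->
  valid_codes (forest_code F) s (residual F s).
Proof.
move=> FI incr; have FF : F \in forests n by move: FI; rewrite inE => /andP[].
elim: s => //= k s IH ps up.
have [_ up'] := sorted_leaf FF incr ps up; have [-> ->] := residual_cons FF incr ps up.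
rewrite IH ?andbT //; last by case/andP: ps.
have := leaf_valid FI (@sorted_uniq (k :: s) ps) up (mem_head k s).
by rewrite /= eqxx.
Qed.

Lemma valid_codes_increasing phi s b : pairwise (fun i j : 'I_n => (i < j)%N) s ->
  valid_codes phi s b -> forall i j, i \in s -> phi i = inl j -> (i < j)%N /\ j \in s.
Proof.
elim: s b => //= k s IH b /andP[/allP ks ps] /andP[vd vp] i j.
rewrite inE => /predU1P[->|is_] E.
  by rewrite E /= in vd; rewrite inE vd orbT; split=> //; apply: ks.
by have [ij js] := IH _ ps vp i j is_ E; rewrite inE js orbT.
Qed.

Lemma valid_codes_roots F s : F \in forests n -> increasing (forest_code F) ->
  pairwise (fun i j : 'I_n => (i < j)%N) s -> up_closed F s ->
  valid_codes (forest_code F) s (residual F s) ->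
  forall i b, i \in s -> forest_code F i = inr b -> weight F i \is a Num.int.
Proof.
move=> FF incr; elim: s => //= k s IH ps up.
have [_ up'] := sorted_leaf FF incr ps up; have [-> ->] := residual_cons FF incr ps up.
move=> /andP[vd vp] i b; rewrite inE => /predU1P[->|is_] E.
  by rewrite E in vd.
by apply: IH E => //; case/andP: ps.
Qed.

Lemma enum_sorted : pairwise (fun i j : 'I_n => (i < j)%N) (enum 'I_n).
Proof.
rewrite -(pairwise_map (val : 'I_n -> nat) ltn) val_enum_ord.
by rewrite -sorted_pairwise ?iota_ltn_sorted //; apply: ltn_trans.
Qed.

Lemma residual_enum F : residual F (enum 'I_n) = a.
Proof. by apply: residual_all => i; rewrite mem_enum. Qed.

Theorem valid_code_forest phi : valid_codes phi (enum 'I_n) a ->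
  exists F, [/\ F \in int_forests a, rectified F
              & code_product X phi (enum 'I_n) a = forest_product F (enum 'I_n)].
Proof.
move=> vp; have es := enum_sorted.
have incr : increasing phi.
  by move=> i j E; have [] := valid_codes_increasing es vp (mem_enum _ i) E.
pose F := graph_of phi; have FF : F \in forests n := graph_is_forest incr.
have codeE : forest_code F =1 phi := forest_code_graph incr.
have incrF : increasing (forest_code F) by move=> i j; rewrite codeE; apply: incr.
have upF : up_closed F (enum 'I_n) by move=> i j _ _; rewrite mem_enum.
have FI : F \in int_forests a.
  apply: graph_is_int => // i b E.
  apply: (valid_codes_roots FF incrF es upF) (mem_enum _ i) (etrans (codeE i) E).
  by rewrite residual_enum (eq_valid_codes _ (psi := phi)) // => k _; rewrite codeE.
exists F; split=> //; first exact: graph_rectified.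
rewrite -code_product_forest // residual_enum; apply: eq_code_product => k _.
by rewrite codeE.
Qed.

Lemma int_forest_bspan F : F \in int_forests a ->
  bspan (enum 'I_n) a (forest_product F (enum 'I_n)).
Proof.
move=> FI; rewrite -[X in bspan _ X](residual_enum F); apply: forest_in_bspan => //.
  exact: enum_uniq.
by move=> i j _ _; rewrite mem_enum.
Qed.

Lemma rect_forest_code F : F \in int_forests a -> rectified F ->
  valid_codes (forest_code F) (enum 'I_n) a
  /\ code_product X (forest_code F) (enum 'I_n) a = forest_product F (enum 'I_n).
Proof.
move=> FI rF; have FF : F \in forests n by move: FI; rewrite inE => /andP[].
have incr := increasing_forest_code FF rF.
have up : up_closed F (enum 'I_n) by move=> i j _ _; rewrite mem_enum.
have R := residual_enum F; split.
  by rewrite -[X in valid_codes _ _ X]R; apply: valid_codes_forest enum_sorted up.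
by rewrite -[X in code_product _ _ _ X]R; apply: code_product_forest enum_sorted up.
Qed.

End ForestForms.

(** * The field of rational functions *)

Section QuotientRule.
Variable K : fieldType.
Implicit Types a b c d : K.

Lemma quotient_ruleM a b c d a' b' c' d' : b != 0 -> d != 0 ->
  ((a' * c + a * c') * (b * d) - a * c * (b' * d + b * d')) / (b * d) ^+ 2
  = (a' * b - a * b') / b ^+ 2 * (c / d) + a / b * ((c' * d - c * d') / d ^+ 2).
Proof. by move=> b0 d0; field; rewrite b0 d0. Qed.

Lemma sub_fractions a b c d : b != 0 -> d != 0 ->
  a / b - c / d = (a * d - c * b) / (b * d).
Proof. by move=> b0 d0; field; rewrite b0 d0. Qed.

Lemma quotient_ruleC a b ai bi aj bj aij bij : b != 0 ->
  ((aij * b + aj * bi - (ai * bj + a * bij)) * b ^+ 2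
     - (aj * b - a * bj) * (2%:R * b ^+ 1 * bi)) / (b ^+ 2) ^+ 2
  = ((aij * b + ai * bj - (aj * bi + a * bij)) * b ^+ 2
     - (ai * b - a * bi) * (2%:R * b ^+ 1 * bj)) / (b ^+ 2) ^+ 2.
Proof. by move=> b0; field; rewrite ?b0. Qed.

End QuotientRule.

Section RationalFunctionField.
Variables (C : numFieldType) (n : nat).
Local Notation K := (ratfun C n).
Local Notation z := (@z C n).
Local Notation partial := (@partial C n).
Implicit Types (i j : 'I_n) (f g : K) (w : 'S_n).

Definition ratconst (c : C) : K := frac_of c%:MP.

Lemma ratconst_is_zmod_morphism : zmod_morphism ratconst.
Proof. by move=> c d; rewrite /ratconst mpolyCB rmorphB. Qed.
Lemma ratconst_is_monoid_morphism : monoid_morphism ratconst.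
Proof. by split=> [|c d]; rewrite /ratconst ?mpolyC1 ?rmorph1 ?mpolyCM ?rmorphM. Qed.
HB.instance Definition _ := GRing.isZmodMorphism.Build C K ratconst ratconst_is_zmod_morphism.
HB.instance Definition _ := GRing.isMonoidMorphism.Build C K ratconst ratconst_is_monoid_morphism.

Local Notation F := (@frac_of C n).
Lemma fracM (p q : {mpoly C[n]}) : F (p * q) = F p * F q. Proof. exact: rmorphM. Qed.
Lemma fracD (p q : {mpoly C[n]}) : F (p + q) = F p + F q. Proof. exact: rmorphD. Qed.
Lemma fracB (p q : {mpoly C[n]}) : F (p - q) = F p - F q. Proof. exact: rmorphB. Qed.
Lemma frac1 : F 1 = 1. Proof. exact: rmorph1. Qed.

Lemma partial_der i : derivation (partial i).
Proof.
split=> [|f g]; first exact: partialD.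
rewrite (fracE f) (fracE g).
move: (numer f) (denom f) (denom_neq0 f) (numer g) (denom g) (denom_neq0 g).
move=> a b b0 c d d0.
have fb0 : frac_of b != 0 by rewrite frac_of_eq0.
have fd0 : frac_of d != 0 by rewrite frac_of_eq0.
have -> : frac_of a / frac_of b * (frac_of c / frac_of d) = frac_of (a * c) / frac_of (b * d).
  by rewrite !fracM mulf_div.
rewrite (partialE i _ (mulf_neq0 b0 d0)) (partialE i _ b0) (partialE i _ d0).
rewrite !mderivM !fracB !fracM !fracD !fracM.
by rewrite (quotient_ruleM (F a) (F c) _ _ _ _ fb0 fd0).
Qed.

Lemma partial_poly i (p : {mpoly C[n]}) : partial i (frac_of p) = frac_of (mderiv i p).
Proof.
have := partialE i p (oner_neq0 {mpoly C[n]}); rewrite frac1 divr1 => ->.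
by rewrite -mpolyC1 mderivC mulr0 subr0 mpolyC1 mulr1 expr1n divr1.
Qed.

Lemma partial_z i j : partial i (z j) = (i == j)%:R.
Proof.
rewrite /z partial_poly mderivX mnm1E eq_sym.
case: eqP => [->|_]; last by rewrite scale0r rmorph0.
by rewrite scale1r -[X in (X - _)%MM]add0m addmK mpolyX0 rmorph1.
Qed.

Lemma partial_ratconst i c : partial i (ratconst c) = 0.
Proof. by rewrite partial_poly mderivC rmorph0. Qed.

Lemma partialC i j f : partial i (partial j f) = partial j (partial i f).
Proof.
rewrite (fracE f); move: (numer f) (denom f) (denom_neq0 f) => a b b0.
have fb0 : frac_of b != 0 by rewrite frac_of_eq0.
have fb20 : frac_of b ^+ 2 != 0 by rewrite expf_neq0.
have E k : partial k (F a / F b)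
    = (F (mderiv k a) * F b - F a * F (mderiv k b)) / F b ^+ 2.
  by rewrite (der_div (partial_der k) (F a) fb0) !partial_poly.
have E2 k l : partial l ((F (mderiv k a) * F b - F a * F (mderiv k b)) / F b ^+ 2)
    = ((F (mderiv l (mderiv k a)) * F b + F (mderiv k a) * F (mderiv l b)
         - (F (mderiv l a) * F (mderiv k b) + F a * F (mderiv l (mderiv k b)))) * F b ^+ 2
       - (F (mderiv k a) * F b - F a * F (mderiv k b)) * (2%:R * F b ^+ 1 * F (mderiv l b)))
      / (F b ^+ 2) ^+ 2.
  have dl := partial_der l.
  rewrite (der_div dl _ fb20) (derB dl) (derM dl (F _)) (derM dl (F a)) (derX dl (F b)).
  by rewrite !partial_poly.
rewrite E E2 E E2 (mderiv_comm i j a) (mderiv_comm i j b).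
by rewrite (quotient_ruleC (F a) (F (mderiv i a)) (F (mderiv i b)) (F (mderiv j a))
  (F (mderiv j b)) (F (mderiv i (mderiv j a))) (F (mderiv i (mderiv j b))) fb0).
Qed.

Lemma perm_ratfun_poly w (p : {mpoly C[n]}) : perm_ratfun w (frac_of p) = frac_of (msym w p).
Proof.
have := perm_ratfunE w p (oner_neq0 {mpoly C[n]}); rewrite msym1 !rmorph1 !divr1.
exact.
Qed.

Lemma perm_ratfun_z w i : perm_ratfun w (z i) = z (w i).
Proof.
rewrite perm_ratfun_poly msymX; congr (frac_of 'X_[_]); apply/mnmP => j.
by rewrite mnmE !mnm1E -(inj_eq (@perm_inj _ w)) permKV.
Qed.

Lemma perm_ratfun_is_zmod_morphism w : zmod_morphism (@perm_ratfun C n w).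
Proof.
move=> f g; rewrite (fracE f) (fracE g).
move: (numer f) (denom f) (denom_neq0 f) (numer g) (denom g) (denom_neq0 g).
move=> a b b0 c d d0.
have fb0 : frac_of b != 0 by rewrite frac_of_eq0.
have fd0 : frac_of d != 0 by rewrite frac_of_eq0.
have -> : frac_of a / frac_of b - (frac_of c / frac_of d)
    = frac_of (a * d - c * b) / frac_of (b * d).
  by rewrite !fracB !fracM (sub_fractions (F a) (F c) fb0 fd0).
rewrite (perm_ratfunE w _ (mulf_neq0 b0 d0)) (perm_ratfunE w _ b0) (perm_ratfunE w _ d0).
rewrite msymB !msymM !fracB !fracM.
have wb0 : frac_of (msym w b) != 0 by rewrite frac_of_eq0 msym_neq0.
have wd0 : frac_of (msym w d) != 0 by rewrite frac_of_eq0 msym_neq0.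
by rewrite (sub_fractions _ _ wb0 wd0).
Qed.

Lemma perm_ratfun_is_monoid_morphism w : monoid_morphism (@perm_ratfun C n w).
Proof.
split=> [|f g]; first by rewrite -(rmorph1 (@frac_of C n)) perm_ratfun_poly msym1.
rewrite (fracE f) (fracE g).
move: (numer f) (denom f) (denom_neq0 f) (numer g) (denom g) (denom_neq0 g).
move=> a b b0 c d d0.
have -> : frac_of a / frac_of b * (frac_of c / frac_of d) = frac_of (a * c) / frac_of (b * d).
  by rewrite !fracM mulf_div.
rewrite (perm_ratfunE w _ (mulf_neq0 b0 d0)) (perm_ratfunE w _ b0) (perm_ratfunE w _ d0).
by rewrite !msymM !fracM mulf_div.
Qed.

HB.instance Definition _ w := GRing.isZmodMorphism.Build K K (perm_ratfun w)
  (perm_ratfun_is_zmod_morphism w).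
HB.instance Definition _ w := GRing.isMonoidMorphism.Build K K (perm_ratfun w)
  (perm_ratfun_is_monoid_morphism w).

End RationalFunctionField.

Definition standard_coordinates (C : numFieldType) (n : nat) : coordinates C (ratfun C n) n :=
  @Coordinates C (ratfun C n) n (@ratconst C n) (@z C n) (@partial C n) (@partial_der C n)
    (@partial_z C n) (@partial_ratconst C n) (@partialC C n).

(** * Rational forms and regular forms *)

Section Wedge.
Variables (C : numFieldType) (n : nat).
Local Notation K := (ratfun C n).
Local Notation form := (Defs.form C n).
Local Notation X := (standard_coordinates C n).
Implicit Types (f g : K) (alpha beta gamma : form) (S : {set 'I_n}) (i j k : 'I_n).

Lemma form_mulE f alpha : form_mul f alpha = fmul f alpha. Proof. by []. Qed.
Lemma scaleE (c : C) alpha : c *: alpha = fmul (cst X c) alpha. Proof. by []. Qed.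

Lemma wedgeDl alpha beta gamma : wedge (alpha + beta) gamma = wedge alpha gamma + wedge beta gamma.
Proof.
apply/ffunP => S; rewrite !ffunE -big_split; apply: eq_bigr => A _ /=.
by rewrite ffunE mulrDl mulrDr.
Qed.

Lemma wedge_mull f alpha beta : wedge (fmul f alpha) beta = fmul f (wedge alpha beta).
Proof.
apply/ffunP => S; rewrite !ffunE mulr_sumr; apply: eq_bigr => A _ /=.
by rewrite ffunE -mulrA mulrCA.
Qed.

Lemma wedgeNl alpha beta : wedge (- alpha) beta = - wedge alpha beta.
Proof.
have NE (x : form) : - x = fmul (-1) x by rewrite fmulNl fmul1.
by rewrite NE wedge_mull -NE.
Qed.

Lemma wedge_suml I (r : seq I) (P : pred I) (F : I -> form) beta :
  wedge (\sum_(i <- r | P i) F i) beta = \sum_(i <- r | P i) wedge (F i) beta.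
Proof.
elim/big_rec2: _ => [|i u v _ <-]; last by rewrite wedgeDl.
by rewrite -[X in wedge X](fmul0 (0 : form)) wedge_mull fmul0.
Qed.

Lemma wedge_form0 f beta : wedge (form0 f) beta = fmul f beta.
Proof.
apply/ffunP => S; rewrite !ffunE (bigD1 set0) ?sub0set //= big1 => [|A /andP[_ A0]].
  rewrite addr0 setD0 !ffunE eqxx /inversions (_ : [set _ in _ | _] = set0).
    by rewrite cards0 expr0 mul1r.
  by apply/setP => ij; rewrite !inE.
by rewrite ffunE (negPf A0) mul0r mulr0.
Qed.

Lemma wedge_dz i alpha : wedge (dz C i) alpha = lw i alpha.
Proof.
apply/ffunP => S; rewrite !ffunE; case: ifP => iS; last first.
  rewrite big1 // => A AS; rewrite ffunE; case: eqP => [AE|_]; last by rewrite mul0r mulr0.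
  by have := subsetP AS i; rewrite AE inE eqxx iS => /(_ isT).
rewrite (bigD1 [set i]) ?sub1set //= big1 ?addr0 => [|A /andP[_ Ai]]; last first.
  by rewrite ffunE (negPf Ai) mul0r mulr0.
rewrite ffunE eqxx mul1r; congr (_ ^+ _ * _).
rewrite /inversions /pos.
have pair_inj : injective (pair i : 'I_n -> _) by move=> x y [].
rewrite -(card_imset (mem [set j in S | (j < i)%N]) pair_inj).
congr #|pred_of_set _|; apply/setP => -[x y]; rewrite !inE /=; apply/idP/imsetP => [|[y']].
  by move=> /andP[/andP[/eqP-> /andP[_ yS]] yi]; exists y; rewrite ?inE ?yS.
rewrite !inE => /andP[y'S y'i] [-> ->]; rewrite eqxx y'S y'i andbT /= andbT.
by apply: contraTneq y'i => ->; rewrite ltnn.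
Qed.

Definition basis_form S : form := [ffun T : {set 'I_n} => (T == S)%:R].

Lemma form_expansion alpha : alpha = \sum_S fmul (alpha S) (basis_form S).
Proof.
apply/ffunP => T; rewrite sum_ffunE (bigD1 T) //= !ffunE eqxx mulr1 big1 ?addr0 // => S ST.
by rewrite !ffunE eq_sym (negPf ST) mulr0.
Qed.

Lemma lw_basis_form i S : lw i (basis_form S)
  = if i \in S then 0 else fmul ((-1) ^+ pos i S) (basis_form (i |: S)).
Proof.
apply/ffunP => T; rewrite !ffunE; have [iT|iT] := boolP (i \in T); last first.
  case: ifP => iS; rewrite !ffunE //; case: eqP => [TE|_]; last by rewrite mulr0.
  by rewrite TE !inE eqxx in iT.
have [iS|iS] := boolP (i \in S); rewrite !ffunE.
  case: eqP => [TE|_]; last by rewrite mulr0.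
  by rewrite -TE !inE eqxx in iS.
have [->|TS] := eqVneq T (i |: S); first by rewrite setU1K // eqxx pos_self.
by case: eqP => [TE|_]; [rewrite -TE setD1K ?eqxx in TS|rewrite !mulr0].
Qed.

Lemma lw_basis i S : (forall j, j \in S -> (i < j)%N) -> lw i (basis_form S) = basis_form (i |: S).
Proof.
move=> iS; have iNS : i \notin S by apply/negP => /iS; rewrite ltnn.
rewrite lw_basis_form (negPf iNS) (_ : pos i S = 0%N) ?fmul1 //.
apply/eqP; rewrite cards_eq0; apply/eqP/setP => j; rewrite !inE.
by apply/negbTE/negP => /andP[/iS ij ji]; have := ltn_trans ij ji; rewrite ltnn.
Qed.

Lemma sorted_enum_set S : pairwise (fun i j : 'I_n => (i < j)%N) (enum S).
Proof.
have -> : enum S = filter (mem S) (enum 'I_n) by rewrite enumT /enum_mem.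
by apply: pairwise_filter; apply: enum_sorted.
Qed.

Lemma big_wedge_fold (F : 'I_n -> form) (s : seq 'I_n) :
  \big[@wedge C n/form0 1]_(i <- s) F i = foldr (fun i => wedge (F i)) (unit_form K n) s.
Proof. by elim: s => [|i s IH]; rewrite ?big_nil ?big_cons //= IH. Qed.

Lemma dz_wedgeE S : dz_wedge C S = basis_form S.
Proof.
rewrite /dz_wedge big_wedge_fold.
have := sorted_enum_set S; rewrite -[in RHS](set_enum S).
elim: (enum S) => [_|i s IH] /=.
  rewrite (_ : [set:: [::]] = set0); last by apply/setP => j; rewrite !inE.
  by apply/ffunP => T; rewrite !ffunE; case: eqP.
move=> /andP[/allP is_ ps]; rewrite IH // wedge_dz lw_basis => [|j]; last by rewrite inE => /is_.
by congr basis_form; apply/setP => j; rewrite !inE.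
Qed.

Lemma ext_dE alpha : ext_d alpha = \sum_i lw i (fmap (partial i) alpha).
Proof.
rewrite /ext_d exchange_big; apply: eq_bigr => i _ /=.
rewrite [in RHS](form_expansion (fmap _ _)) lw_sum; apply: eq_bigr => S _.
by rewrite dz_wedgeE wedge_dz lw_fmul ffunE.
Qed.

Lemma wedge_omega1 i alpha : wedge (omega1 C i) alpha = fmul (z C i)^-1 (lw i alpha).
Proof. by rewrite /omega1 form_mulE wedge_mull wedge_dz. Qed.

Lemma nablaE a alpha : nabla a alpha = nab X a alpha.
Proof.
rewrite /nabla ext_dE /nab /omega wedge_suml -big_split; apply: eq_bigr => i _ /=.
rewrite scaleE wedge_mull wedge_omega1 fmulA -!lw_fmul -lwD; congr lw.
by apply/ffunP => S; rewrite !ffunE.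
Qed.
End Wedge.

Section Regular.
Variables (C : numFieldType) (n : nat).
Local Notation K := (ratfun C n).
Local Notation X := (standard_coordinates C n).
Local Notation z := (@z C n).
Local Notation regular := (@regular C n).
Implicit Types (f g : K) (i j k : 'I_n).

Lemma regular_mul f g : f \in regular -> g \in regular -> f * g \in regular.
Proof.
move=> /asboolP[N [p fN]] /asboolP[M [q gM]]; apply/asboolP; exists (N + M)%N, (p * q).
by rewrite exprD mulrACA fN gM fracM.
Qed.

Lemma regular_poly (p : {mpoly C[n]}) : frac_of p \in regular.
Proof. by apply/asboolP; exists 0%N, p; rewrite expr0 mulr1. Qed.

Lemma regular_add f g : f \in regular -> g \in regular -> f + g \in regular.
Proof.
by move=> fr gr; have := regular_submod 1 fr gr; rewrite mpolyC1 frac1 mul1r.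
Qed.

Lemma frac_arrangement_neq0 : frac_of (arrangement C n) != 0.
Proof.
have F_prod (I : Type) (r : seq I) (P : pred I) (G : I -> {mpoly C[n]}) :
    frac_of (\prod_(l <- r | P l) G l) = \prod_(l <- r | P l) frac_of (G l) by apply: rmorph_prod.
rewrite fracM !F_prod mulf_neq0 //; first by apply/prodf_neq0 => i _; apply: (z_neq0 X).
apply/prodf_neq0 => i _; rewrite F_prod; apply/prodf_neq0 => j ij.
rewrite fracB; apply: (zB_neq0 X); by apply: contraTneq ij => ->; rewrite ltnn.
Qed.

Lemma regular_factor (p q : {mpoly C[n]}) : p * q = arrangement C n -> (frac_of p)^-1 \in regular.
Proof.
move=> E; have := frac_arrangement_neq0; rewrite -E fracM mulf_eq0 negb_or => /andP[p0 q0].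
apply/asboolP; exists 1%N, q; rewrite -E fracM expr1.
exact: (mulKf p0 (frac_of q)).
Qed.

Lemma regular_zV i : (z i)^-1 \in regular.
Proof.
apply: (@regular_factor _ ((\prod_(j < n | j != i) 'X_j)
   * \prod_(j < n) \prod_(k < n | (j < k)%N) ('X_j - 'X_k))).
by rewrite mulrA /arrangement; congr (_ * _); rewrite [RHS](bigD1 i).
Qed.

Lemma regular_zBV i j : (z i - z j)^-1 \in regular.
Proof.
wlog ij : i j / (i < j)%N => [H|].
  have [ij|ji|/val_inj->] := ltngtP i j; first exact: H.
    have -> : (z i - z j)^-1 = -1 * (z j - z i)^-1 by rewrite -opprB invrN mulN1r.
    apply: regular_mul; last exact: H.
    by have := regular_poly (-1); rewrite /frac_of rmorphN rmorph1.
  by rewrite subrr invr0 regular0.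
rewrite /Defs.z -fracB.
apply: (@regular_factor _ ((\prod_(l < n) 'X_l)
   * ((\prod_(k < n | (i < k)%N && (k != j)) ('X_i - 'X_k))
   * \prod_(l < n | l != i) \prod_(k < n | (l < k)%N) ('X_l - 'X_k)))).
rewrite mulrCA /arrangement; congr (_ * _).
by rewrite [RHS](bigD1 i) // [X in _ = X * _](bigD1 j) //= mulrA.
Qed.

Lemma reg_regular s : uniq s -> {subset reg X s <= regular}.
Proof.
move=> us; apply: (@reg_generated _ _ _ X) => //.
- by move=> c; apply: regular_poly.
- by move=> i; apply: regular_poly.
- exact: regular_zV.
- exact: regular_zBV.
- exact: regular_add.
exact: regular_mul.
Qed.

Lemma regular_reg : {subset regular <= reg X (enum 'I_n)}.
Proof.
have un := enum_uniq 'I_n; have ok := reg_ok X un.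
have zr i : z i \in reg X (enum 'I_n) by apply: (reg_z ok); rewrite mem_enum.
have prodr (I : Type) (r : seq I) (P : pred I) (G : I -> K) :
    (forall l, P l -> G l \in reg X (enum 'I_n)) ->
    \prod_(l <- r | P l) G l \in reg X (enum 'I_n).
  move=> H; elim/big_rec: _ => [|l u Pl ur]; first exact: (reg1 X un).
  by apply: (regM un) => //; apply: H.
have F_prod (I : Type) (r : seq I) (P : pred I) (G : I -> {mpoly C[n]}) :
    frac_of (\prod_(l <- r | P l) G l) = \prod_(l <- r | P l) frac_of (G l) by apply: rmorph_prod.
have polyr (p : {mpoly C[n]}) : frac_of p \in reg X (enum 'I_n).
  elim/mpolyind: p => [|c m p _ _ IH].
    by rewrite (_ : frac_of 0 = 0) ?(reg0 X un) //; apply: rmorph0.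
  rewrite fracD; apply: (regD un) => //.
  rewrite -mul_mpolyC fracM; apply: (regM un); first exact: (reg_cst ok).
  rewrite mpolyXE_id F_prod; apply: (prodr) => i _.
  rewrite (_ : frac_of ('X_i ^+ m i) = z i ^+ m i); first exact: (regX un).
  exact: rmorphXn.
move=> f /asboolP[N [p fN]].
have A0 := frac_arrangement_neq0.
have AV : (frac_of (arrangement C n))^-1 \in reg X (enum 'I_n).
  rewrite /arrangement fracM invfM; apply: (regM un).
    rewrite F_prod -prodfV; apply: (prodr) => i _.
    by apply: (reg_zV ok); rewrite mem_enum.
  rewrite F_prod -prodfV; apply: (prodr) => i _.
  rewrite F_prod -prodfV; apply: (prodr) => j _.
  by rewrite fracB; apply: (reg_zBV ok); rewrite mem_enum.
have -> : f = frac_of p * (frac_of (arrangement C n))^-1 ^+ N.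
  by rewrite -fN exprVn (mulfK (expf_neq0 N A0)).
by apply: (regM un) => //; apply: (regX un).
Qed.

Lemma OmegaP p alpha : reflect
  (Om X (enum 'I_n) (enum 'I_n) alpha /\ forall S, alpha S != 0 -> #|S| = p)
  (alpha \in @Omega C n p).
Proof.
apply: (iffP forallP) => [H|[[ra _] da] S].
  split=> [|S aS]; last by have /andP[_ /implyP/(_ aS)/eqP] := H S.
  split=> [S|S i _ _]; last by rewrite mem_enum.
  by apply: regular_reg; have /andP[] := H S.
rewrite (reg_regular (enum_uniq _) (ra S)) /=.
by apply/implyP => /da->.
Qed.
End Regular.

(** * The forms attached to forests *)

Section Normalization.
Variables (C : numFieldType) (K : fieldType) (n : nat) (X : coordinates C K n).
Variable a : 'I_n -> rat.
Local Notation z := (coord X).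
Local Notation block := (block X).
Local Notation aform := {ffun {set 'I_n} -> K}.
Local Notation weight := (weight a).
Implicit Types (F : rooted_graph n) (i j k c x : 'I_n) (s : seq 'I_n) (alpha : aform).

Definition edge_op i j (q : rat) alpha : aform :=
  if q \is a Num.int then fmul (z i - z j)^-1 (lw i alpha - lw j alpha)
  else fmul (z i - z j)^-1 (fmul (z i)^-1 (lw i alpha) - fmul (z j)^-1 (lw j alpha)).

(** The difference between floor and ceiling accounts for the passage from
    [dz_i / z_i] to [dz_i]. *)
Lemma block_edge i j q alpha :
  fmul (z i ^ (- Num.floor q) * z j ^ Num.ceil q) (edge_op i j q alpha) = block i (inl j) q alpha.
Proof.
have zi := z_neq0 X i; have zj := z_neq0 X j.
rewrite /block /ecoef !edge_coefE // /edge_op ceil_floor.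
have [qint|qint] /= := boolP (q \is a Num.int); rewrite ?addr0.
  by rewrite !fmulDr !fmulN !fmulA -!invr_expz.
rewrite !fmulDr !fmulN !fmulA !expfzDr // !expr1z -!invr_expz.
have := expfz_neq0 (Num.floor q) zi; move: (z i ^ _) (z j ^ _) => u v u0.
move: (z i - z j)^-1 => d.
congr (fmul _ _ - fmul _ _); first by field; rewrite u0 zi.
by field; rewrite u0 zj.
Qed.

(** A relational form of [forest_code], which passes to a relabelled graph without
    any discussion of its components. *)
Definition encodes (phi : 'I_n -> 'I_n + bool) F := forall i,
  [/\ (phi i == inr false) = (i \in open_roots F), (phi i == inr true) = (i \in closed_roots F)
    & forall j, (phi i == inl j) = arrow (edges F) i j].

Lemma encodes_forest F : F \in forests n -> encodes (forest_code F) F.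
Proof.
by move=> FF i; split=> [||j]; rewrite ?forest_code_open ?forest_code_closed ?forest_code_edge.
Qed.

Definition vertex_monomial phi F i : K :=
  z i ^ (- Num.floor (weight F i))
  * (if (phi i : 'I_n + bool) is inl j then z j ^ Num.ceil (weight F i) else 1).

Lemma monomial_exponent phi F : encodes phi F ->
  \prod_j z j ^ exponent a F j = \prod_i vertex_monomial phi F i.
Proof.
move=> FF; rewrite /vertex_monomial big_split /=.
rewrite (eq_bigr (fun j => z j ^ (- Num.floor (weight F j))
    * \prod_(i | arrow (edges F) i j) z j ^ Num.ceil (weight F i))) => [|j _]; last first.
  rewrite /exponent expfzDr ?z_neq0 //; congr (_ * _).
  by elim/big_rec2: _ => [|i u v _ <-]; rewrite ?expr0z // expfzDr ?z_neq0.
rewrite big_split /=; congr (_ * _).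
rewrite (exchange_big_dep xpredT) //=; apply: eq_bigr => i _.
have [_ _ edgeE] := FF i; case E : (phi i) => [j|b].
  rewrite (big_pred1 j) // => k; rewrite -edgeE E.
  by rewrite (inj_eq (@inl_inj _ _)) eq_sym.
by rewrite big_pred0 // => k; rewrite -edgeE E.
Qed.

(** Scalars are collected from operators which are linear over them. *)
Lemma fold_scale (m rho : 'I_n -> K) (f g : 'I_n -> aform -> aform) (u : aform) s :
  (forall i (c : K) alpha, g i (fmul c alpha) = fmul c (g i alpha)) ->
  (forall i alpha, fmul (m i) (f i alpha) = fmul (rho i) (g i alpha)) ->
  fmul (\prod_(i <- s) m i) (foldr f u s) = fmul (\prod_(i <- s) rho i) (foldr g u s).
Proof.
move=> gZ fg; elim: s => [|i s IH] /=; first by rewrite !big_nil.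
by rewrite !big_cons [m i * _]mulrC -[LHS]fmulA fg fmulC -gZ IH gZ fmulA.
Qed.
End Normalization.

Section Beta.
Variables (C : numFieldType) (n : nat) (a : 'I_n -> rat) (r : nat).
Local Notation K := (ratfun C n).
Local Notation X := (standard_coordinates C n).
Local Notation form := (Defs.form C n).
Implicit Types (F : rooted_graph n) (i j : 'I_n).

Definition open_factor F i : C := if i \in open_roots F then (-1) ^+ sign_at F i * r%:R else 1.

Lemma wedge_edge_form F i j alpha :
  wedge (edge_form a C F i j) alpha = edge_op X i j (weight a F i) alpha.
Proof.
rewrite /edge_form /edge_op; case: ifP => _.
  by rewrite /omega2 form_mulE wedge_mull wedgeDl wedgeNl !wedge_dz.
by rewrite form_mulE wedge_mull wedgeDl wedgeNl !wedge_omega1.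
Qed.

Lemma beta_factor_block phi F i alpha : encodes phi F ->
  fmul (vertex_monomial X a phi F i) (wedge (beta_factor a C r F i) alpha)
  = fmul (cst X (open_factor F i)) (block X i (phi i) (weight a F i) alpha).
Proof.
move=> /(_ i)[openE closedE edgeE]; rewrite /beta_factor /open_factor /vertex_monomial.
rewrite -openE -closedE.
case E : (phi i) => [j|[]] /=.
- rewrite (big_pred1 j) => [|k]; last by rewrite -edgeE E (inj_eq (@inl_inj _ _)) eq_sym.
  rewrite wedge_edge_form rmorph1 fmul1.
  exact: (block_edge X i j (weight a F i) alpha).
- rewrite wedge_omega1 mulr1 [LHS]fmulA rmorph1 fmul1; congr fmul.
  by rewrite (expfzDr _ _ (z_neq0 X i)) exprN1.
rewrite wedge_form0 mulr1 fmulC; congr (fmul _ _).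
rewrite rmorphM rmorph_nat rmorphXn rmorphN rmorph1 //.
Qed.

Lemma beta_bar_encoded phi F : encodes phi F ->
  beta_bar a C r F = (\prod_i open_factor F i) *:
    (foldr (fun i => block X i (phi i) (weight a F i)) (unit_form K n) (enum 'I_n) : form).
Proof.
move=> FF; rewrite /beta_bar big_wedge_fold scaleE form_mulE.
have -> : \prod_(j < n) z C j ^ exponent a F j = \prod_(i <- enum 'I_n) vertex_monomial X a phi F i.
  by rewrite (monomial_exponent X a FF) big_enum.
have -> : cst X (\prod_i open_factor F i) = \prod_(i <- enum 'I_n) cst X (open_factor F i).
  by rewrite rmorph_prod big_enum.
have -> : index_enum 'I_n = enum 'I_n by rewrite enumT [index_enum _]unlock.
apply: (@fold_scale K n (vertex_monomial X a phi F) (fun i => cst X (open_factor F i))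
  (fun i => @wedge C n (beta_factor a C r F i))
  (fun i => block X i (phi i) (weight a F i))) => [i c alpha|i alpha].
  exact: blockZ.
exact: beta_factor_block.
Qed.

Lemma beta_barE F : F \in forests n ->
  beta_bar a C r F = (\prod_i open_factor F i) *: (forest_product X a F (enum 'I_n) : form).
Proof. by move=> /encodes_forest/beta_bar_encoded. Qed.
End Beta.

(** * Homogeneous components *)

Section Degree.
Variables (C : numFieldType) (K : fieldType) (n : nat) (X : coordinates C K n).
Variable a : 'I_n -> rat.
Local Notation aform := {ffun {set 'I_n} -> K}.
Implicit Types (F : rooted_graph n) (i j k : 'I_n) (s : seq 'I_n) (alpha beta : aform).

Definition homogeneous p alpha := forall S, alpha S != 0 -> #|S| = p.

Definition proj p alpha : aform := [ffun S : {set 'I_n} => if #|S| == p then alpha S else 0].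

Lemma homogeneous_lw p i alpha : homogeneous p alpha -> homogeneous p.+1 (lw i alpha).
Proof.
move=> ha S; rewrite ffunE; case: ifP => iS; rewrite ?eqxx // mulf_eq0 negb_or.
by move=> /andP[_ /ha <-]; rewrite (cardsD1 i S) iS.
Qed.

Lemma homogeneous_fmul p f alpha : homogeneous p alpha -> homogeneous p (fmul f alpha).
Proof. by move=> ha S; rewrite ffunE mulf_eq0 negb_or => /andP[_ /ha]. Qed.

Lemma homogeneous_add p alpha beta : homogeneous p alpha -> homogeneous p beta ->
  homogeneous p (alpha + beta).
Proof.
move=> ha hb S; rewrite ffunE; have [->|/ha //] := eqVneq (alpha S) 0.
by rewrite add0r => /hb.
Qed.

Lemma homogeneous_block p k d q alpha : homogeneous p alpha ->
  homogeneous (p + ~~ is_open d) (block X k d q alpha).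
Proof.
move=> ha; case: d => [j|[]] /=; rewrite /is_open /= ?addn1 ?addn0.
- rewrite -fmulNl; apply: homogeneous_add; apply: homogeneous_fmul; exact: homogeneous_lw.
- by apply: homogeneous_fmul; apply: homogeneous_lw.
exact: homogeneous_fmul.
Qed.

Lemma homogeneous_forest_product F s :
  homogeneous (count (fun i => ~~ is_open (forest_code F i)) s) (forest_product X a F s).
Proof.
elim: s => [|k s IH] /=; last by rewrite addnC; apply: homogeneous_block.
by move=> S; rewrite ffunE; have [->|_] := eqVneq S set0; rewrite ?cards0 ?eqxx.
Qed.

(** Each non-open vertex contributes one 1-form. *)
Lemma count_not_open F : F \in forests n ->
  count (fun i => ~~ is_open (forest_code F i)) (enum 'I_n) = (#|edges F| + #|closed_roots F|)%N.
Proof.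
move=> FF; have -> : #|edges F| = #|[set e.1 | e in edges F]|.
  rewrite card_in_imset // => -[i j] [i' j'] /= ij ij' E; move: ij ij'; rewrite -{}E => ij ij'.
  by rewrite (forest_functional FF (ij : arrow (edges F) i j) (ij' : arrow (edges F) i j')).
rewrite -cardsUI (_ : _ :&: _ = set0) ?cards0 ?addn0.
  set B := [set e.1 | e in edges F].
  rewrite cardE [in RHS]/enum_mem size_filter -enumT; apply: eq_count => i.
  rewrite -[RHS]/(i \in B :|: closed_roots F) in_setU -(forest_code_closed FF) /is_open.
  case E : (forest_code F i) => [j|[]]; rewrite ?orbT ?orbF //=.
    symmetry; apply/imsetP; exists (i, j) => //.
    by rewrite -[_ \in _]/(arrow _ _ _) -(forest_code_edge FF) E.
  symmetry; apply/negbTE/negP => /imsetP[[i' j] ij /= ii']; move: ij.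
  by rewrite -[_ \in _]/(arrow _ _ _) -(forest_code_edge FF) -ii' E.
apply/setP => i; rewrite !inE; apply/negbTE/negP => /andP[/imsetP[[i' j] ij /= ->]].
rewrite -(forest_code_closed FF); have := ij.
by rewrite -[_ \in edges F]/(arrow _ _ _) -(forest_code_edge FF) => /eqP->.
Qed.

Lemma projD p alpha beta : proj p (alpha + beta) = proj p alpha + proj p beta.
Proof. by apply/ffunP => S; rewrite !ffunE; case: ifP; rewrite ?addr0. Qed.

Lemma proj_fmul p f alpha : proj p (fmul f alpha) = fmul f (proj p alpha).
Proof. by apply/ffunP => S; rewrite !ffunE; case: ifP; rewrite ?mulr0. Qed.

Lemma proj0 p : proj p 0 = 0.
Proof. by apply/ffunP => S; rewrite !ffunE if_same. Qed.

Lemma proj_sum p I (r : seq I) (P : pred I) (G : I -> aform) :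
  proj p (\sum_(l <- r | P l) G l) = \sum_(l <- r | P l) proj p (G l).
Proof. by elim/big_rec2: _ => [|l u v _ <-]; rewrite ?proj0 ?projD. Qed.

Lemma proj_homogeneous p alpha : homogeneous p alpha -> proj p alpha = alpha.
Proof.
move=> ha; apply/ffunP => S; rewrite ffunE; case: ifP => // Sp.
by apply/eqP; rewrite eq_sym; apply: contraFT Sp => /ha ->; rewrite eqxx.
Qed.

Lemma proj_other p q alpha : p != q -> homogeneous p alpha -> proj q alpha = 0.
Proof.
move=> pq ha; apply/ffunP => S; rewrite !ffunE; case: ifP => // /eqP Sq.
by apply/eqP; apply: contraNT pq => /ha <-; rewrite Sq.
Qed.

Lemma homogeneous_proj p alpha : homogeneous p (proj p alpha).
Proof. by move=> S; rewrite ffunE; case: ifP => [/eqP//|_]; rewrite eqxx. Qed.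

Lemma proj_lw p i alpha : proj p.+1 (lw i alpha) = lw i (proj p alpha).
Proof.
apply/ffunP => S; rewrite !ffunE; have [iS|_] := boolP (i \in S); last by rewrite if_same.
by rewrite (cardsD1 i S) iS eqSS; case: ifP; rewrite ?mulr0.
Qed.

Lemma proj0_lw i alpha : proj 0 (lw i alpha) = 0.
Proof.
apply/ffunP => S; rewrite !ffunE; case: ifP => // /eqP/cards0_eq->.
by rewrite inE.
Qed.

Lemma proj_nab p alpha : proj p.+1 (nab X a alpha) = nab X a (proj p alpha).
Proof.
rewrite /nab proj_sum; apply: eq_bigr => i _; rewrite proj_lw; congr lw.
by apply/ffunP => S; rewrite !ffunE; case: ifP; rewrite ?tw0.
Qed.

Lemma proj0_nab alpha : proj 0 (nab X a alpha) = 0.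
Proof. by rewrite /nab proj_sum big1 // => i _; apply: proj0_lw. Qed.

Lemma Om_proj s t p alpha : uniq s -> Om X s t alpha -> Om X s t (proj p alpha).
Proof.
move=> us [ra ta]; split=> [S|S i]; rewrite ffunE; case: ifP; rewrite ?(reg0 X us) ?eqxx //.
by move=> _; apply: ta.
Qed.
End Degree.

(** * Basis of the cohomology *)

Section Cohomology.
Variables (C : numFieldType) (n : nat) (a : 'I_n -> rat) (r : nat).
Hypothesis r_gt0 : (0 < r)%N.
Local Notation K := (ratfun C n).
Local Notation X := (standard_coordinates C n).
Local Notation form := (Defs.form C n).
Local Notation bb := (beta_bar a C r).
Local Notation un := (enum_uniq 'I_n).
Implicit Types (F : rooted_graph n) (i j : 'I_n) (alpha eta : form).

Lemma supported_enum : supported a (enum 'I_n).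
Proof. by move=> i; rewrite mem_enum. Qed.

Definition open_constant F : C := \prod_i open_factor C r F i.

Lemma open_constant_neq0 F : open_constant F != 0.
Proof.
apply/prodf_neq0 => i _; rewrite /open_factor; case: ifP => _; last exact: oner_neq0.
by rewrite mulf_neq0 ?expf_neq0 ?oppr_eq0 ?oner_eq0 // pnatr_eq0 -lt0n.
Qed.

Lemma beta_bar_product F : F \in forests n ->
  bb F = open_constant F *: (forest_product X a F (enum 'I_n) : form).
Proof. exact: beta_barE. Qed.

Lemma forest_productE F : F \in forests n ->
  forest_product X a F (enum 'I_n) = (open_constant F)^-1 *: bb F.
Proof. by move=> FF; rewrite beta_bar_product // scalerA mulVf ?open_constant_neq0 // scale1r. Qed.

Lemma int_forest_forest F : F \in int_forests a -> F \in forests n.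
Proof. by rewrite inE => /andP[]. Qed.

Lemma beta_bar_bspan F : F \in int_forests a -> bspan X (enum 'I_n) a (bb F).
Proof.
move=> FI; rewrite beta_bar_product ?int_forest_forest //.
by apply: bspan_scale; apply: int_forest_bspan.
Qed.

Lemma beta_bar_homogeneous F : F \in forests n ->
  homogeneous (#|edges F| + #|closed_roots F|) (bb F).
Proof.
move=> FF; rewrite beta_bar_product //; apply: homogeneous_fmul.
by rewrite -count_not_open //; apply: homogeneous_forest_product.
Qed.

Lemma int_forests_degE p F : (F \in int_forests_deg a p)
  = (F \in int_forests a) && (#|edges F| + #|closed_roots F| == p)%N.
Proof.
apply/bigcupP/andP => [[k _]|[FI /eqP Fp]].
  rewrite inE => /andP[-> /andP[/eqP-> /eqP->]]; split=> //.
  by rewrite subnKC // -ltnS.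
have kp : (#|edges F| < p.+1)%N by rewrite -Fp ltnS leq_addr.
by exists (Ordinal kp); rewrite // inE FI /= eqxx -Fp addKn eqxx.
Qed.

Lemma rect_forests_degE p F : (F \in rect_forests_deg a p)
  = [&& F \in int_forests a, rectified F & (#|edges F| + #|closed_roots F| == p)%N].
Proof.
apply/bigcupP/and3P => [[k _]|[FI rF /eqP Fp]].
  rewrite !inE => /andP[/andP[-> /andP[/eqP-> /eqP->]] ->]; split=> //.
  by rewrite subnKC // -ltnS.
have kp : (#|edges F| < p.+1)%N by rewrite -Fp ltnS leq_addr.
by exists (Ordinal kp); rewrite // inE rF andbT inE FI /= eqxx -Fp addKn eqxx.
Qed.

Lemma beta_bar_cocycle p F : F \in int_forests_deg a p -> bb F \in cocycles a p.
Proof.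
rewrite int_forests_degE => /andP[FI /eqP Fp].
have [bO b0] := bspan_spec un supported_enum (beta_bar_bspan FI).
apply/andP; split; last by rewrite nablaE b0.
apply/OmegaP; split=> // S; rewrite -Fp; apply: beta_bar_homogeneous.
exact: int_forest_forest.
Qed.

Lemma span_gen (A : {set rooted_graph n}) F : F \in A -> bb F \in in_span A bb.
Proof.
move=> FA; apply/asboolP; exists (fun G => (G == F)%:R).
rewrite (bigD1 F) //= eqxx scale1r big1 ?addr0 // => G /andP[_ /negPf->].
by rewrite scale0r.
Qed.

Lemma Hspan_cocycle p : {subset Hspan a C r p <= cocycles a p}.
Proof.
move=> x /asboolP[c ->]; apply: (rpred_sum (S := cocycles a p)) => F FA.
by apply: (rpredZ (s := cocycles a p)); apply: beta_bar_cocycle.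
Qed.

Lemma proj_bspan p v : bspan X (enum 'I_n) a v ->
  (proj p v : form) \in in_span (rect_forests_deg a p) bb.
Proof.
move=> /(bspan_codes un); elim=> [|q u w [phi vphi ->] _ IH].
  by rewrite proj0; apply: rpred0.
rewrite projD proj_fmul; apply: (rpredD (V := form)) => //.
have [F [FI rF ->]] := valid_code_forest X vphi.
have FF := int_forest_forest FI; rewrite forest_productE //.
have hF := beta_bar_homogeneous FF.
have [Fp|Fp] := eqVneq (#|edges F| + #|closed_roots F|)%N p.
  rewrite scaleE proj_fmul -!scaleE (proj_homogeneous (p := p)) -?Fp //.
  do 2!apply: (rpredZ (s := in_span _ _)).
  by apply: span_gen; rewrite rect_forests_degE FI rF eqxx.
rewrite scaleE proj_fmul (proj_other Fp hF) !fmulr0.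
exact: rpred0.
Qed.

Lemma rect_sub_int p : {subset rect_forests_deg a p <= int_forests_deg a p}.
Proof. by move=> F; rewrite rect_forests_degE int_forests_degE => /and3P[-> _ ->]. Qed.

(** Each [beta_bar] is a combination of products of valid blocks, hence of
    rectified forests; its homogeneous component of degree [p] retains those of
    degree [p]. *)
Lemma rect_span p : in_span (rect_forests_deg a p) bb =i Hspan a C r p.
Proof.
move=> x; apply/idP/idP => /asboolP[c ->].
  apply: (rpred_sum (S := Hspan a C r p)) => F FA; apply: (rpredZ (s := Hspan a C r p)).
  by apply: span_gen; apply: rect_sub_int.
apply: (rpred_sum (S := in_span (rect_forests_deg a p) bb)) => F.
rewrite int_forests_degE => /andP[FI /eqP Fp].
apply: (rpredZ (s := in_span (rect_forests_deg a p) bb)).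
rewrite -(proj_homogeneous (beta_bar_homogeneous (int_forest_forest FI))) Fp.
by apply: proj_bspan; apply: beta_bar_bspan.
Qed.

Lemma rect_exact_zero p (c : rooted_graph n -> C) eta :
  Om X (enum 'I_n) (enum 'I_n) eta ->
  \sum_(F in rect_forests_deg a p) c F *: bb F = nab X a eta ->
  forall F, F \in rect_forests_deg a p -> c F = 0.
Proof.
move=> eO H F FA.
have good G : G \in rect_forests_deg a p -> [/\ G \in int_forests a, rectified G & G \in forests n].
  by rewrite rect_forests_degE => /and3P[GI rG _]; split=> //; apply: int_forest_forest.
have := @independence C K n X (enum 'I_n) a (rooted_graph n) (mem (rect_forests_deg a p))
  (@forest_code n) (fun G => c G * open_constant G) eta un supported_enum _ _ eO _ F FA.
move=> H0; apply/eqP; have /eqP : c F * open_constant F = 0.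
  apply: H0.
  - by move=> G /good[GI rG _]; have [] := rect_forest_code X GI rG.
  - move=> G G' /good[_ _ GF] /good[_ _ GF'] E.
    rewrite -(graph_of_forest_code GF) -(graph_of_forest_code GF').
    by congr graph_of; apply: funext => i; apply: E; rewrite mem_enum.
  rewrite -H; apply: eq_bigr => G /good[GI rG GF].
  by have [_ ->] := rect_forest_code X GI rG; rewrite beta_bar_product // scalerA.
by rewrite mulf_eq0 (negPf (open_constant_neq0 F)) orbF.
Qed.

Lemma rect_basis p : is_basis (Hspan a C r p) (rect_forests_deg a p) bb.
Proof.
split; last exact: rect_span.
move=> c H F FA; apply: (@rect_exact_zero p c 0) => //; first exact: (Om0 X _ (enum_uniq 'I_n)).
by rewrite nab0.
Qed.

Lemma coboundary_zero p x : x \in Hspan a C r p -> coboundaries a p x -> x = 0.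
Proof.
rewrite -rect_span => /asboolP[c ->]; case: p => [|q] /= in c *; first by move=> /eqP.
move=> /asboolP[eta /OmegaP[eO _]]; rewrite nablaE => H.
by rewrite big1 // => F FA; rewrite (rect_exact_zero eO H FA) scale0r.
Qed.

(** The homogeneous component of degree [p] of the decomposition in
    [cocycle_span]. *)
Lemma cocycle_class p eta : eta \in cocycles a p ->
  exists2 x, x \in Hspan a C r p & coboundaries a p (x - eta).
Proof.
move=> /andP[/OmegaP[eO dege] /eqP]; rewrite nablaE => e0.
have [v [xi [vV xO E]]] := cocycle_span un supported_enum eO e0.
exists (proj p v); first by rewrite -rect_span proj_bspan.
have Ep : eta = proj p v + proj p (nab X a xi).
  by rewrite -projD -E proj_homogeneous.
rewrite [X in _ - X]Ep opprD addrA subrr add0r /coboundaries; case: p => [|q] in dege Ep *.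
  by rewrite proj0_nab oppr0.
apply/asboolP; exists (- (proj q xi : form)).
  rewrite -scaleN1r; apply: (rpredZ (s := @Omega C n q)); apply/OmegaP.
  by split; [exact: (Om_proj _ (enum_uniq _) xO)|exact: homogeneous_proj].
by rewrite nablaE (nabN X a (proj q xi)) proj_nab.
Qed.

Definition Hclass p (x : subspace (Hspan a C r p)) : cohomology C a p :=
  cohomology_class (Subspace (Hspan_cocycle (valP x))).

Lemma Hclass_linear p : linear (@Hclass p).
Proof.
move=> k x y; rewrite /Hclass /cohomology_class -linearP /=; congr lclass.
exact: val_inj.
Qed.

HB.instance Definition _ p := GRing.isLinear.Build C (subspace (Hspan a C r p))
  (cohomology C a p) *:%R (@Hclass p) (@Hclass_linear p).

Lemma HclassE p (x : subspace (Hspan a C r p)) (y : subspace (cocycles a p)) :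
  subspace_val x = subspace_val y -> Hclass x = cohomology_class y.
Proof. by move=> E; congr cohomology_class; apply: val_inj. Qed.

Lemma Hclass_bij p : bijective (@Hclass p).
Proof.
have inj : injective (@Hclass p).
  move=> x y /eqP; rewrite [_ == _]lclass_eq => H; apply: val_inj; apply/eqP.
  rewrite -subr_eq0; apply/eqP; apply: (coboundary_zero (p := p)) => //.
  rewrite -scaleN1r; apply: (rpredD (V := form)); first exact: valP.
  by apply: (rpredZ (s := Hspan a C r p)); apply: valP.
have surj y : exists x, Hclass x = y.
  have [x xH xb] := cocycle_class (valP (repr y)).
  exists (Subspace xH); rewrite -[RHS]lclass_repr; apply/eqP.
  by rewrite [_ == _]lclass_eq.
have [g gK] := choice (surj p).
by exists g => // x; apply: inj.
Qed.
End Cohomology.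

(** * Equivariance *)

Section Sorting.
Variables (K : fieldType) (n : nat).
Local Notation aform := {ffun {set 'I_n} -> K}.
Variables (I : Type) (B : I -> aform -> aform) (chi : I -> I -> bool).
Implicit Types (i j k l : I) (s t : seq I) (alpha : aform).
Hypothesis BZ : forall k f alpha, B k (fmul f alpha) = fmul f (B k alpha).
Hypothesis BC : forall k l alpha, B k (B l alpha) = fmul ((-1) ^+ chi k l) (B l (B k alpha)).

Lemma fold_move k s alpha :
  B k (foldr B alpha s) = fmul (\prod_(l <- s) (-1) ^+ chi k l) (foldr B (B k alpha) s).
Proof.
elim: s => [|l s IH] /=; first by rewrite big_nil fmul1.
by rewrite BC IH BZ big_cons fmulA.
Qed.
End Sorting.

Section Inversions.
Variables (K : fieldType) (n : nat).
Local Notation aform := {ffun {set 'I_n} -> K}.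
Variables (B : 'I_n -> aform -> aform) (chi : 'I_n -> 'I_n -> bool).
Implicit Types (i j k l : 'I_n) (s t : seq 'I_n) (alpha : aform).
Hypothesis BZ : forall k f alpha, B k (fmul f alpha) = fmul f (B k alpha).
Hypothesis BC : forall k l alpha, B k (B l alpha) = fmul ((-1) ^+ chi k l) (B l (B k alpha)).
Local Notation sorted_ord := (pairwise (fun i j : 'I_n => (i < j)%N)).

Definition step_sign k s : K := \prod_(l <- s | (l < k)%N) (-1) ^+ chi k l.

(** The sign gained by sorting [s]: one factor for each inversion between
    anticommuting operators. *)
Fixpoint inversion_sign s : K :=
  if s is k :: s' then step_sign k s' * inversion_sign s' else 1.

Lemma fold_insert k s s' alpha : sorted_ord s' -> perm_eq (k :: s) s' -> sorted_ord s ->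
  B k (foldr B alpha s) = fmul (step_sign k s) (foldr B alpha s').
Proof.
move=> ps' pe; have ks' : k \in s' by rewrite -(perm_mem pe) mem_head.
case/splitPr: ks' ps' pe => s1 s2 ps' pe ps.
have pe' : perm_eq s (s1 ++ s2) by rewrite -(perm_cons k) (permPl pe) perm_catC perm_cons perm_catC.
move: ps'; rewrite pairwise_cat /= => /and3P[/allrelP s1k ps1 /andP[/allP ks2 ps2]].
have s12 : sorted_ord (s1 ++ s2).
  rewrite pairwise_cat ps1 ps2 !andbT; apply/allrelP => x y xs ys; apply: s1k => //.
  by rewrite inE ys orbT.
have ltn_tr : transitive (fun i j : 'I_n => (i < j)%N) by move=> x y z; apply: ltn_trans.
have -> : s = s1 ++ s2.
  apply: (sorted_eq ltn_tr) => //; rewrite ?sorted_pairwise //.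
  by move=> x y /andP[xy yx]; have := ltn_trans xy yx; rewrite ltnn.
rewrite !foldr_cat /= (fold_move BZ BC); congr (fmul _ _).
rewrite /step_sign big_cat /= [X in _ * X]big_seq_cond [X in _ * X]big_pred0 ?mulr1 => [|x].
  rewrite [LHS]big_seq [RHS]big_seq_cond; apply: eq_bigl => x.
  by case xs : (x \in s1) => //=; rewrite s1k ?mem_head.
by apply/negbTE/negP => /andP[/ks2 kx xk]; have := ltn_trans kx xk; rewrite ltnn.
Qed.

Lemma fold_sort t s alpha : sorted_ord s -> perm_eq t s ->
  foldr B alpha t = fmul (inversion_sign t) (foldr B alpha s).
Proof.
elim: t s => [|k t IH] s ps pe /=.
  by rewrite fmul1; move: pe; rewrite perm_sym => /perm_nilP->.
have ks : k \in s by rewrite -(perm_mem pe) mem_head.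
have pr : sorted_ord (rem k s) by apply: subseq_pairwise (rem_subseq k s) ps.
have per : perm_eq t (rem k s) by rewrite -(perm_cons k) (permPl pe) perm_to_rem.
rewrite (IH _ pr per) BZ (fold_insert alpha ps _ pr) ?fmulA; last first.
  by rewrite perm_sym perm_to_rem.
by rewrite mulrC /step_sign (perm_big _ per).
Qed.

Lemma inversion_sign_map (w : 'S_n) s : sorted_ord s ->
  inversion_sign [seq w i | i <- s]
  = \prod_(i <- s) \prod_(j <- s | (i < j)%N) (-1) ^+ ((w j < w i)%N && chi (w i) (w j)).
Proof.
elim: s => [|k s IH] /=; first by rewrite big_nil.
move=> /andP[/allP ks ps]; rewrite big_cons big_cons ltnn IH //; congr (_ * _).
  rewrite /step_sign big_map big_mkcond big_seq [RHS]big_seq_cond; apply: eq_big => [l|l ls].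
    by case ls : (l \in s); rewrite //= ks.
  by case: ifP.
apply: eq_big_seq => l ls; rewrite big_cons.
by have := ks l ls; case: ltngtP.
Qed.

End Inversions.

Lemma inversion_sign_rmorph (K L : fieldType) n (f : {rmorphism K -> L}) chi (s : seq 'I_n) :
  inversion_sign L chi s = f (inversion_sign K chi s).
Proof.
elim: s => [|k s IH] /=; first by rewrite rmorph1.
rewrite rmorphM -IH /step_sign rmorph_prod; congr (_ * _).
by apply: eq_bigr => l _; rewrite rmorphXn rmorphN1.
Qed.

Section SignOfPermutation.
Variables (K : numFieldType) (n : nat).

(** A permutation of 0, ..., n-1 multiplies their Vandermonde determinant by its
    sign, and the factors which change sign are those of the inversions. *)
Lemma sign_inversions (w : 'S_n) :
  (-1) ^+ odd_perm w = \prod_(i < n) \prod_(j < n | (i < j)%N) (-1) ^+ (w j < w i)%N :> K.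
Proof.
(* any increasing sequence would do *)
pose x : 'rV[rat]_n := \row_j (j : nat)%:R.
have V0 : \det (Vandermonde n x) != 0.
  rewrite det_Vandermonde; apply/prodf_neq0 => i _; apply/prodf_neq0 => j ij.
  by rewrite !mxE subr_eq0 eqr_nat gtn_eqF.
have : \det (Vandermonde n (col_perm w x)) = (-1) ^+ odd_perm w * \det (Vandermonde n x).
  rewrite (_ : Vandermonde n (col_perm w x) = col_perm w (Vandermonde n x)).
    by rewrite col_permE det_mulmx det_perm mulrC odd_permV.
  by apply/matrixP => i j; rewrite !mxE.
pose y (u v : 'I_n) : rat := (v : nat)%:R - (u : nat)%:R.
have sgy u v : Num.sg (y u v) = if (u < v)%N then 1 else if (v < u)%N then -1 else 0.
  rewrite /y; case: ltngtP => uv; last by rewrite uv subrr sgr0.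
    by rewrite gtr0_sg // subr_gt0 ltr_nat.
  by rewrite ltr0_sg // subr_lt0 ltr_nat.
have sgM (P : 'I_n -> 'I_n -> rat) : Num.sg (\prod_(i < n) \prod_(j < n | (i < j)%N) P i j)
    = \prod_(i < n) \prod_(j < n | (i < j)%N) Num.sg (P i j).
  by rewrite (big_morph _ (@sgrM _) (@sgr1 _)); apply: eq_bigr => i _;
    rewrite (big_morph _ (@sgrM _) (@sgr1 _)).
rewrite !det_Vandermonde => /(congr1 Num.sg); rewrite sgrM !sgM.
rewrite [in X in _ * X]big1 ?mulr1 => [|i _]; last first.
  by rewrite big1 // => j ij; rewrite !mxE [LHS](sgy i j) ij.
rewrite sgrX sgrN1 => E.
have {}E : (-1) ^+ odd_perm w
    = \prod_(i < n) \prod_(j < n | (i < j)%N) (-1) ^+ (w j < w i)%N :> rat.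
  rewrite -E; apply: eq_bigr => i _; apply: eq_bigr => j ij.
  rewrite !mxE [LHS](sgy (w i) (w j)); case: ltngtP => //= /val_inj/perm_inj ji.
  by rewrite ji ltnn in ij.
have := congr1 (@ratr K) E; rewrite rmorphXn rmorphN1 => ->.
rewrite rmorph_prod; apply: eq_bigr => i _; rewrite rmorph_prod; apply: eq_bigr => j _.
by rewrite rmorphXn rmorphN1.
Qed.
End SignOfPermutation.

Section Permutation.
Variables (C : numFieldType) (n : nat) (w : 'S_n).
Local Notation K := (ratfun C n).
Local Notation X := (standard_coordinates C n).
Local Notation form := (Defs.form C n).
Local Notation pr := (@perm_ratfun C n w).
Local Notation z := (@z C n).
Implicit Types (f : K) (i j k : 'I_n) (S : {set 'I_n}) (alpha beta : form).

Definition perm_basis S : form := foldr (fun i => lw (w i)) (unit_form K n) (enum S).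

Lemma perm_formE alpha : perm_form w alpha = \sum_S fmul (pr (alpha S)) (perm_basis S).
Proof.
apply: eq_bigr => S _; congr fmul; rewrite big_wedge_fold /perm_basis.
by elim: (enum S) => //= i s ->; rewrite wedge_dz.
Qed.

Lemma perm_formD alpha beta : perm_form w (alpha + beta) = perm_form w alpha + perm_form w beta.
Proof.
rewrite !perm_formE -big_split; apply: eq_bigr => S _ /=.
by rewrite ffunE -fmulDl; congr fmul; apply: rmorphD.
Qed.

Lemma perm_form_fmul f alpha : perm_form w (fmul f alpha) = fmul (pr f) (perm_form w alpha).
Proof.
rewrite !perm_formE fmul_sum; apply: eq_bigr => S _.
by rewrite ffunE fmulA; congr fmul; apply: rmorphM.
Qed.

Lemma perm_formN alpha : perm_form w (- alpha) = - perm_form w alpha.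
Proof.
have E beta : - beta = fmul (-1) beta by rewrite fmulNl fmul1.
by rewrite E perm_form_fmul rmorphN1 -E.
Qed.

Lemma perm_form_sum I (r : seq I) (P : pred I) (F : I -> form) :
  perm_form w (\sum_(l <- r | P l) F l) = \sum_(l <- r | P l) perm_form w (F l).
Proof.
elim/big_rec2: _ => [|l u v _ <-]; last exact: perm_formD.
by rewrite -[X in perm_form w X](fmul0 (0 : form)) perm_form_fmul rmorph0 fmul0.
Qed.

Lemma perm_form_basis S : perm_form w (basis_form C S) = perm_basis S.
Proof.
rewrite perm_formE (bigD1 S) //= ffunE eqxx rmorph1 fmul1 big1 ?addr0 // => T TS.
by rewrite ffunE (negPf TS) rmorph0 fmul0.
Qed.

Lemma perm_form_unit : perm_form w (unit_form K n) = unit_form K n.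
Proof.
have -> : unit_form K n = basis_form C set0 by apply/ffunP => S; rewrite !ffunE; case: eqP.
rewrite perm_form_basis /perm_basis enum_set0 /=.
by apply/ffunP => S; rewrite !ffunE; case: eqP.
Qed.

Lemma perm_ratfun_const (c : C) : pr (ratconst n c) = ratconst n c.
Proof. by rewrite perm_ratfun_poly -alg_mpolyC msymZ msym1 alg_mpolyC. Qed.

Lemma lw_perm_basis i S : lw (w i) (perm_basis S)
  = if i \in S then 0 else fmul ((-1) ^+ pos i S) (perm_basis (i |: S)).
Proof.
have BZ k f alpha : lw (w k) (fmul f alpha) = fmul f (lw (w k) alpha) by apply: lw_fmul.
have BC k l alpha : lw (w k) (lw (w l) alpha) = fmul ((-1) ^+ true) (lw (w l) (lw (w k) alpha)).
  by rewrite lwC fmulNl fmul1.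
case: ifP => iS; rewrite /perm_basis.
  have : i \in enum S by rewrite mem_enum.
  case/splitPr => s1 s2; rewrite foldr_cat /=.
  rewrite [LHS](fold_move BZ BC i s1) lw2.
  by rewrite (_ : foldr _ 0 s1 = 0) ?fmulr0 //; elim: s1 => //= j s ->; rewrite lw0.
rewrite (fold_insert BZ BC _ (sorted_enum_set (i |: S))) ?sorted_enum_set //; last first.
  apply: uniq_perm; rewrite ?enum_uniq //= ?mem_enum ?iS ?enum_uniq // => j.
  by rewrite !(inE, mem_enum).
congr fmul; rewrite /step_sign big_const_seq iter_mulr_1 /pos; congr (_ ^+ _).
rewrite cardE -size_filter; apply: perm_size.
apply: uniq_perm; [exact: filter_uniq (enum_uniq _)|exact: enum_uniq|].
by move=> j; rewrite !(mem_filter, mem_enum, inE) andbCA andbA.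
Qed.

(** On the basis of the forms, this compares the products of the [dz_(w j)] over
    [S] and over [i |: S], hence reduces to an insertion. *)
Lemma perm_form_lw i alpha : perm_form w (lw i alpha) = lw (w i) (perm_form w alpha).
Proof.
rewrite [in LHS](form_expansion alpha) lw_sum perm_form_sum [in RHS]perm_formE lw_sum.
apply: eq_bigr => S _; rewrite !lw_fmul perm_form_fmul; congr fmul.
rewrite lw_perm_basis lw_basis_form; case: ifP => _.
  by rewrite -[X in perm_form w X](fmul0 (0 : form)) perm_form_fmul rmorph0 fmul0.
by rewrite perm_form_fmul perm_form_basis rmorphXn rmorphN1.
Qed.

Definition perm_code (d : 'I_n + bool) := if d is inl j then inl (w j) else d.

Lemma perm_form_block k d q alpha :
  perm_form w (block X k d q alpha) = block X (w k) (perm_code d) q (perm_form w alpha).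
Proof.
have zE i : pr (z i) = z (w i) by apply: perm_ratfun_z.
have expE i m : pr (z i ^ m) = z (w i) ^ m by rewrite -zE; apply: fmorphXz.
have ecE j m : pr (ecoef X k j m) = ecoef X (w k) (w j) m.
  rewrite /ecoef /edge_coef /= -!zE -(rmorphB pr) -(fmorph_div pr) -(fmorphXz pr).
  by rewrite -(fmorph_div pr).
case: d => [j|[]] /=.
- by rewrite perm_formD perm_formN !perm_form_fmul !perm_form_lw !ecE.
- by rewrite perm_form_fmul perm_form_lw expE.
by rewrite perm_form_fmul expE.
Qed.
End Permutation.

Section Relabelling.
Variables (n : nat) (w : 'S_n) (F : rooted_graph n).
Implicit Types i j k : 'I_n.
Local Notation e := (arrow (edges F)).
Local Notation e' := (arrow (edges (perm_forest w F))).

Lemma arrow_perm i j : e' (w i) (w j) = e i j.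
Proof.
rewrite /arrow /= (mem_imset _ (i, j)) // => -[x y] [x' y'] [].
by move=> /perm_inj-> /perm_inj->.
Qed.

Lemma open_perm i : (w i \in open_roots (perm_forest w F)) = (i \in open_roots F).
Proof. by rewrite [LHS](mem_imset _ i (@perm_inj _ w)). Qed.

Lemma closed_perm i : (w i \in closed_roots (perm_forest w F)) = (i \in closed_roots F).
Proof. by rewrite [LHS](mem_imset _ i (@perm_inj _ w)). Qed.

Lemma preceq_perm i j : preceq (perm_forest w F) (w i) (w j) = preceq F i j.
Proof.
have path_perm x p : path e' (w x) (map w p) = path e x p.
  by elim: p x => //= y p IH x; rewrite arrow_perm IH.
apply/connectP/connectP => [[p]|[p ep ->]]; last by exists (map w p); rewrite ?path_perm ?last_map.
have -> : p = map w (map (w^-1)%g p) by rewrite -map_comp map_id_in // => k _ /=; rewrite permKV.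
by rewrite path_perm last_map => ep /perm_inj->; exists (map (w^-1)%g p).
Qed.

Lemma weight_perm a j : w \in stabilizer a -> weight a (perm_forest w F) (w j) = weight a F j.
Proof.
rewrite inE => /forallP aw; rewrite /weight (reindex_inj (@perm_inj _ w)) /=.
by apply: eq_big => [k|k _]; [exact: preceq_perm|exact/eqP].
Qed.

Lemma encodes_perm phi : encodes phi F ->
  encodes (fun i => perm_code w (phi (w^-1%g i))) (perm_forest w F).
Proof.
move=> Fphi i; have [openE closedE edgeE] := Fphi (w^-1%g i).
rewrite -[X in X \in _](permKV w i) -[X in X \in closed_roots _](permKV w i).
rewrite open_perm closed_perm -openE -closedE.
split=> [||j]; rewrite ?permK; try by case: (phi _) => [j|[]].
rewrite -[X in arrow _ X _](permKV w i) -[j](permKV w) arrow_perm -edgeE.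
by case: (phi _) => //= k; rewrite !(inj_eq (@inl_inj _ _)) (inj_eq perm_inj).
Qed.
End Relabelling.

Section Equivariance.
Variables (C : numFieldType) (n : nat) (a : 'I_n -> rat) (r : nat).
Variables (w : 'S_n) (F : rooted_graph n).
Local Notation K := (ratfun C n).
Local Notation X := (standard_coordinates C n).
Implicit Types i j k : 'I_n.
Local Notation op i := (i \in open_roots F).
Local Notation wF := (perm_forest w F).

(** All the signs of the statement are products over pairs of vertices. *)
Definition pair_sign (b : 'I_n -> 'I_n -> bool) : C :=
  \prod_i \prod_(j : 'I_n) (-1) ^+ b i j.

Lemma pair_signM b b' : pair_sign b * pair_sign b' = pair_sign (fun i j => b i j (+) b' i j).
Proof.
rewrite /pair_sign -big_split; apply: eq_bigr => i _; rewrite -big_split; apply: eq_bigr => j _ /=.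
by rewrite signr_addb.
Qed.

Lemma pair_signC b : pair_sign b = pair_sign (fun i j => b j i).
Proof. exact: exchange_big. Qed.

Lemma eq_pair_sign b b' : b =2 b' -> pair_sign b = pair_sign b'.
Proof. by move=> E; do 2!apply: eq_bigr => ? _; rewrite E. Qed.

Lemma pair_sign_perm (b : 'I_n -> 'I_n -> bool) :
  pair_sign (fun i j => b (w i) (w j)) = pair_sign b.
Proof.
rewrite /pair_sign [RHS](reindex_inj (@perm_inj _ w)); apply: eq_bigr => i _.
by rewrite [RHS](reindex_inj (@perm_inj _ w)).
Qed.

Lemma card_sign (A : {set 'I_n}) : (-1) ^+ #|A| = \prod_(i : 'I_n) (-1) ^+ (i \in A) :> C.
Proof.
rewrite -prodr_const [LHS]big_mkcond; apply: eq_bigr => i _.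
by case: (i \in A); rewrite ?expr1.
Qed.

Lemma open_factors_sign (G : rooted_graph n) : \prod_i open_factor C r G i
  = pair_sign (fun i j => [&& (j < i)%N, i \in open_roots G & j \notin open_roots G])
    * r%:R ^+ #|open_roots G|.
Proof.
rewrite -prodr_const (big_mkcond (fun i => i \in open_roots G)) -big_split.
apply: eq_bigr => i _ /=; rewrite /open_factor; case: ifP => io; last first.
  by rewrite mulr1 big1 // => j _; rewrite andbF.
congr (_ * _); rewrite /sign_at.
have lt_card : #|[set j : 'I_n | (j < i)%N]| = i.
  rewrite -sum1_card (eq_bigl (fun j : 'I_n => (j < i)%N)) => [|j]; last by rewrite inE.
  by rewrite -(big_ord_widen _ (fun=> 1%N)) ?sum1_card ?card_ord // ltnW.
rewrite -{1}lt_card -cardsDS; last by apply/subsetP => j; rewrite !inE => /andP[].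
rewrite card_sign; apply: eq_bigr => j _; congr (_ ^+ _); rewrite !inE /=.
by case: (j < i)%N; rewrite ?io /= ?andbT ?andbF.
Qed.

Lemma perm_sign_exp_sign : (-1) ^+ perm_sign_exp w F
  = pair_sign (fun i j => [&& (i < j)%N, (w j < w i)%N, op i & op j]).
Proof.
rewrite /perm_sign_exp -prodr_const big_mkcond /pair_sign pair_big /=; apply: eq_bigr => -[i j] _.
rewrite !inE /=; move: (op i) (op j) (i < j)%N (w j < w i)%N.
by move=> [] [] [] []; rewrite /= ?expr1.
Qed.

Lemma sorting_sign : inversion_sign C (fun i j => ~~ (op (w^-1%g i) || op (w^-1%g j)))
    [seq w i | i <- enum 'I_n]
  = pair_sign (fun i j => [&& (i < j)%N, (w j < w i)%N, ~~ op i & ~~ op j]).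
Proof.
rewrite inversion_sign_map ?enum_sorted // /pair_sign big_enum; apply: eq_bigr => i _.
rewrite big_enum_cond big_mkcond; apply: eq_bigr => j _ /=.
by rewrite !permK negb_or; case: (i < j)%N.
Qed.

(** An inversion of two vertices that are not open roots counts in the sorting and
    in the sign of [w]; one of two open roots counts twice on the right. For an
    open root [i] and another vertex [j], the sign of [i] in [F] counts [j < i],
    that of [w i] in the relabelled forest counts [w j < w i], and they differ
    exactly when the pair is inverted. *)
Lemma equivariance_sign :
  (\prod_i open_factor C r F i) * inversion_sign C (fun i j => ~~ (op (w^-1%g i) || op (w^-1%g j)))
    [seq w i | i <- enum 'I_n]
  = (-1) ^+ odd_perm w * (-1) ^+ perm_sign_exp w F * \prod_i open_factor C r wF i.
Proof.
rewrite sorting_sign perm_sign_exp_sign !open_factors_sign.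
have -> : #|open_roots wF| = #|open_roots F| by apply: card_imset; apply: perm_inj.
rewrite mulrAC [RHS]mulrA; congr (_ * _).
rewrite -[pair_sign (fun i j => [&& _, _ \in open_roots wF & _])]pair_sign_perm.
have -> : (-1) ^+ odd_perm w = pair_sign (fun i j => (i < j)%N && (w j < w i)%N).
  rewrite sign_inversions; apply: eq_bigr => i _; rewrite big_mkcond; apply: eq_bigr => j _.
  by case: (i < j)%N.
have -> : pair_sign (fun i j => (i < j)%N && (w j < w i)%N)
    = pair_sign (fun i j => [&& (i < j)%N, (w j < w i)%N & op i || ~~ op j])
      * pair_sign (fun i j => [&& (j < i)%N, (w i < w j)%N, op i & ~~ op j]).
  rewrite [X in _ * X]pair_signC pair_signM; apply: eq_pair_sign => i j.
  by case: (i < j)%N; case: (w j < w i)%N; case: (op i); case: (op j).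
rewrite !pair_signM; apply: eq_pair_sign => i j; rewrite !open_perm.
have : (w j < w i)%N || (w i < w j)%N = (i < j)%N || (j < i)%N.
  by rewrite -!neq_ltn !(inj_eq val_inj) (inj_eq perm_inj) eq_sym.
case: (ltngtP i j) => _; case: (ltngtP (w i) (w j)) => _ //=;
  by case: (op i); case: (op j).
Qed.

Theorem perm_beta_bar : w \in stabilizer a -> F \in forests n ->
  perm_form w (beta_bar a C r F)
  = ((-1) ^+ odd_perm w * (-1) ^+ perm_sign_exp w F) *: beta_bar a C r wF.
Proof.
move=> wa FF; have Fphi := encodes_forest FF; have wFphi := encodes_perm w Fphi.
rewrite (@beta_bar_encoded C n a r _ _ Fphi) (@beta_bar_encoded C n a r _ _ wFphi) scalerA.
rewrite -equivariance_sign scaleE perm_form_fmul scaleE.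
set B := fun i => block X i _ _; set B' := fun i => block X i _ _.
have -> : perm_form w (foldr B (unit_form K n) (enum 'I_n))
    = foldr B' (unit_form K n) [seq w i | i <- enum 'I_n].
  elim: (enum 'I_n) => [|i s IH] /=; first exact: perm_form_unit.
  by rewrite -IH /B /B' permK weight_perm // perm_form_block.
have B'C k l alpha : B' k (B' l alpha)
    = fmul ((-1) ^+ ~~ (op (w^-1%g k) || op (w^-1%g l))) (B' l (B' k alpha)).
  rewrite /B' blockC -!(forest_code_open FF) /is_open.
  case: (forest_code F _) => [?|[]] /=; case: (forest_code F _) => [?|[]] /=;
    by rewrite ?fmulNl ?fmul1.
rewrite (fold_sort (fun k => blockZ X k _ _) B'C _ (enum_sorted n)); last first.
  apply: uniq_perm; rewrite ?(map_inj_uniq perm_inj) ?enum_uniq // => i.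
  by rewrite mem_enum -(permKV w i) map_f ?mem_enum.
rewrite fmulA; congr fmul; rewrite [RHS]rmorphM; congr (_ * _).
  exact: perm_ratfun_const.
exact: inversion_sign_rmorph.
Qed.
End Equivariance.

Theorem theorem4p5 (R : realType) (n : nat) (a : 'I_n -> rat) (r : nat)
    (n_gt0 : (0 < n)%N) (r_gt0 : (0 < r)%N)
    (ra_int : forall i, r%:R * a i \is a Num.int) :
  (forall p : nat,
    [/\ {subset Hspan a R[i] r p <= cocycles a p},
        exists2 phi : {linear subspace (Hspan a R[i] r p)
                               -> cohomology R[i] a p},
          (forall (x : subspace (Hspan a R[i] r p))
                  (y : subspace (cocycles a p)),
             subspace_val x = subspace_val y -> phi x = cohomology_class y)
          & bijective phi
      & is_basis (Hspan a R[i] r p) (rect_forests_deg a p) (beta_bar a R[i] r)])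
  /\ (forall (w : 'S_n) (k l : nat) (F : rooted_graph n),
        w \in stabilizer a -> F \in int_forests_kl a k l ->
        perm_form w (beta_bar a R[i] r F)
        = ((-1) ^+ odd_perm w * (-1) ^+ perm_sign_exp w F)
            *: beta_bar a R[i] r (perm_forest w F)).
Proof.
split=> [p|w k l F wa].
  split; [exact: (@Hspan_cocycle R[i] n a r p)| |exact: (@rect_basis R[i] n a r r_gt0 p)].
  exists (@Hclass R[i] n a r p); first exact: HclassE.
  exact: Hclass_bij.
rewrite inE => /andP[/int_forest_forest FF _].
exact: (@perm_beta_bar R[i]).
Qed.
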